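(* Let $\xi=(\xi_n)_{n\in\mathbb Z_+}$, $\xi_n=(X_n,\eta_n)$, be the time-homogeneous Markov process on the half-strip $\Sigma=\mathbb R_+\times S$ described in the context, with kernel $\mathcal K_s$. Suppose the following. (1) (Non-confinement) $\Pr(\limsup_{n\to\infty}X_n=\infty)=1$. (2) (Limiting kernel) $\mathcal K:S\times\mathcal B(S)\to[0,1]$ is a Markov kernel on $S$ that has a unique invariant probability measure $\pi\in\mathcal P(S)$, and $u\mapsto\mathcal K(u,\cdot)$ is continuous from $(S,d_S)$ to $(\mathcal P(S),d_{\mathrm{TV}})$. (3) (Strong asymptotic Markovianity) There is a continuous map $\Gamma:(S,d_S)\to(\mathcal M_\pm(S),d_{\mathrm{TV}})$, $u\mapsto\Gamma_u$, such that $\sup_{u\in S}\|\mathcal K_s^\circ(x,u,\cdot)-\mathcal K(u,\cdot)-x^{-1}\Gamma_u\|_{\mathrm{TV}}=o(x^{-1})$ as $x\to\infty$. (4) (Moments) There are constants $p>2$, $q>0$, $x_B\in\mathbb R_+$ and $B_p,B_q<\infty$ such that, for all $n\in\mathbb Z_+$, $\mathbb E[|X_{n+1}-X_n|^p\mid\mathcal F_n]\le B_p$ on $\{X_n\ge x_B\}$ and $\mathbb E[|X_{n+1}|^q\mid\mathcal F_n]\le B_q$ on $\{X_n<x_B\}$. (5) (Lamperti regime) There are $d,e,\sigma^2\in C_b(S)$ (values at $u$ written $d_u,e_u,\sigma_u^2$) such that, as $x\to\infty$, $\sup_{u\in S}|\mu_1(x,u)-(d_u+\frac{e_u}{x})|=o(x^{-1})$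 and $\sup_{u\in S}|\mu_2(x,u)-\sigma_u^2|=o(1)$; moreover $\int_Sd_u\,\pi(du)=0$. (6) (Conditional drifts) There are $\lambda_u\in M_b(S)$, $u\in S$, such that $u\mapsto\lambda_u$ is continuous from $(S,d_S)$ to $(M_b(S),d_\infty)$ and $\lim_{x\to\infty}\sup_{u,v\in S}|\mu_1^\circ(x,u,v)-\lambda_u(v)|=0$. Then there exists $\psi\in C_b(S)$, unique up to translation (addition of constants), with $\int_S(\psi(u)-\psi(v))\,\mathcal K(u,dv)=d_u$ for all $u\in S$. For $\theta\in\mathbb R$ define $$\tilde\delta_\theta:=2\int_S\Big[e_u+\int_S\psi(v)\,\Gamma_u(dv)\Big]\pi(du)+(2\theta-1)\int_S\Big[\sigma_u^2+2\int_S\lambda_u(v)\psi(v)\,\mathcal K(u,dv)\Big]\pi(du).$$ Then $\tilde\delta_\theta$ is invariant under translation of $\psi$, and $\tilde\delta_\theta\le\tilde\delta_{\theta'}$ whenever $\theta\le\theta'$. Furthermore: (a) $\xi$ is transient if $\tilde\delta_0>0$ and recurrent if $\tilde\delta_0<0$. (b) If, moreover, $q\ge2$, then $\xi$ is positive recurrent if $\tilde\delta_1<0$, while $\xi$ is null recurrent if $\tilde\delta_0<0<\tilde\delta_1$. Moreover, if it also holds that $\lim_{n\to\infty}\sup_{u\in S}\|\mathcal K^n(u,\cdot)-\pi(\cdot)\|_{\mathrm{TV}}=0$, then one may take $\psi\in C_b(S)$ given by the convergent series $\psi(u)=\sum_{n=0}^\infty\int_S\mathcal K^n(u,dv)\,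d_v$.
   Context: Notation: $\mathbb R_+=[0,\infty)$, $\mathbb Z_+=\{0,1,2,\dots\}$. $(S,d_S)$ is a compact metric space with Borel sets $\mathcal B(S)$; $\mathcal P(S)$ is the set of Borel probability measures on $S$, $\mathcal M_\pm(S)$ the set of finite signed Borel measures; $C_b(S)$ is the set of continuous real functions on $S$; $M_b(S)$ is the set of bounded measurable real functions on $S$ with metric $d_\infty(f,g)=\sup_{u\in S}|f(u)-g(u)|$. $\|\cdot\|_{\mathrm{TV}}$ is the total variation norm, $\|\nu\|_{\mathrm{TV}}=\sup\{\int f\,d\nu: f\in C_b(S),\ \sup|f|\le1\}$, and $d_{\mathrm{TV}}(\mu,\nu)=\frac12\|\mu-\nu\|_{\mathrm{TV}}$. A probability $\nu\in\mathcal P(S)$ is invariant for a Markov kernel $\mathcal K$ if $\nu(B)=\int_S\nu(du)\mathcal K(u,B)$ for all $B\in\mathcal B(S)$. $\mathcal K^n$ is the $n$-fold convolution: $\mathcal K^0(u,B)=\mathbf 1\{u\in B\}$, $\mathcal K^n(u,B)=\int_S\mathcal K(u,dv)\mathcal K^{n-1}(v,B)$. The process: on a probability space with filtration $(\mathcal F_n)_{n\in\mathbb Z_+}$, $\xi=(\xi_n)$ is an adapted process in $\Sigma=\mathbb R_+\times S$ with $\xi_n=(X_n,\eta_n)$, $X_n\in\mathbb R_+$, $\eta_n\in S$, and $\mathcal K_s$ is a Markov kernel on $\Sigma$ with $\Pr(\xi_{n+1}\in A\mid\mathcal F_n)=\mathcal K_s(\xi_n,A)$ a.s. for all Borel $A\subseteq\Sigma$,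 $n\in\mathbb Z_+$. The initial state $\xi_0=(x_0,u_0)\in\Sigma$ is deterministic but arbitrary. For $B\in\mathcal B(S)$, $\mathcal K_s^\circ(x,u,B):=\mathcal K_s((x,u),\mathbb R_+\times B)$. For $k\in\{1,2\}$ and $x\ge x_B$, $\mu_k(x,u):=\int_{\mathbb R_+\times S}(y-x)^k\,\mathcal K_s((x,u),d(y,v))$, so $\mathbb E[(X_{n+1}-X_n)^k\mid\mathcal F_n]=\mu_k(\xi_n)$ on $\{X_n\ge x_B\}$. The function $\mu_1^\circ:\Sigma\times S\to\mathbb R$ is the (measurable, essentially unique) conditional drift given the next $S$-coordinate: $\mu_1^\circ(x,u,v)=\int_{\mathbb R_+}(y-x)\,\mathcal L(x,u,v,dy)$, where $\mathcal L(x,u,v,\cdot)$ is a regular conditional distribution of $X_{n+1}$ given $(\xi_n,\eta_{n+1})=(x,u,v)$, i.e. $\mathcal K_s((x,u),d(y,v))=\mathcal K_s^\circ(x,u,dv)\mathcal L(x,u,v,dy)$; thus $\mu_1(x,u)=\int_S\mathcal K_s^\circ(x,u,dv)\,\mu_1^\circ(x,u,v)$. Definitions: $\tau_r:=\min\{n\in\mathbb Z_+:X_n\le r\}$ ($\min\emptyset:=\infty$). $\xi$ is transient if $\lim_{n}X_n=\infty$ a.s.; recurrent if there is $r_0\in\mathbb R_+$ with $\liminf_nX_n\le r_0$ a.s.; positive recurrent if there is $r_1\in\mathbb R_+$ with $\mathbb E\tau_r<\infty$ for all $r\ge r_1$; null recurrent if for every $r\in\mathbb R_+$ there is $r_1>r$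 such that $\mathbb E\tau_r=\infty$ whenever $x_0>r_1$ (a statement about the process with the given kernel started from such $x_0$). *)

(* Defs.v *)
From HB Require Import structures.
From mathcomp Require Import all_boot all_order all_algebra.
From mathcomp Require Import all_classical all_reals all_analysis.
From mathcomp Require Import measurable_realfun lebesgue_measure.

Set Implicit Arguments.
Unset Strict Implicit.
Unset Printing Implicit Defensive.

Import Order.TTheory GRing.Theory Num.Theory.
Import numFieldNormedType.Exports.

Local Open Scope classical_set_scope.
Local Open Scope ring_scope.

(* The library's measurable types carry a default point; for a metric space
   this only records that the space is nonempty. *)
#[short(type="pointedMetricType")]
HB.structure Definition PointedMetric (K : numDomainType) :=
  {M of Pointed M & Metric K M}.

Definition borel {R : realType} (S : pointedMetricType R) :=
  g_sigma_algebraType (@open S).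

Notation state R S := (R * borel S)%type.

Section markov_kernels.
Context d1 d2 (X : measurableType d1) (Y : measurableType d2) {R : realType}.
Variable k : R.-pker X ~> Y.

Definition kcharge (x : X) : set Y -> \bar R := k x.

Lemma kcharge0 x : kcharge x set0 = 0%E.
Proof. exact: measure0. Qed.

Lemma kcharge_fin x A : measurable A -> kcharge x A \is a fin_num.
Proof.
move=> mA; rewrite ge0_fin_numE; last exact: measure_ge0.
apply: (@le_lt_trans _ _ (k x [set: Y])); last by rewrite prob_kernel ltry.
by apply: le_measure; rewrite ?inE.
Qed.

Lemma kcharge_sigma_additive x : semi_sigma_additive (kcharge x).
Proof. exact: measure_semi_sigma_additive. Qed.

HB.instance Definition _ x := isCharge.Build _ Y R (kcharge x)
  (kcharge0 x) (@kcharge_fin x) (@kcharge_sigma_additive x).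

End markov_kernels.

Section kernel_iteration.
Context d (X : measurableType d) {R : realType}.

Section composition.
Variables k1 k2 : R.-pker X ~> X.

Lemma prob_mkcomp_noparam x : mkcomp_noparam k1 k2 x [set: X] = 1%E.
Proof.
rewrite /mkcomp_noparam /= /kcomp_noparam.
under eq_integral do rewrite prob_kernel.
by rewrite integral_cst// mul1e prob_kernel.
Qed.

HB.instance Definition _ := isProbabilityKernel.Build _ _ _ _ R
  (mkcomp_noparam k1 k2) prob_mkcomp_noparam.

Definition pkcomp : R.-pker X ~> X := mkcomp_noparam k1 k2.

End composition.

Fixpoint kiter (k : R.-pker X ~> X) (n : nat) : R.-pker X ~> X :=
  if n is m.+1 then pkcomp k (kiter k m) else kdirac (@measurable_id _ X [set: X]).

Definition invariant_probability (k : R.-pker X ~> X) (nu : probability X R) :=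
  forall B, measurable B -> nu B = (\int[nu]_u k u B)%E.

Definition unique_invariant_probability (k : R.-pker X ~> X)
    (nu : probability X R) :=
  invariant_probability k nu /\
  forall nu' : probability X R, invariant_probability k nu' ->
    forall B, measurable B -> nu' B = nu B.

End kernel_iteration.

Section charge_integral.
Context d (T : measurableType d) {R : realType}.
Variable nu : {charge set T -> \bar R}.

Lemma hahn_sets : {PN : set T * set T | hahn_decomposition nu PN.1 PN.2}.
Proof.
by apply: cid; have [P [N PN]] := Hahn_decomposition nu; exists (P, N).
Qed.

(* Independent of the chosen Hahn decomposition. *)
Definition charge_integral (f : T -> R) : R :=
  \int[jordan_pos (svalP hahn_sets)]_x f x - \int[jordan_neg (svalP hahn_sets)]_x f x.

End charge_integral.

Section total_variation.
Context {R : realType} {S : pointedMetricType R}.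
Implicit Types nu : {charge set (borel S) -> \bar R}.

Definition tv_norm nu : \bar R :=
  ereal_sup [set (charge_integral nu f)%:E |
    f in [set f : S -> R | continuous f /\ forall u, `|f u| <= 1]].

Definition tv_dist nu1 nu2 : \bar R :=
  ((2^-1)%:E * tv_norm (cadd nu1 (copp nu2)))%E.

Definition tv_continuous (nu : S -> {charge set (borel S) -> \bar R}) :=
  forall u, tv_dist (nu v) (nu u) @[v --> u] --> 0%E.

End total_variation.

Section bounded_measurable.
Context {R : realType} {S : pointedMetricType R}.

Definition bounded_measurable (f : S -> R) :=
  measurable_fun [set: borel S] (f : borel S -> R) /\
  exists M : R, forall u, `|f u| <= M.

Definition sup_dist (f g : S -> R) : \bar R :=
  ereal_sup [set (`|f u - g u|)%:E | u in [set: S]].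

End bounded_measurable.

(* sup_i f x i = o(g x) as x -> +oo, for nonnegative f and g; the supremum is
   taken in the extended reals, so that it is not a junk value when infinite. *)
Definition sup_littleo {R : realType} {I : Type} (f : R -> I -> \bar R)
    (g : R -> R) :=
  forall eps : R, 0 < eps -> \forall x \near +oo,
    (ereal_sup [set f x i | i in [set: I]] <= (eps * g x)%:E)%E.

Section filtered_space.
Context d (Omega : measurableType d) {R : realType}.
Variable P : probability Omega R.

Definition filtration (F : nat -> set (set Omega)) :=
  [/\ forall n, sigma_algebra [set: Omega] (F n),
      forall n, F n `<=` measurable &
      forall m n, (m <= n)%N -> F m `<=` F n].

(* Z is a version of E[Y | G], for Y >= 0 (not necessarily integrable). *)
Definition is_cond_exp (G : set (set Omega)) (Y Z : Omega -> \bar R) :=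
  [/\ forall w, (0 <= Z w)%E,
      forall B : set (\bar R), measurable B -> G (Z @^-1` B) &
      forall A, G A -> (\int[P]_(w in A) Z w = \int[P]_(w in A) Y w)%E].

(* E[Y | G] <= b a.s. on A. *)
Definition cond_exp_le_on (G : set (set Omega)) (Y : Omega -> \bar R)
    (A : set Omega) (b : R) :=
  exists2 Z, is_cond_exp G Y Z & {ae P, forall w, A w -> (Z w <= b%:E)%E}.

End filtered_space.

Section half_strip.
Context {R : realType} {S : pointedMetricType R}.

Definition half_strip : set (state R S) := [set z | 0 <= z.1].

(* A Markov kernel on the half-strip is encoded as a kernel on R * S that gives
   full mass to the half-strip from every point of it; its values at points
   outside the half-strip are irrelevant. *)
Definition half_strip_kernel (Ks : R.-pker (state R S) ~> (state R S)) :=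
  forall z, half_strip z -> Ks z half_strip = 1%E.

Definition half_strip_process d (Omega : measurableType d)
    (P : probability Omega R) (F : nat -> set (set Omega))
    (Ks : R.-pker (state R S) ~> (state R S)) (z0 : state R S)
    (xi : nat -> Omega -> state R S) :=
  [/\ filtration F,
      forall n A, measurable A -> F n (xi n @^-1` A),
      forall n w, half_strip (xi n w),
      forall w, xi 0%N w = z0 &
      forall n A, measurable A ->
        is_cond_exp P (F n) (fun w => (\1_A (xi n.+1 w))%:E)
          (fun w => Ks (xi n w) A)].

Section marginal.
Variable Ks : R.-pker (state R S) ~> (state R S).

(* For a half-strip kernel and z in the half-strip this is
   B |-> Ks z ([0, +oo[ x B). *)
Definition marginal_fun (z : state R S) : set (borel S) -> \bar R :=
  fun B => Ks z (snd @^-1` B).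

Lemma measurable_snd_preimage (B : set (borel S)) : measurable B ->
  measurable (snd @^-1` B : set (state R S)).
Proof. by move=> mB; rewrite -[X in measurable X]setTI; exact: measurable_snd. Qed.

Lemma marginal0 z : marginal_fun z set0 = 0%E.
Proof. by rewrite /marginal_fun preimage_set0 measure0. Qed.

Lemma marginal_ge0 z B : (0 <= marginal_fun z B)%E.
Proof. exact: measure_ge0. Qed.

Lemma marginal_sigma_additive z : semi_sigma_additive (marginal_fun z).
Proof.
move=> F mF tF mUF; rewrite /marginal_fun preimage_bigcup.
apply: measure_semi_sigma_additive.
- by move=> n; exact: measurable_snd_preimage.
- apply/trivIsetP => /= i j _ _ ij; rewrite -preimage_setI.
  by move/trivIsetP : tF => /(_ _ _ _ _ ij) ->//; rewrite preimage_set0.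
- by rewrite -preimage_bigcup; exact: measurable_snd_preimage.
Qed.

HB.instance Definition _ z := isMeasure.Build _ _ _ (marginal_fun z)
  (marginal0 z) (marginal_ge0 z) (@marginal_sigma_additive z).

Definition marginal_meas (z : state R S) :
  {measure set (borel S) -> \bar R} := marginal_fun z.

Lemma measurable_marginal_meas U : measurable U ->
  measurable_fun [set: state R S] (marginal_meas ^~ U).
Proof. by move=> mU; apply: measurable_kernel; exact: measurable_snd_preimage. Qed.

HB.instance Definition _ := isKernel.Build _ _ _ _ R
  marginal_meas measurable_marginal_meas.

Lemma prob_marginal_meas z : marginal_meas z [set: borel S] = 1%E.
Proof. by rewrite /marginal_meas /= /marginal_fun preimage_setT prob_kernel. Qed.

HB.instance Definition _ := Kernel_isProbability.Build _ _ _ _ R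
  marginal_meas prob_marginal_meas.

Definition marginal : R.-pker (state R S) ~> borel S := marginal_meas.

(* L(x, u, v, dy) is a regular conditional distribution of the first
   coordinate of Ks((x, u), .) given that the second one is v. *)
Definition disintegrates (L : R.-pker (state R S * borel S) ~> R) :=
  forall z, half_strip z -> forall (A : set R) (B : set (borel S)),
    measurable A -> measurable B ->
    Ks z (A `*` B) = (\int[marginal z]_(v in B) L (z, v) A)%E.

Definition increment_moment (k : nat) (x : R) (u : S) : \bar R :=
  (\int[Ks (x, u)]_(z in half_strip) ((z.1 - x) ^+ k)%:E)%E.

End marginal.

Definition cond_drift (L : R.-pker (state R S * borel S) ~> R)
    (x : R) (u v : S) : \bar R :=
  (\int[L ((x, u), v)]_(y in `[0%R, +oo[) (y - x)%:E)%E.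

Section classification.
Context {d : measure_display} {Omega : state R S -> measurableType d}.
Variables (P : forall z, probability (Omega z) R)
  (xi : forall z, nat -> Omega z -> state R S).

Definition non_confined := forall z, half_strip z ->
  {ae P z, forall w, limn_esup (fun n => ((xi n w).1)%:E) = +oo%E}.

Definition transient := forall z, half_strip z ->
  {ae P z, forall w, (xi n w).1 @[n --> \oo] --> +oo}.

Definition recurrent := exists2 r0 : R, 0 <= r0 &
  forall z, half_strip z ->
    {ae P z, forall w, (limn_einf (fun n => ((xi n w).1)%:E) <= r0%:E)%E}.

Definition passage_time (z : state R S) (r : R) (w : Omega z) : \bar R :=
  ereal_inf [set (n%:R)%:E | n in [set n : nat | (xi n w).1 <= r]].

Definition positive_recurrent := exists2 r1 : R, 0 <= r1 &
  forall r, r1 <= r -> forall z, half_strip z ->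
    (\int[P z]_w passage_time r w < +oo)%E.

Definition null_recurrent := forall r : R, 0 <= r -> exists2 r1, r < r1 &
  forall z, half_strip z -> r1 < z.1 ->
    (\int[P z]_w passage_time r w = +oo)%E.

End classification.

End half_strip.

Section poisson_equation.
Context {R : realType} {S : pointedMetricType R}.
Variables (K : R.-pker (borel S) ~> (borel S)) (pi : probability (borel S) R).
Variables (Gam : S -> {charge set (borel S) -> \bar R}).
Variables (dd ee sigma2 : S -> R) (lam : S -> S -> R).

Definition poisson_solution (psi : S -> R) :=
  continuous psi /\ forall u, \int[K u]_v (psi u - psi v) = dd u.

Definition delta (psi : S -> R) (theta : R) : R :=
  2 * (\int[pi]_u (ee u + charge_integral (Gam u) psi)) +
  (2 * theta - 1) *
    (\int[pi]_u (sigma2 u + 2 * (\int[K u]_v (lam u v * psi v)))).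

End poisson_equation.

(* Main.v *)
Require Import Defs.
From HB Require Import structures.
From mathcomp Require Import all_boot all_order all_algebra.
From mathcomp Require Import all_classical all_reals all_analysis.
From mathcomp Require Import measurable_realfun lebesgue_measure.
From mathcomp Require Import ring lra.

(* The Poisson equation psi - K psi = d is solved by Cesaro averages of the
   iterates of K: since K is continuous in total variation it turns bounded sets
   into equicontinuous ones, and uniqueness of pi makes continuous harmonic
   functions constant.  Adding psi(eta) to X removes the constant part d of the
   drift.  A second solution phi, of the Poisson equation for the drift of order
   1/x that remains, averages that drift over pi: for
   G = X + psi(eta) + phi(eta) / (X + 1) and increment D of G, uniformly in eta,
   G E[D] tends to delta_theta / 2 - (2 theta - 1) s(eta) / 2 and E[D^2] to
   s(eta), where pi(s) is the coefficient of 2 theta - 1 in delta_theta.  Thus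
   ln G (theta = 0), G^(-gamma) (theta = 0) and G^2 (theta = 1) are
   supermartingales far from 0 when delta_0 < 0, delta_0 > 0 and delta_1 < 0.
   When delta_1 > 0, N^4 / (N^2 + G^2) decreases in mean up to an error
   proportional to the time spent above eta N, which is incompatible with
   integrable passage times. *)

Set Implicit Arguments.
Unset Strict Implicit.
Unset Printing Implicit Defensive.

Import Order.TTheory GRing.Theory Num.Theory.
Import numFieldNormedType.Exports.

Local Open Scope classical_set_scope.
Local Open Scope ring_scope.

(** [theta] acts as an exponent. For a power f(x) = x^(2 theta) the mean increment of f(G) is, to
    leading order, 2 theta G^(2 theta - 2) times G E[D] + (2 theta - 1) E[D^2] / 2, and the
    logarithm stands for exponent 0. The correction [phi] is chosen so that exactly this combination
    has a limit, delta_theta / 2, that no longer depends on eta; so [phi] changes with [theta].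

    Three obstacles shape the rest. [K] may be periodic, so its iterates need not converge; averages
    do, and limits along an ultrafilter provide them without extracting subsequences. Moments exist
    only up to some order p > 2, possibly below 3, so Taylor expansions stop at order two and large
    jumps are paid for by truncated second moments, which decay like a power of the height. Finally,
    G^2 is unbounded, which blocks a direct optional stopping argument when delta_1 > 0; since N^4 /
    (N^2 + G^2) = N^2 - N^2 G^2 / (N^2 + G^2), the function used there is a bounded substitute for -
    G^2 whose values at two fixed heights stay apart as N grows. *)

Section mixture.
Context d1 d2 (X : measurableType d1) (Z : measurableType d2) {R : realType}.
Import HBNNSimple.
Local Open Scope ereal_scope.

(** Both sides are monotone limits along simple approximations of [f], for which the identity is
    [mE] and linearity. With suitable [k] it gives the change of variables (Dirac masses), the
    Markov property and disintegration. *)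
Lemma integral_mixture (mu : {measure set X -> \bar R}) (A : set X)
    (k : X -> {measure set Z -> \bar R}) (m : {measure set Z -> \bar R})
    (f : Z -> \bar R) :
  measurable A ->
  (forall B, measurable B -> measurable_fun [set: X] (k ^~ B)) ->
  (forall B, measurable B -> m B = \int[mu]_(x in A) k x B) ->
  (forall z, 0 <= f z) -> measurable_fun [set: Z] f ->
  \int[m]_z f z = \int[mu]_(x in A) \int[k x]_z f z.
Proof.
move=> mA mk mE f0 mf.
have mint (g : Z -> \bar R) : (forall z, 0 <= g z) ->
    measurable_fun [set: Z] g -> measurable_fun A (fun x => \int[k x]_z g z).
  by move=> g0 mg; apply: measurable_funTS; exact: measurable_fun_integral_kernel.
pose f_ := nnsfun_approx measurableT mf.
have simple (g : {nnsfun Z >-> R}) :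
    \int[m]_z (g z)%:E = \int[mu]_(x in A) \int[k x]_z (g z)%:E.
  have gE (n : {measure set Z -> \bar R}) : \int[n]_z (g z)%:E =
      \sum_(r \in range g) (r%:E * n (g @^-1` [set r])).
    rewrite integralT_nnsfun sintegralE; apply: eq_fsbigr => r _.
    by rewrite /=.
  rewrite gE.
  under [RHS]eq_integral do rewrite gE.
  rewrite ge0_integral_fsum//; last 2 first.
  - move=> r; apply: measurable_funeM; apply: measurable_funTS.
    by apply: mk.
  - move=> r x _; have [r0|r0] := leP 0%R r; first by rewrite mule_ge0.
    by rewrite preimage_nnfun0// measure0 mule0.
  apply: eq_fsbigr => r _; have [r0|r0] := leP 0%R r.
    rewrite mE// ge0_integralZl//.
    by apply: measurable_funTS; apply: mk.
  rewrite preimage_nnfun0// measure0 mule0 integral0_eq// => x _.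
  by rewrite measure0 mule0.
have intlim (n : {measure set Z -> \bar R}) :
    \int[n]_z (f_ i z)%:E @[i --> \oo] --> \int[n]_z f z.
  have := @cvg_monotone_convergence _ _ _ n _ measurableT
    (fun i z => (f_ i z)%:E).
  rewrite (_ : (fun x => limn _) = f); last first.
    by apply/funext => z; apply/cvg_lim => //; exact: cvg_nnsfun_approx.
  apply.
  - by move=> i; exact/measurable_EFinP.
  - by move=> i z _; rewrite lee_fin.
  - by move=> z _ a b ab; rewrite lee_fin; exact/lefP/nd_nnsfun_approx.
have := intlim m.
under eq_fun do rewrite simple.
move/cvg_lim => <-//.
apply/cvg_lim => //.
have := @cvg_monotone_convergence _ _ _ mu A mA
  (fun i x => \int[k x]_z (f_ i z)%:E).
rewrite (_ : (fun x => limn _) = (fun x => \int[k x]_z f z)); last first.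
  by apply/funext => x; apply/cvg_lim => //; exact: intlim.
apply.
- by move=> i; apply: mint => [z|]; [rewrite lee_fin|exact/measurable_EFinP].
- by move=> i x _; apply: integral_ge0 => z _; rewrite lee_fin.
- move=> x _ a b ab; apply: ge0_le_integral => //.
  + by move=> z _; rewrite lee_fin.
  + exact/measurable_EFinP.
  + exact/measurable_EFinP.
  + by move=> z _; rewrite lee_fin; exact/lefP/nd_nnsfun_approx.
Qed.

End mixture.

(** * Bounded measurable functions and their integrals *)

Section bounded_measurable_functions.
Context d (T : measurableType d) {R : realType}.

Definition bmeas (f : T -> R) :=
  measurable_fun [set: T] f /\ exists C : R, forall x, `|f x| <= C.

Lemma bmeas_cst (c : R) : bmeas (cst c).
Proof. by split; [exact: measurable_cst|exists `|c|]. Qed.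

Lemma bmeasD f g : bmeas f -> bmeas g -> bmeas (fun x => f x + g x).
Proof.
move=> [mf [C fC]] [mg [D gD]]; split; first exact: measurable_funD.
by exists (C + D) => x; rewrite (le_trans (ler_normD _ _))// lerD.
Qed.

Lemma bmeasM f g : bmeas f -> bmeas g -> bmeas (fun x => f x * g x).
Proof.
move=> [mf [C fC]] [mg [D gD]]; split; first exact: measurable_funM.
by exists (C * D) => x; rewrite normrM ler_pM.
Qed.

Lemma bmeasZ c f : bmeas f -> bmeas (fun x => c * f x).
Proof. by move=> bf; apply: bmeasM => //; exact: bmeas_cst. Qed.

Lemma bmeasB f g : bmeas f -> bmeas g -> bmeas (fun x => f x - g x).
Proof.
move=> [mf [C fC]] [mg [D gD]]; split; first exact: measurable_funB.
by exists (C + D) => x; rewrite (le_trans (ler_normB _ _))// lerD.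
Qed.

Lemma bmeas_integrable (mu : {measure set T -> \bar R}) f :
  (mu setT < +oo)%E -> bmeas f -> mu.-integrable [set: T] (EFin \o f).
Proof.
move=> muoo [mf [C fC]]; apply: measurable_bounded_integrable => //.
by exists C; split; [exact: num_real|move=> M CM x _ /=; rewrite (le_trans (fC x))// ltW].
Qed.

Lemma EFin_Rintegral (mu : {measure set T -> \bar R}) (f : T -> R) :
  mu.-integrable [set: T] (EFin \o f) ->
  (\int[mu]_x f x)%:E = (\int[mu]_x (f x)%:E)%E.
Proof. by move=> fi; rewrite /Rintegral fineK//; exact: integrable_fin_num. Qed.

End bounded_measurable_functions.
Arguments bmeas_cst {d T R} c.

(** The lemmas that follow are stated for a plain measure of mass one, so that they apply to the
    values [k x] of a kernel; this supplies their hypothesis for a bundled probability. *)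
Lemma prob_setT d (T : measurableType d) {R : realType} (mu : probability T R) :
  (mu : {measure set T -> \bar R}) [set: T] = 1%E.
Proof. exact: probability_setT. Qed.

Section unit_mass.
Context d (T : measurableType d) {R : realType}.
Variable mu : {measure set T -> \bar R}.
Hypothesis mu1 : mu setT = 1%E.
Implicit Types f g : T -> R.

Lemma mass1_lty : (mu setT < +oo)%E. Proof. by rewrite mu1 ltry. Qed.

Lemma mass1_fin A : measurable A -> mu A \is a fin_num.
Proof.
move=> mA; rewrite ge0_fin_numE//; apply: le_lt_trans mass1_lty.
by apply: le_measure; rewrite ?inE.
Qed.

Lemma bint f : bmeas f -> mu.-integrable [set: T] (EFin \o f).
Proof. by apply: bmeas_integrable; exact: mass1_lty. Qed.

Lemma bint_cst c : \int[mu]_x c = c.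
Proof. by rewrite Rintegral_cst// mu1 mulr1. Qed.

Lemma bintD f g : bmeas f -> bmeas g ->
  \int[mu]_x (f x + g x) = \int[mu]_x f x + \int[mu]_x g x.
Proof. by move=> bf bg; rewrite RintegralD//; exact: bint. Qed.

Lemma bintB f g : bmeas f -> bmeas g ->
  \int[mu]_x (f x - g x) = \int[mu]_x f x - \int[mu]_x g x.
Proof. by move=> bf bg; rewrite RintegralB//; exact: bint. Qed.

Lemma bintZ c f : bmeas f -> \int[mu]_x (c * f x) = c * \int[mu]_x f x.
Proof. by move=> bf; rewrite RintegralZl//; exact: bint. Qed.

Lemma le_bint f g : bmeas f -> bmeas g -> (forall x, f x <= g x) ->
  \int[mu]_x f x <= \int[mu]_x g x.
Proof. by move=> bf bg fg; apply: le_Rintegral => //; exact: bint. Qed.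

Lemma bint_norm_le f C : measurable_fun setT f -> (forall x, `|f x| <= C) ->
  `|\int[mu]_x f x| <= C.
Proof.
move=> mf fC; have bf : bmeas f by split => //; exists C.
apply: le_trans (le_normr_Rintegral _ _) _ => //; first exact: bint.
rewrite -[leRHS]bint_cst; apply: le_bint => //; last exact: bmeas_cst.
by split; [exact: measurableT_comp|exists C => x; rewrite normr_id].
Qed.

End unit_mass.

Section bounded_mixture.
Context d1 d2 (X : measurableType d1) (Z : measurableType d2) {R : realType}.

(* Subtracting a constant reduces bounded functions to nonnegative ones. *)
Lemma measurable_Rintegral_kernel (k : R.-pker X ~> Z) (f : Z -> R) :
  bmeas f -> bmeas (fun x => \int[k x]_z f z).
Proof.
move=> [mf [C fC]]; have bf : bmeas f by split => //; exists C.
have k1 x : k x setT = 1%E by exact: prob_kernel.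
split; last by exists C => x; exact: (bint_norm_le (k1 x)).
have E x : \int[k x]_z f z = fine (\int[k x]_z (f z + C)%:E)%E - C.
  have -> : fine (\int[k x]_z (f z + C)%:E)%E = \int[k x]_z (f z + C) by [].
  by rewrite (bintD (k1 x) bf (bmeas_cst C)) (bint_cst (k1 x)) addrK.
rewrite (_ : (fun x => _) = (fun x => fine (\int[k x]_z (f z + C)%:E)%E - C)); last first.
  exact/funext.
apply: measurable_funB => //.
apply: measurableT_comp => //.
apply: measurable_fun_integral_kernel.
- by move=> U mU; exact: measurable_kernel.
- by move=> z; rewrite lee_fin -lerBlDr sub0r; have := fC z; rewrite ler_norml => /andP[].
- by apply/measurable_EFinP; exact: measurable_funD.
Qed.

Lemma Rintegral_mixture (mu : {measure set X -> \bar R}) (k : R.-pker X ~> Z)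
    (m : {measure set Z -> \bar R}) (f : Z -> R) : mu setT = 1%E ->
  (forall B, measurable B -> m B = (\int[mu]_x k x B)%E) -> bmeas f ->
  \int[m]_z f z = \int[mu]_x \int[k x]_z f z.
Proof.
move=> mu1 mE bf; have [mf [C fC]] := bf.
have m1 : m setT = 1%E.
  by rewrite mE//; under eq_integral do rewrite prob_kernel; rewrite integral_cst// mul1e.
have k1 x : k x setT = 1%E by exact: prob_kernel.
have bC := bmeas_cst C : bmeas (cst C : Z -> R).
apply: (@addIr _ C).
rewrite -{1}(bint_cst m1 C) -bintD//.
rewrite -[X in _ = _ + X](bint_cst mu1) -bintD//; last first.
- exact: bmeas_cst.
- exact: measurable_Rintegral_kernel.
rewrite {1}/Rintegral (@integral_mixture _ _ _ _ _ mu setT k m)//.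
- congr fine; apply: eq_integral => x _; rewrite -EFin_Rintegral//.
    by rewrite (bintD (k1 x))// (bint_cst (k1 x)).
  by apply: bint; [exact: k1|exact: bmeasD].
- by move=> B mB; exact: measurable_kernel.
- by move=> z; rewrite lee_fin -lerBlDr sub0r; have := fC z; rewrite ler_norml => /andP[].
- by apply/measurable_EFinP; exact: measurable_funD.
Qed.

End bounded_mixture.

(** * Charges and total variation *)

Section charge_integral_theory.
Context d (T : measurableType d) {R : realType}.
Implicit Types (nu : {charge set T -> \bar R}) (f : T -> R).

Lemma finite_measure_lty (m : {finite_measure set T -> \bar R}) :
  (m setT < +oo)%E.
Proof. by rewrite -ge0_fin_numE// fin_num_measure. Qed.

Lemma measure_addEm (m1 m2 : {measure set T -> \bar R}) A :
  (measure_add m1 m2 : {measure set T -> \bar R}) A = (m1 A + m2 A)%E.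
Proof. exact: measure_addE. Qed.

Lemma measure_add_lty (m1 m2 : {finite_measure set T -> \bar R}) :
  (measure_add m1 m2 setT < +oo)%E.
Proof.
rewrite measure_addE -ge0_fin_numE; last by apply: adde_ge0; exact: measure_ge0.
by rewrite fin_numD !fin_num_measure.
Qed.

Lemma Rintegral_measure_add (m1 m2 : {finite_measure set T -> \bar R}) f :
  bmeas f ->
  \int[measure_add m1 m2]_x f x = \int[m1]_x f x + \int[m2]_x f x.
Proof.
move=> bf; have mf : measurable_fun setT (EFin \o f).
  by apply/measurable_EFinP; case: bf.
have if1 := bmeas_integrable (finite_measure_lty m1) bf.
have if2 := bmeas_integrable (finite_measure_lty m2) bf.
have if12 := bmeas_integrable (measure_add_lty m1 m2) bf.
by apply/EFin_inj; rewrite EFinD !EFin_Rintegral// integral_measure_add.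
Qed.

(** From p - n = m1 - m2, all four finite, follows p + m2 = n + m1 as measures; integrating [f] and
    rearranging frees the integral from the Hahn decomposition. The rules below for sums, opposites
    and multiples each exhibit a suitable pair of measures. *)
Lemma charge_integralE nu (m1 m2 : {measure set T -> \bar R}) f :
  (m1 setT < +oo)%E -> (m2 setT < +oo)%E ->
  (forall A, measurable A -> nu A = m1 A - m2 A)%E ->
  bmeas f -> charge_integral nu f = \int[m1]_x f x - \int[m2]_x f x.
Proof.
move=> m1oo m2oo nuE bf; rewrite /charge_integral.
set PN := svalP _; set p := jordan_pos PN; set n := jordan_neg PN.
have if1 := bmeas_integrable m1oo bf.
have if2 := bmeas_integrable m2oo bf.
have ifp : p.-integrable setT (EFin \o f) by apply: bmeas_integrable => //; exact: finite_measure_lty.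
have ifn : n.-integrable setT (EFin \o f) by apply: bmeas_integrable => //; exact: finite_measure_lty.
have mf : measurable_fun setT (EFin \o f) by apply/measurable_EFinP; case: bf.
have fin (m : {measure set T -> \bar R}) A : (m setT < +oo)%E -> measurable A ->
    m A \is a fin_num.
  move=> moo mA; rewrite ge0_fin_numE ?measure_ge0//.
  by apply: le_lt_trans moo; apply: le_measure; rewrite ?inE.
have H : (\int[measure_add p m2]_x (f x)%:E = \int[measure_add n m1]_x (f x)%:E)%E.
  apply: eq_measure_integral => A mA _.
  transitivity (p A + m2 A)%E; first exact: measure_addE.
  transitivity (n A + m1 A)%E; last exact/esym/measure_addE.
  have pnE : nu A = (p A - n A)%E.
    by rewrite (jordan_decomp PN mA) /cadd/= cscaleN1.
  have := nuE A mA; rewrite pnE.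
  rewrite -(fineK (fin m1 A m1oo mA)) -(fineK (fin m2 A m2oo mA)).
  have fp : p A \is a fin_num by exact: fin_num_measure.
  have fn : n A \is a fin_num by exact: fin_num_measure.
  rewrite -(fineK fp) -(fineK fn).
  by rewrite -!EFinD => -[E]; congr EFin; clear -E; lra.
move: H; rewrite !integral_measure_add//.
rewrite -!EFin_Rintegral// -!EFinD => -[E].
have cross (a b c e : R) : a + b = c + e -> a - c = e - b by move=> ?; lra.
exact: cross.
Qed.

Lemma charge_integral_jordan nu : exists m1 m2 : {finite_measure set T -> \bar R},
  (forall A, measurable A -> nu A = m1 A - m2 A)%E /\
  forall f, charge_integral nu f = \int[m1]_x f x - \int[m2]_x f x.
Proof.
set PN := svalP (hahn_sets nu); exists (jordan_pos PN), (jordan_neg PN).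
split=> // A mA.
by rewrite (jordan_decomp PN mA) /cadd/= cscaleN1.
Qed.

Lemma charge_integral_cadd nu1 nu2 f : bmeas f ->
  charge_integral (cadd nu1 nu2) f =
  charge_integral nu1 f + charge_integral nu2 f.
Proof.
move=> bf.
have [p1 [n1 [nu1E ->]]] := charge_integral_jordan nu1.
have [p2 [n2 [nu2E ->]]] := charge_integral_jordan nu2.
rewrite (charge_integralE (measure_add_lty p1 p2) (measure_add_lty n1 n2) _ bf).
  by rewrite !Rintegral_measure_add//; lra.
move=> A mA; transitivity (nu1 A + nu2 A)%E; first by [].
transitivity ((p1 A + p2 A) - (n1 A + n2 A))%E; last by rewrite !measure_addEm.
rewrite nu1E// nu2E//.
rewrite -(fineK (fin_num_measure p1 A mA)) -(fineK (fin_num_measure n1 A mA)).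
rewrite -(fineK (fin_num_measure p2 A mA)) -(fineK (fin_num_measure n2 A mA)).
by rewrite -!EFinD; congr EFin; lra.
Qed.

Lemma charge_integral_copp nu f : bmeas f ->
  charge_integral (copp nu) f = - charge_integral nu f.
Proof.
move=> bf.
have [p [n [nuE ->]]] := charge_integral_jordan nu.
rewrite (@charge_integralE _ n p)//.
- by rewrite opprB.
- exact: finite_measure_lty.
- exact: finite_measure_lty.
move=> A mA; transitivity (- nu A)%E; first by [].
transitivity (n A - p A)%E; last by [].
rewrite nuE//.
rewrite -(fineK (fin_num_measure p A mA)) -(fineK (fin_num_measure n A mA)).
by apply: (congr1 EFin (_ : - (_ - _) = _ - _)); lra.
Qed.

Lemma charge_integral_cscale r nu f : 0 <= r -> bmeas f ->
  charge_integral (cscale r nu) f = r * charge_integral nu f.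
Proof.
move=> r0 bf.
have [p [n [nuE ->]]] := charge_integral_jordan nu.
have sE (m : {finite_measure set T -> \bar R}) :
    \int[mscale (NngNum r0) m]_x f x = r * \int[m]_x f x.
  have fm : measurable_fun setT (EFin \o f).
    by apply/measurable_EFinP; case: bf.
  have if1 := bmeas_integrable (finite_measure_lty m) bf.
  rewrite /Rintegral [in LHS]integralE.
  rewrite !ge0_integral_mscale//; [|exact: measurable_funeneg|exact: measurable_funepos].
  rewrite /= [in RHS]integralE.
  have := integrable_fin_num measurableT (integrable_funepos measurableT if1).
  have := integrable_fin_num measurableT (integrable_funeneg measurableT if1).
  move=> f1 f2; rewrite -(fineK f1) -(fineK f2).
  by rewrite /=; lra.
have soo (m : {finite_measure set T -> \bar R}) :
    (mscale (NngNum r0) m setT < +oo)%E.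
  rewrite /mscale/= -ge0_fin_numE; last by rewrite mule_ge0.
  by rewrite fin_numM// fin_num_measure.
rewrite (charge_integralE (soo p) (soo n) _ bf).
  by rewrite !sE; lra.
move=> A mA; transitivity (r%:E * nu A)%E; first by [].
transitivity (r%:E * p A - r%:E * n A)%E; last by [].
rewrite nuE//.
rewrite -(fineK (fin_num_measure p A mA)) -(fineK (fin_num_measure n A mA)).
by apply: (congr1 EFin (_ : _ * (_ - _) = _ * _ - _ * _)); lra.
Qed.

Lemma charge_integral_measure nu (m : {finite_measure set T -> \bar R}) f :
  (forall A, measurable A -> nu A = m A) -> bmeas f ->
  charge_integral nu f = \int[m]_x f x.
Proof.
move=> nuE bf.
have zoo : ((mzero : {measure set T -> \bar R}) setT < +oo)%E by rewrite /mzero ltry.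
rewrite (charge_integralE (finite_measure_lty m) zoo _ bf).
  by rewrite {2}/Rintegral integral_measure_zero subr0.
by move=> A mA; rewrite nuE// /mzero sube0.
Qed.

Lemma bmeas_cvg (f_ : nat -> T -> R) f (C : R) :
  (forall n, measurable_fun setT (f_ n)) -> (forall n x, `|f_ n x| <= C) ->
  (forall x, f_ n x @[n --> \oo] --> f x) ->
  measurable_fun setT f /\ forall x, `|f x| <= C.
Proof.
move=> mf fC ff; split.
  by apply: (@measurable_fun_cvg _ _ _ _ f_) => // x _; exact: ff.
move=> x; apply: (cvgr_to_le (cvg_norm (ff x))).
by apply: nearW => n; exact: fC.
Qed.

Lemma Rintegral_dominated_cvg (mu : {measure set T -> \bar R})
    (f_ : nat -> T -> R) f (C : R) : (mu setT < +oo)%E ->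
  (forall n, measurable_fun setT (f_ n)) -> (forall n x, `|f_ n x| <= C) ->
  (forall x, f_ n x @[n --> \oo] --> f x) ->
  \int[mu]_x f_ n x @[n --> \oo] --> \int[mu]_x f x.
Proof.
move=> muoo mf fC ff.
have [mlim fC'] := bmeas_cvg mf fC ff.
have bf : bmeas f by split => //; exists C.
apply: fine_cvg; rewrite EFin_Rintegral; last exact: bmeas_integrable.
apply: (@dominated_cvg _ _ _ mu setT measurableT (fun n x => (f_ n x)%:E)
   (fun x => (f x)%:E) (cst C%:E)) => //.
- by move=> n; exact/measurable_EFinP.
- by move=> x _; apply: cvg_EFin; [exact: nearW|exact: ff].
- exact: (bmeas_integrable muoo (bmeas_cst C)).
- by move=> n x _; rewrite lee_fin.
Qed.

End charge_integral_theory.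

Section borel_sets.
Context {R : realType} {S : pointedMetricType R}.
Implicit Types f : S -> R.

Lemma continuous_borel f : continuous f -> measurable_fun [set: borel S] (f : borel S -> R).
Proof.
move=> cf; apply: (measurability _ (RGenOpens.measurableE R)) => //.
move=> _ [_ [x [y ->]] <-]; rewrite setTI; apply: sub_sigma_algebra.
by apply: open_comp; [move=> z _; exact: cf|exact: interval_open].
Qed.

Lemma compact_bounded_fun f : compact [set: S] -> continuous f ->
  exists2 C : R, 0 <= C & forall u, `|f u| <= C.
Proof.
move=> cS cf; have [|||c _ cmax] := @compact_EVT_max S R (fun u => `|f u|) setT => //.
- by exists point.
- apply: continuous_subspaceT => x; apply: continuous_comp; first exact: cf.
  exact: norm_continuous.
by exists `|f c| => // u; apply: cmax; rewrite inE.
Qed.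

Lemma bmeas_continuous f : compact [set: S] -> continuous f ->
  bmeas (f : borel S -> R).
Proof.
move=> cS cf; split; first exact: continuous_borel.
by have [C _ fC] := compact_bounded_fun cS cf; exists C.
Qed.

(** With [dl] the distance to the complement truncated at 1, the functions 1 - (1 - dl)^n vanish off
    [O] and increase to 1 on it. An empty complement is treated apart, because the infimum defining
    the distance would then range over the empty set. *)
Lemma open_indic_approx (O : set S) : open O ->
  exists2 h : nat -> S -> R, (forall n, continuous (h n) /\ forall u, 0 <= h n u <= 1) &
    forall u, h n u @[n --> \oo] --> (\1_O u : R).
Proof.
move=> oO; case: (eqVneq (~` O) set0) => [cO0|/set0P[a0 Oa0]].
  exists (fun _ _ => 1).
    by move=> n; split=> u; [exact: cvg_cst|rewrite ler01 lexx].
  have -> : O = setT by rewrite -(setCK O) cO0 setC0.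
  by move=> u; rewrite indicT; exact: cvg_cst.
pose D (u : S) : R := inf [set mdist u a | a in ~` O].
have hasD u : has_inf [set mdist u a | a in ~` O].
  split; first by exists (mdist u a0), a0.
  by exists 0 => _ [a _ <-]; exact: mdist_ge0.
have D0 u : 0 <= D u.
  by apply: lb_le_inf; [by case: (hasD u)|move=> _ [a _ <-]; exact: mdist_ge0].
have Dle u a : ~ O a -> D u <= mdist u a.
  by move=> Oa; apply: ge_inf; [by case: (hasD u)|exists a].
have Dlip u v : D u <= mdist u v + D v.
  rewrite -lerBlDl; apply: lb_le_inf; first by case: (hasD v).
  move=> _ [a Oa <-]; rewrite lerBlDl.
  by apply: (le_trans (Dle u a Oa)); exact: metric_triangle.
have cD : continuous D.
  move=> u; apply/cvgrPdist_lt => r r0.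
  have : nbhs u (ball u r) by exact: nbhsx_ballx.
  apply: filterS => v; rewrite ballEmdist/= => uv.
  have := Dlip u v; have := Dlip v u; rewrite (metric_sym v u) ltr_norml => h1 h2.
  by apply/andP; split; lra.
pose dl u : R := Num.min (D u) 1.
have dl01 u : 0 <= dl u <= 1.
  by rewrite /dl le_min D0 ler01 ge_min lexx orbT.
have cdl : continuous dl.
  by move=> u; apply: (@continuous_min _ _ D (cst 1)); [exact: cD|exact: cvg_cst].
have dlO u : O u -> 0 < dl u.
  move=> Ou; have /nbhs_ballP[r /= r0 rO] : nbhs u O by exact: open_nbhs_nbhs.
  rewrite lt_min ltr01 andbT (lt_le_trans r0)//.
  apply: lb_le_inf; first by case: (hasD u).
  move=> _ [a Oa <-]; rewrite leNgt; apply/negP => ua; apply: Oa; apply: rO.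
  by rewrite ballEmdist.
have dlC u : ~ O u -> dl u = 0.
  move=> Ou; apply/eqP; rewrite eq_le; have /andP[-> _] := dl01 u.
  by rewrite andbT ge_min -(mdistxx u) Dle.
exists (fun n u => 1 - (1 - dl u) ^+ n).
  move=> n; split=> u.
    apply: cvgB; first exact: cvg_cst.
    apply: (@continuous_comp _ _ _ (fun u => 1 - dl u) (fun x => x ^+ n)).
      by apply: cvgB; [exact: cvg_cst|exact: cdl].
    exact: exprn_continuous.
  have /andP[d0 d1] := dl01 u.
  have p0 : 0 <= (1 - dl u) ^+ n by rewrite exprn_ge0// subr_ge0.
  have p1 : (1 - dl u) ^+ n <= 1.
    by rewrite exprn_ile1 ?subr_ge0// lerBlDr lerDl.
  by apply/andP; split; lra.
move=> u; rewrite indicE; have [Ou|Ou] := pselect (O u).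
  rewrite mem_set//= -[X in _ --> X]subr0; apply: cvgB; first exact: cvg_cst.
  apply: cvg_expr; have /andP[d0 d1] := dl01 u.
  by rewrite ger0_norm ?subr_ge0// gtrBl dlO.
rewrite memNset//= dlC// subr0; under eq_fun do rewrite expr1n subrr.
exact: cvg_cst.
Qed.

Section L1_approximation.
Variable mu : {measure set (borel S) -> \bar R}.
Hypothesis muoo : (mu setT < +oo)%E.

(** The approximants stay in [0, 1] so that 2 g - 1 is an admissible test function for [tv_norm]. *)
Definition cont_approx (f : S -> R) := forall e : R, 0 < e ->
  exists2 g : S -> R, continuous g /\ (forall u, 0 <= g u <= 1) &
    \int[mu]_u `|f u - g u| <= e.

Lemma cont_approx_lim (f_ : nat -> S -> R) (f : S -> R) :
  (forall n, measurable_fun [set: borel S] (f_ n : borel S -> R)) ->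
  (forall n u, 0 <= f_ n u <= 1) ->
  (forall n, cont_approx (f_ n)) -> (forall u, f_ n u @[n --> \oo] --> f u) ->
  cont_approx f.
Proof.
move=> mf f01 fa ff e e0.
have fN n u : `|f_ n u| <= 1.
  by have /andP[? ?] := f01 n u; rewrite ger0_norm.
have [mlim f1] := @bmeas_cvg _ (borel S) R f_ f 1 mf fN ff.
have md n : measurable_fun [set: borel S] ((fun u => `|f u - f_ n u|) : borel S -> R).
  by apply: measurableT_comp => //; exact: measurable_funB.
have dN n u : `| `|f u - f_ n u| | <= 2.
  by rewrite normr_id (le_trans (ler_normB _ _))// (_ : 2 = 1 + 1) ?lerD//; lra.
have dcv u : `|f u - f_ n u| @[n --> \oo] --> 0.
  rewrite -(normr0 R) -(subrr (f u)); apply: cvg_norm.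
  by apply: cvgB; [exact: cvg_cst|exact: ff].
have := @Rintegral_dominated_cvg _ (borel S) R mu _ _ 2 muoo md dN dcv.
rewrite (_ : \int[mu]_(x in setT) 0 = 0); last first.
  by rewrite Rintegral_cst// mul0r.
move=> /cvgrPdist_lt/(_ (e / 2)); rewrite divr_gt0// => /(_ isT)[n _ /(_ n (leqnn n))]/=.
rewrite sub0r normrN => nlt.
have [|g [cg g01] gle] := fa n (e / 2); first by rewrite divr_gt0.
exists g => //.
have gN u : `|g u| <= 1 by have /andP[? ?] := g01 u; rewrite ger0_norm.
have mg : measurable_fun [set: borel S] (g : borel S -> R) by exact: continuous_borel.
have b1 : bmeas ((fun u => `|f u - f_ n u|) : borel S -> R) by split=> //; exists 2.
have b2 : bmeas ((fun u => `|f_ n u - g u|) : borel S -> R).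
  split; first by apply: measurableT_comp => //; exact: measurable_funB.
  exists 2 => u.
  by rewrite normr_id (le_trans (ler_normB _ _))// (_ : 2 = 1 + 1) ?lerD//; lra.
have b3 : bmeas ((fun u => `|f u - g u|) : borel S -> R).
  split; first by apply: measurableT_comp => //; exact: measurable_funB.
  exists 2 => u.
  by rewrite normr_id (le_trans (ler_normB _ _))// (_ : 2 = 1 + 1) ?lerD//; lra.
apply: (@le_trans _ _ (\int[mu]_u (`|f u - f_ n u| + `|f_ n u - g u|))).
  apply: le_Rintegral => //; try exact: bmeas_integrable.
    by apply: bmeas_integrable => //; exact: bmeasD.
  by move=> u _; rewrite (le_trans _ (ler_normD _ _))// addrA subrK.
rewrite RintegralD//; try exact: bmeas_integrable.
rewrite [leRHS](splitr e) lerD// (le_trans _ (ltW nlt))// ler_norm//.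
Qed.

Lemma cont_approx_continuous (g : S -> R) :
  continuous g -> (forall u, 0 <= g u <= 1) -> cont_approx g.
Proof.
move=> cg g01 e e0; exists g => //.
under eq_Rintegral do rewrite subrr normr0.
by rewrite Rintegral_cst// mul0r ltW.
Qed.

Lemma cont_approxU (A B : set (borel S)) : measurable A -> measurable B ->
  cont_approx (\1_A) -> cont_approx (\1_B) -> cont_approx (\1_(A `|` B)).
Proof.
move=> mA mB aA aB e e0.
have [|g [cg g01] gle] := aA (e / 2); first by rewrite divr_gt0.
have [|h [ch h01] hle] := aB (e / 2); first by rewrite divr_gt0.
(* The approximant is 1 - (1 - g)(1 - h), which stays in [0, 1]. The error splits as (1_A - g)(1 -
   1_B) + (1_B - h)(1 - g), and the second factors are in [0, 1]. *)
have gh01 u : 0 <= g u + h u - g u * h u <= 1.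
  have := g01 u; have := h01 u; move=> /andP[h0 h1] /andP[g0 g1].
  apply/andP; split; first by nra.
  by rewrite -subr_ge0; have := mulr_ge0 (_ : 0 <= 1 - g u) (_ : 0 <= 1 - h u); rewrite !subr_ge0; nra.
exists (fun u => g u + h u - g u * h u).
  split=> // u; apply: cvgB; first by apply: cvgD; [exact: cg|exact: ch].
  by apply: cvgM; [exact: cg|exact: ch].
have mi (C : set (borel S)) (k : S -> R) : measurable C -> continuous k ->
    (forall u, 0 <= k u <= 1) ->
    bmeas ((fun u => `|\1_C u - k u|) : borel S -> R).
  move=> mC ck k01; split.
    apply: measurableT_comp => //; apply: measurable_funB => //.
    exact: continuous_borel.
  exists 2 => u; rewrite normr_id (le_trans (ler_normB _ _))//.
  have /andP[? ?] := k01 u.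
  rewrite (_ : 2 = 1 + 1)//; apply: lerD; last by rewrite ger0_norm.
  by rewrite indicE; case: (_ \in _); rewrite ?normr1 ?normr0.
apply: (@le_trans _ _ (\int[mu]_u (`|\1_A u - g u| + `|\1_B u - h u|))).
  apply: le_Rintegral => //.
  - apply: bmeas_integrable => //; apply: mi => //; first exact: measurableU.
    move=> u; apply: cvgB; first by apply: cvgD; [exact: cg|exact: ch].
    by apply: cvgM; [exact: cg|exact: ch].
  - by apply: bmeas_integrable => //; apply: bmeasD; apply: mi.
  move=> u _; have /andP[g0 g1] := g01 u.
  have i01 (C : set S) : 0 <= (\1_C u : R) <= 1.
    by rewrite indicE; case: (_ \in C); rewrite ?lexx ?ler01.
  have /andP[b0 b1] := i01 B.
  rewrite (_ : _ - _ = (\1_A u - g u) * (1 - \1_B u) + (\1_B u - h u) * (1 - g u)).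
    rewrite (le_trans (ler_normD _ _))// !normrM lerD// ler_piMr//.
      by rewrite ger0_norm ?subr_ge0// lerBlDr lerDl.
    by rewrite ger0_norm ?subr_ge0// lerBlDr lerDl.
  have -> : (\1_(A `|` B) u : R) = \1_A u + \1_B u - \1_A u * \1_B u.
    by rewrite !indicE in_setU; case: (_ \in A); case: (_ \in B) => /=; lra.
  by ring.
rewrite RintegralD//; [|by apply: bmeas_integrable => //; apply: mi..].
by rewrite [leRHS](splitr e) lerD.
Qed.

(** The sets with this property form a sigma-algebra containing the open sets. Countable unions are
    limits of finite ones, handled by [cont_approxU] and dominated convergence. *)
Lemma cont_approx_measurable (A : set (borel S)) :
  measurable A -> cont_approx (\1_A).
Proof.
pose G : set (set S) := [set A | measurable (A : set (borel S)) /\ cont_approx (\1_A)].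
suff : <<s @open S >> `<=` G by move=> sG mA; have [] := sG A mA.
have i01 (C : set S) u : 0 <= (\1_C u : R) <= 1.
  by rewrite indicE; case: (_ \in C); rewrite ?lexx ?ler01.
have G0 : G set0.
  split=> //; rewrite (_ : \1_set0 = fun=> 0); last first.
    by apply/funext => u; rewrite indicE in_set0.
  apply: cont_approx_continuous; first by move=> u; exact: cvg_cst.
  by move=> u; rewrite lexx ler01.
have GU B1 B2 : G B1 -> G B2 -> G (B1 `|` B2).
  by move=> [m1 a1] [m2 a2]; split; [exact: measurableU|exact: cont_approxU].
apply: smallest_sub.
  split => //.
  - move=> B [mB aB]; split; first by rewrite setTD; exact: measurableC.
    move=> e e0; have [g [cg g01] ge] := aB e e0.
    exists (fun u => 1 - g u).
      split; first by move=> u; apply: cvgB; [exact: cvg_cst|exact: cg].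
      by move=> u; have /andP[? ?] := g01 u; rewrite subr_ge0 lerBlDr lerDl; apply/andP.
    rewrite (_ : (fun _ => _) = (fun u => `|\1_B u - g u|))//.
    apply/funext => u; rewrite -normrN; congr `| _ |.
    by rewrite !indicE setTD in_setC; case: (_ \in B) => /=; lra.
  - move=> B GB; have mB n : measurable (B n : set (borel S)) by case: (GB n).
    split; first exact: bigcupT_measurable.
    have GBn n : G (\big[setU/set0]_(i < n) B i).
      by elim: n => [|n ih]; rewrite ?big_ord0// big_ord_recr/=; exact: GU.
    apply: (@cont_approx_lim (fun n => \1_(\big[setU/set0]_(i < n) B i))).
    + by move=> n; apply: measurable_indic; case: (GBn n).
    + by move=> n u; exact: i01.
    + by move=> n; case: (GBn n).
    move=> u; have [[k _ Bku]|nBu] := pselect ((\bigcup_k B k) u).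
      apply: cvg_near_cst; exists k.+1 => // n /= kn.
      rewrite !indicE !mem_set//; first by exists k.
      by rewrite -bigcup_mkord; exists k.
    apply: cvg_near_cst; apply: nearW => n.
    rewrite !indicE !memNset//; first by rewrite -bigcup_mkord => -[k /= _ Bk]; apply: nBu; exists k.
move=> B oB; split; first exact: sub_sigma_algebra.
have [h ch hB] := open_indic_approx oB.
apply: (@cont_approx_lim h) => //.
- by move=> n; apply: continuous_borel; case: (ch n).
- by move=> n; case: (ch n).
- by move=> n; apply: cont_approx_continuous; case: (ch n).
Qed.

End L1_approximation.

(* tv_norm only tests continuous functions; approximating the indicator of the
   positive Hahn set in L1 by continuous functions shows that it dominates the
   total mass of the Jordan decomposition. *)
Lemma charge_integral_le_tv (nu : {charge set (borel S) -> \bar R}) f (C e : R) :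
  measurable_fun [set: borel S] (f : borel S -> R) -> (forall u, `|f u| <= C) ->
  (tv_norm nu <= e%:E)%E -> `|charge_integral nu f| <= C * e.
Proof.
move=> mf fC tve.
have C0 : 0 <= C by rewrite (le_trans _ (fC point)).
have bf : bmeas (f : borel S -> R) by split => //; exists C.
pose PN := svalP (hahn_sets nu); pose P := (sval (hahn_sets nu)).1.
pose p : {finite_measure set (borel S) -> \bar R} := jordan_pos PN.
pose n : {finite_measure set (borel S) -> \bar R} := jordan_neg PN.
have poo : (p setT < +oo)%E := finite_measure_lty p.
have noo : (n setT < +oo)%E := finite_measure_lty n.
have mP : measurable P by have [[]] := PN.
have CIE g : charge_integral nu g = \int[p]_u g u - \int[n]_u g u by [].
set tp := fine (p setT); set tn := fine (n setT).
have tp0 : 0 <= tp by exact: fine_ge0.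
have tn0 : 0 <= tn by exact: fine_ge0.
have pC : p (~` P) = 0%E.
  change (jordan_pos PN (~` P) = 0%E).
  by rewrite jordan_posE cjordan_posE /crestr0 mem_set/=; [rewrite /crestr/= setICl charge0|exact: measurableC].
have nP : n P = 0%E.
  change (jordan_neg PN P = 0%E).
  rewrite jordan_negE cjordan_negE /crestr0 mem_set//= /crestr/=.
  by have [_ _ _ ->] := PN; rewrite charge0 oppe0.
have Ip : \int[p]_u (\1_P u : R) = tp.
  rewrite /Rintegral integral_indic// setIT; congr fine.
  transitivity (p P + p (~` P))%E; first by rewrite pC adde0.
  by rewrite -measureU ?setUv//; [exact: measurableC|exact: setICr].
have In : \int[n]_u (\1_P u : R) = 0.
  by rewrite /Rintegral integral_indic// setIT [X in fine X]nP.
have tot : tp + tn <= e.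
  apply/ler_addgt0Pr => r r0.
  have [|g [cg g01] gle] := @cont_approx_measurable (measure_add p n) (measure_add_lty p n) P mP (r / 4).
    by rewrite divr_gt0.
  have gN u : `|g u| <= 1 by have /andP[? ?] := g01 u; rewrite ger0_norm.
  have mg : measurable_fun [set: borel S] (g : borel S -> R) by exact: continuous_borel.
  have bg : bmeas (g : borel S -> R) by split=> //; exists 1.
  have bP : bmeas (\1_P : borel S -> R).
    split; first exact: measurable_indic.
    by exists 1 => u; rewrite indicE; case: (_ \in P); rewrite ?normr1 ?normr0.
  have b1 : bmeas ((fun u => `|\1_P u - g u|) : borel S -> R).
    have [mPg [D PgD]] := bmeasB bP bg.
    by split; [exact: measurableT_comp|exists D => u; rewrite normr_id].
  (* The test function 2 g - 1 is close to the sign 1 on [P] and -1 off it, whose integral is tp +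
     tn. The error r / 4 on [g] costs at most r / 2. *)
  have : 2 * charge_integral nu g - (tp - tn) <= e.
    have -> : 2 * charge_integral nu g - (tp - tn) = charge_integral nu (fun u => 2 * g u - 1).
      have bc : bmeas (cst 1 : borel S -> R) by exact: bmeas_cst.
      have b2g : bmeas ((fun u => 2 * g u) : borel S -> R) by exact: bmeasZ.
      rewrite !CIE.
      have E (m : {finite_measure set (borel S) -> \bar R}) :
          \int[m]_u (2 * g u - 1) = 2 * \int[m]_u g u - fine (m setT).
        have moo := finite_measure_lty m.
        rewrite RintegralB//; try exact: bmeas_integrable.
        by rewrite RintegralZl// ?Rintegral_cst ?mul1r//; exact: bmeas_integrable.
      by rewrite !E -/tp -/tn; lra.
    rewrite -lee_fin (le_trans _ tve)//; apply: ereal_sup_ubound.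
    exists (fun u => 2 * g u - 1) => //; split.
      move=> u; apply: cvgB; last exact: cvg_cst.
      by apply: cvgM; [exact: cvg_cst|exact: cg].
    by move=> u; have /andP[? ?] := g01 u; rewrite ler_norml; apply/andP; split; lra.
  have : tp - \int[p]_u g u + \int[n]_u g u <= r / 4.
    rewrite -Ip (_ : _ + _ = (\int[p]_u \1_P u - \int[p]_u g u) + (\int[n]_u g u - \int[n]_u \1_P u)); last first.
      by rewrite In subr0.
    apply: le_trans gle; rewrite (@Rintegral_measure_add _ (borel S))//.
    rewrite -!RintegralB//; try exact: bmeas_integrable.
    apply: lerD; apply: le_Rintegral => //; try (by apply: bmeas_integrable => //; exact: bmeasB);
      try exact: bmeas_integrable.
      by move=> u _; rewrite ler_norm.
    by move=> u _; rewrite distrC ler_norm.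
  rewrite CIE; lra.
have fin (m : {finite_measure set (borel S) -> \bar R}) :
    `|\int[m]_u f u| <= C * fine (m setT).
  have moo := finite_measure_lty m.
  apply: le_trans (le_normr_Rintegral _ _) _ => //; first exact: bmeas_integrable.
  rewrite -Rintegral_cst//; apply: le_Rintegral => //.
    by apply: bmeas_integrable => //; split; [exact: measurableT_comp|exists C => u; rewrite normr_id].
  by apply: bmeas_integrable => //; exact: bmeas_cst.
rewrite CIE (le_trans (ler_normB _ _))// (le_trans (lerD (fin p) (fin n)))//.
by rewrite -mulrDr ler_wpM2l.
Qed.

End borel_sets.

(** * The Poisson equation *)

Section ultrafilter_limits.
Context {R : realType} {U : set_system nat} {UU : UltraFilter U}.

(** A cluster point of an ultrafilter is a limit, and the compact interval [-C, C] provides one. A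
    single [U] thus gives limits of all bounded sequences at once, for every point of [S] and every
    function. *)
Lemma ultra_bounded_cvg (x : nat -> R) (C : R) : (\forall n \near U, `|x n| <= C) ->
  x n @[n --> U] --> lim (x n @[n --> U]).
Proof.
move=> xC.
have FP : ProperFilter (x @ U) by exact: fmap_proper_filter.
have Fseg : (x @ U) `[- C, C]%classic.
  by apply: filterS xC => n /=; rewrite in_itv/= -ler_norml.
have [l [_ cl]] := @segment_compact R (- C) C (x @ U) FP Fseg.
apply/cvg_ex; exists l => V /= Vl.
have [//|UnV] := in_ultra_setVsetC (x @^-1` V) UU.
by have [y []] := cl (~` V) V UnV Vl.
Qed.

End ultrafilter_limits.

Section tv_continuous_integrals.
Context {R : realType} {S : pointedMetricType R}.

(** Uniform over the unit ball of bounded measurable functions, continuous or not. Taking e / 2 for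
    [tv_dist] absorbs its factor 1 / 2. *)
Lemma tv_continuous_near (nu : S -> {charge set (borel S) -> \bar R}) :
  tv_continuous nu -> forall u (e : R), 0 < e -> \forall v \near u,
  forall f : S -> R, measurable_fun [set: borel S] (f : borel S -> R) ->
    (forall w, `|f w| <= 1) ->
    `|charge_integral (nu v) f - charge_integral (nu u) f| <= e.
Proof.
move=> cnu u e e0.
have e20 : 0 < e / 2 by rewrite divr_gt0.
have /fine_cvgP[finv /cvgrPdist_lt/(_ _ e20)] := cnu u.
apply: filterS2 finv => v vfin; rewrite sub0r normrN => vlt f mf f1.
have bf : bmeas (f : borel S -> R) by split => //; exists 1.
rewrite -charge_integral_copp// -charge_integral_cadd// -[leRHS]mul1r.
apply: charge_integral_le_tv => //.
have : (tv_dist (nu v) (nu u) <= (e / 2)%:E)%E.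
  by rewrite -(fineK vfin) lee_fin (le_trans (ler_norm _))// ltW.
rewrite /tv_dist; move: (tv_norm _) => [r| |].
- by rewrite -EFinM !lee_fin => ?; lra.
- by rewrite gt0_muley ?lte_fin ?invr_gt0.
- by rewrite leNye.
Qed.

End tv_continuous_integrals.

Section strong_feller_kernel.
Context {R : realType} {S : pointedMetricType R}.
Hypothesis S_compact : compact [set: S].
Variable K : R.-pker (borel S) ~> (borel S).
Hypothesis K_continuous : tv_continuous (fun u : S => kcharge K u).
Implicit Types f g h : S -> R.

Local Notation bm f := (bmeas (f : borel S -> R)).

Definition kop f (u : S) : R := \int[K u]_v f v.

Lemma kmass u : K u setT = 1%E. Proof. exact: prob_kernel. Qed.

Lemma charge_integral_kcharge d (X : measurableType d) (k : R.-pker X ~> borel S) x f :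
  bm f -> charge_integral (kcharge k x) f = \int[k x]_v f v.
Proof.
move=> bf.
have kx1 : k x setT = 1%E by exact: prob_kernel.
have zoo : ((mzero : {measure set borel S -> \bar R}) setT < +oo)%E by rewrite /mzero ltry.
rewrite (charge_integralE (mass1_lty kx1) zoo _ bf).
  by rewrite {2}/Rintegral integral_measure_zero subr0.
by move=> A mA; rewrite /mzero sube0.
Qed.

(** The neighbourhood does not depend on [f]: this is the equicontinuity of the image under [kop] of
    a bounded set. The general case follows by scaling to [C] = 1, except for [C] = 0. *)
Lemma kop_near u (e : R) : 0 < e -> \forall v \near u, forall f (C : R),
  measurable_fun [set: borel S] (f : borel S -> R) ->
  (forall w, `|f w| <= C) -> `|kop f v - kop f u| <= C * e.
Proof.
move=> e0; have := tv_continuous_near K_continuous u e0.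
apply: filterS => v H f C mf fC.
have C0 : 0 <= C by rewrite (le_trans _ (fC point)).
have bf : bm f by split => //; exists C.
have [C00|Cneq] := eqVneq C 0.
  have f0 w : f w = 0 by apply/normr0_eq0/le_anti; rewrite normr_ge0 andbT -C00.
  by rewrite /kop (_ : f = cst 0); [rewrite !(bint_cst (kmass _)) subrr normr0 C00 mul0r|apply/funext => w; rewrite f0].
have Cp : 0 < C by rewrite lt_neqAle eq_sym Cneq.
have bCf : bm (fun w => C^-1 * f w) by exact: bmeasZ.
have := H (fun w => C^-1 * f w).
rewrite !charge_integral_kcharge// !(bintZ (kmass _))// -mulrBr normrM gtr0_norm ?invr_gt0//.
move=> h; rewrite -ler_pdivrMl//; apply: h; first by case: bCf.
by move=> w; rewrite normrM gtr0_norm ?invr_gt0// ler_pdivrMl// mulr1.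
Qed.

Lemma kop_continuous f : bm f -> continuous (kop f).
Proof.
move=> [mf [C fC]] u; apply/cvgrPdist_le => e e0.
have C0 : 0 <= C by rewrite (le_trans _ (fC point)).
have C1 : 0 < C + 1 by rewrite ltr_wpDl.
have : 0 < e / (C + 1) by rewrite divr_gt0.
move=> /(kop_near u); apply: filterS => v /(_ f (C + 1) mf); rewrite distrC.
rewrite mulrC divfK ?gt_eqF//; apply => w.
by rewrite (le_trans (fC w))// lerDl.
Qed.

Lemma kop_le f g : bm f -> bm g -> (forall u, f u <= g u) ->
  forall u, kop f u <= kop g u.
Proof. by move=> bf bg fg u; apply: (le_bint (kmass u)). Qed.

Lemma kop_norm f (C : R) : measurable_fun [set: borel S] (f : borel S -> R) ->
  (forall w, `|f w| <= C) -> forall u, `|kop f u| <= C.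
Proof. by move=> mf fC u; exact: (bint_norm_le (kmass u)). Qed.

Lemma kopD f g : bm f -> bm g -> kop (fun u => f u + g u) = (fun u => kop f u + kop g u).
Proof. by move=> bf bg; apply/funext => u; rewrite /kop (bintD (kmass u)). Qed.

Lemma kopB f g : bm f -> bm g -> kop (fun u => f u - g u) = (fun u => kop f u - kop g u).
Proof. by move=> bf bg; apply/funext => u; rewrite /kop (bintB (kmass u)). Qed.

Lemma kopZ c f : bm f -> kop (fun u => c * f u) = (fun u => c * kop f u).
Proof. by move=> bf; apply/funext => u; rewrite /kop (bintZ (kmass u)). Qed.

Lemma kop_cst c : kop (fun=> c) = (fun=> c).
Proof. by apply/funext => u; rewrite /kop (bint_cst (kmass u)). Qed.

Lemma bmeas_kop f : bm f -> bm (kop f).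
Proof. by move=> bf; exact: measurable_Rintegral_kernel. Qed.

(* Dini's theorem, for the continuous functions [kop (g n)]. *)
Lemma kop_dini (g : nat -> S -> R) (C : R) :
  (forall n, measurable_fun [set: borel S] (g n : borel S -> R)) ->
  (forall n u, `|g n u| <= C) -> (forall m n u, (m <= n)%N -> g n u <= g m u) ->
  (forall u, g n u @[n --> \oo] --> 0) ->
  forall e : R, 0 < e -> \forall n \near \oo, forall u, kop (g n) u <= e.
Proof.
move=> mg gC gdec g0 e e0.
have bg n : bm (g n) by split => //; exists C.
have e20 : 0 < e / 2 by rewrite divr_gt0.
suff H : \forall n \near \oo, [set: S] `<=` (fun u => kop (g n) u <= e).
  by apply: filterS H => n h u; exact: h.
apply: ((compact_near_coveringP [set: S]).1 S_compact nat \oo) => u _.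
have := @Rintegral_dominated_cvg _ (borel S) R (K u) g (cst 0) C (mass1_lty (kmass u)) mg gC g0.
rewrite (bint_cst (kmass u)) => /cvgrPdist_lt/(_ _ e20)[N _ /(_ N (leqnn N))]/=.
rewrite sub0r normrN => gN.
have /cvgrPdist_lt/(_ _ e20) := @kop_continuous _ (bg N) u.
move=> near_u; exists ([set v | `|kop (g N) u - kop (g N) v| < e / 2], [set n | (N <= n)%N]).
  by split => //; exists N.
move=> [v n] /= [uv Nn].
apply: (@le_trans _ _ (kop (g N) v)); first by apply: kop_le => // w; exact: gdec.
have h1 := ler_norm (kop (g N) u).
have h2 := ler_norm (- (kop (g N) u - kop (g N) v)); rewrite normrN in h2.
have h3 : `|kop (g N) u| < e / 2 by exact: gN.
by lra.
Qed.

Lemma iter_kop_bmeas n f : bm f -> bm (iter n kop f).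
Proof. by move=> bf; elim: n => //= n ih; exact: bmeas_kop. Qed.

Lemma iter_kop_le n f g : bm f -> bm g -> (forall u, f u <= g u) ->
  forall u, iter n kop f u <= iter n kop g u.
Proof.
by move=> bf bg fg; elim: n => //= n ih; apply: kop_le => //; exact: iter_kop_bmeas.
Qed.

Lemma iter_kop_norm n f (C : R) : measurable_fun [set: borel S] (f : borel S -> R) ->
  (forall w, `|f w| <= C) -> forall u, `|iter n kop f u| <= C.
Proof.
move=> mf fC; have bf : bm f by split => //; exists C.
elim: n => //= n ih; apply: kop_norm => //.
by case: (iter_kop_bmeas n bf).
Qed.

Lemma iter_kopD n f g : bm f -> bm g ->
  iter n kop (fun u => f u + g u) = (fun u => iter n kop f u + iter n kop g u).
Proof.
by move=> bf bg; elim: n => //= n ->; rewrite kopD//; exact: iter_kop_bmeas.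
Qed.

Lemma iter_kopB n f g : bm f -> bm g ->
  iter n kop (fun u => f u - g u) = (fun u => iter n kop f u - iter n kop g u).
Proof.
by move=> bf bg; elim: n => //= n ->; rewrite kopB//; exact: iter_kop_bmeas.
Qed.

Lemma iter_kopZ n c f : bm f ->
  iter n kop (fun u => c * f u) = (fun u => c * iter n kop f u).
Proof.
by move=> bf; elim: n => //= n ->; rewrite kopZ//; exact: iter_kop_bmeas.
Qed.

Lemma iter_kop_cst n c : iter n kop (fun=> c) = (fun=> c).
Proof. by elim: n => //= n ->; exact: kop_cst. Qed.

(** The average starts with one application of [K]. Every term then depends on [f] through [kop f]
    only, so that bounds valid after one step of [K], as in [kop_dini], pass to the means. *)
Definition cesaro_mean f (n : nat) (u : S) : R :=
  n.+1%:R^-1 * \sum_(k < n.+1) iter k.+1 kop f u.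

Lemma cesaroD f g n u : bm f -> bm g ->
  cesaro_mean (fun u => f u + g u) n u = cesaro_mean f n u + cesaro_mean g n u.
Proof.
move=> bf bg; rewrite /cesaro_mean -mulrDr -big_split/=; congr (_ * _).
by apply: eq_bigr => k _; rewrite iter_kopD// kopD//; exact: iter_kop_bmeas.
Qed.

Lemma cesaroZ c f n u : bm f -> cesaro_mean (fun u => c * f u) n u = c * cesaro_mean f n u.
Proof.
move=> bf; rewrite /cesaro_mean mulrCA; congr (_ * _); rewrite mulr_sumr.
by apply: eq_bigr => k _; rewrite iter_kopZ// kopZ//; exact: iter_kop_bmeas.
Qed.

Lemma cesaro_cst c n u : cesaro_mean (fun=> c) n u = c.
Proof.
rewrite /cesaro_mean (eq_bigr (fun=> c)) => [|k _].
  by rewrite sumr_const card_ord -[c *+ _]mulr_natl mulKf// pnatr_eq0.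
by rewrite iter_kop_cst.
Qed.

Lemma cesaro_le f g n u : bm f -> bm g -> (forall v, kop f v <= kop g v) ->
  cesaro_mean f n u <= cesaro_mean g n u.
Proof.
move=> bf bg fg; rewrite /cesaro_mean ler_wpM2l ?invr_ge0//; apply: ler_sum => k _.
rewrite !iterSr.
by apply: iter_kop_le => //; exact: bmeas_kop.
Qed.

Lemma cesaro_norm f (C : R) n u : measurable_fun [set: borel S] (f : borel S -> R) ->
  (forall w, `|f w| <= C) -> `|cesaro_mean f n u| <= C.
Proof.
move=> mf fC; have bf : bm f by split => //; exists C.
rewrite ler_norml -{1}(cesaro_cst (- C) n u) -{2}(cesaro_cst C n u).
have bc c : bm (cst c) by exact: bmeas_cst.
by apply/andP; split; apply: cesaro_le => //; [exact: (bc (- C))| |exact: (bc C)|];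
  apply: kop_le => //; try exact: bc; move=> v; have := fC v; rewrite ler_norml => /andP[].
Qed.

Lemma cesaro_kop f (C : R) n u : measurable_fun [set: borel S] (f : borel S -> R) ->
  (forall w, `|f w| <= C) ->
  `|cesaro_mean (kop f) n u - cesaro_mean f n u| <= 2 * C / n.+1%:R.
Proof.
move=> mf fC; rewrite /cesaro_mean -mulrBr normrM ger0_norm ?invr_ge0//.
rewrite [leRHS]mulrC; apply: ler_wpM2l; first by rewrite invr_ge0.
rewrite -sumrB (eq_bigr (fun k : 'I_n.+1 => iter k.+2 kop f u - iter k.+1 kop f u)); last first.
  by move=> k _; rewrite -iterSr.
rewrite -(big_mkord xpredT (fun k => iter k.+2 kop f u - iter k.+1 kop f u)).
rewrite (telescope_sumr (fun k => iter k.+1 kop f u))// (le_trans (ler_normB _ _))//.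
by rewrite mulr_natl mulr2n lerD//; exact: iter_kop_norm.
Qed.

Lemma harmonic_cvg (c : R) : c / n.+1%:R @[n --> \oo] --> 0.
Proof.
by rewrite -[X in _ --> X](mulr0 c); apply: cvgM; [exact: cvg_cst|exact: cvg_harmonic].
Qed.

(** * Invariant measures by averaging along an ultrafilter *)

Section krylov_bogolyubov.
Context {U : set_system nat} {UU : UltraFilter U}.
Hypothesis U_oo : \oo `<=` U.
Variable u0 : S.

(** A positive normalised linear functional on all bounded measurable functions, invariant under
    [kop] because the means of [kop f] and [f] differ by O(1 / n). *)
Let L f : R := lim (cesaro_mean f n u0 @[n --> U]).

Let L_cvg f : bm f -> cesaro_mean f n u0 @[n --> U] --> L f.
Proof.
by move=> [mf [C fC]]; apply: (@ultra_bounded_cvg _ _ _ _ C); apply: nearW => n; exact: cesaro_norm.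
Qed.

Let LD f g : bm f -> bm g -> L (fun u => f u + g u) = L f + L g.
Proof.
move=> bf bg; rewrite {1}/L; under eq_fun do rewrite cesaroD//.
by apply: (@cvg_lim _ (@Rhausdorff R)); apply: cvgD; exact: L_cvg.
Qed.

Let LZ c f : bm f -> L (fun u => c * f u) = c * L f.
Proof.
move=> bf; rewrite {1}/L; under eq_fun do rewrite cesaroZ//.
by apply: (@cvg_lim _ (@Rhausdorff R)); apply: cvgM; [exact: cvg_cst|exact: L_cvg].
Qed.

Let L_cst c : L (fun=> c) = c.
Proof.
rewrite {1}/L; under eq_fun do rewrite cesaro_cst.
by apply: (@cvg_lim _ (@Rhausdorff R)); exact: cvg_cst.
Qed.

Let LB f g : bm f -> bm g -> L (fun u => f u - g u) = L f - L g.
Proof.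
move=> bf bg; rewrite -mulN1r -LZ// -LD//; last exact: bmeasZ.
by congr L; apply/funext => u; rewrite mulN1r.
Qed.

Let L_le f g : bm f -> bm g -> (forall u, kop f u <= kop g u) -> L f <= L g.
Proof.
move=> bf bg fg; apply: ler_cvg_to (L_cvg bf) (L_cvg bg) _.
by apply: nearW => n; exact: cesaro_le.
Qed.

Let L_kop f : bm f -> L (kop f) = L f.
Proof.
move=> bf; have [mf [C fC]] := bf; apply/eqP; rewrite -subr_eq0 -LB//; last exact: bmeas_kop.
apply/eqP/(@cvg_lim _ (@Rhausdorff R)).
have -> : (fun n => cesaro_mean (fun u => kop f u - f u) n u0) =
    (fun n => cesaro_mean (kop f) n u0 - cesaro_mean f n u0).
  apply/funext => n; have bk := bmeas_kop bf.
  rewrite -mulN1r -cesaroZ// -cesaroD//; last exact: bmeasZ.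
  by congr cesaro_mean; apply/funext => u; rewrite mulN1r.
apply/norm_cvg0P; apply: (@squeeze_cvgr _ _ _ _ (cst 0) (fun n => 2 * C / n.+1%:R)).
- by apply: nearW => n; rewrite normr_ge0 cesaro_kop.
- exact: cvg_cst.
- by apply: cvg_trans (harmonic_cvg (2 * C)); exact: cvg_fmap2.
Qed.

(** An ultrafilter limit is in general only finitely additive. Here Dini's theorem makes
    [kop (f - f_ n)] uniformly small, and [L] sees functions through [kop] only: this is the source
    of countable additivity. *)
Let L_mono_cvg (f_ : nat -> S -> R) f (C : R) :
  (forall n, measurable_fun [set: borel S] (f_ n : borel S -> R)) ->
  (forall n u, `|f_ n u| <= C) -> (forall m n u, (m <= n)%N -> f_ m u <= f_ n u) ->
  (forall u, f_ n u @[n --> \oo] --> f u) -> L (f_ n) @[n --> \oo] --> L f.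
Proof.
move=> mf fC fnd ff; have [mlim fC'] := @bmeas_cvg _ (borel S) R f_ f C mf fC ff.
have bf : bm f by split => //; exists C.
have bf_ n : bm (f_ n) by split => //; exists C.
have fle n u : f_ n u <= f u.
  apply: (cvgr_to_ge (ff u)); exists n => // m /= nm; exact: fnd.
apply/cvgrPdist_le => e e0.
have := @kop_dini (fun n u => f u - f_ n u) (C + C) _ _ _ _ e e0.
have h1 n : measurable_fun [set: borel S] ((fun u => f u - f_ n u) : borel S -> R).
  exact: measurable_funB.
have h2 n u : `|f u - f_ n u| <= C + C by rewrite (le_trans (ler_normB _ _))// lerD.
have h3 m n u : (m <= n)%N -> f u - f_ n u <= f u - f_ m u.
  by move=> mn; rewrite lerB// fnd.
have h4 u : f u - f_ n u @[n --> \oo] --> 0.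
  by rewrite -(subrr (f u)); apply: cvgB; [exact: cvg_cst|exact: ff].
move=> /(_ h1 h2 h3 h4); apply: filterS => n hn.
rewrite -LB// ger0_norm.
  rewrite -[leRHS]L_cst; apply: L_le; [exact: bmeasB|exact: bmeas_cst|].
  by move=> u; rewrite kop_cst.
rewrite -[leLHS]L_cst; apply: L_le; [exact: bmeas_cst|exact: bmeasB|].
move=> u; apply: kop_le; [exact: bmeas_cst|exact: bmeasB|].
by move=> v; rewrite subr_ge0.
Qed.

Let bm_indic (B : set (borel S)) : measurable B -> bm (\1_B).
Proof.
move=> mB; split; first exact: measurable_indic.
by exists 1 => u; rewrite indicE; case: (_ \in B); rewrite ?normr1 ?normr0.
Qed.

Let L_ge0 f : bm f -> (forall u, 0 <= f u) -> 0 <= L f.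
Proof.
move=> bf f0; rewrite -[leLHS]L_cst; apply: L_le => //; first exact: bmeas_cst.
by apply: kop_le => //; exact: bmeas_cst.
Qed.

(** The value 0 on nonmeasurable sets is a default: the properties of [L] are only available for
    measurable functions, while a measure must be nonnegative on every set. *)
Definition kb_measure (B : set (borel S)) : \bar R :=
  (if pselect (measurable B) then L (\1_B) else 0)%:E.

Let kb_measureE B : measurable B -> kb_measure B = (L (\1_B))%:E.
Proof. by rewrite /kb_measure; case: pselect. Qed.

Let kb0 : kb_measure set0 = 0%E.
Proof.
rewrite kb_measureE// (_ : \1_set0 = fun=> 0) ?L_cst//.
by apply/funext => u; rewrite indicE in_set0.
Qed.

Let kb_ge0 B : (0 <= kb_measure B)%E.
Proof.
rewrite /kb_measure; case: pselect => // mB; rewrite lee_fin L_ge0//.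
  exact: bm_indic.
Qed.

Let kb_sigma_additive : semi_sigma_additive kb_measure.
Proof.
move=> F mF tF mUF.
have mUn n : measurable (\big[setU/set0]_(i < n) F i).
  by apply: bigsetU_measurable => i _; exact: mF.
have sumE n : (\sum_(0 <= i < n) kb_measure (F i))%E =
    (L (\1_(\big[setU/set0]_(i < n) F i)))%:E.
  elim: n => [|n ih]; first by rewrite big_nil big_ord0 -kb_measureE// kb0.
  rewrite big_nat_recr//= ih kb_measureE// -EFinD; congr EFin.
  rewrite -LD; [|exact: bm_indic|exact: bm_indic].
  congr L; apply/funext => u; rewrite big_ord_recr/= !indicE in_setU.
  have [/set_mem uU|] := boolP (u \in \big[setU/set0]_(i < n) F i); last by rewrite add0r.
  rewrite memNset ?addr0// => Fn.
  move: uU; rewrite -bigcup_mkord => -[k /= kn Fk].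
  have := tF k n I I; have : F k `&` F n !=set0 by exists u.
  by move=> /[swap] /[apply] kE; move: kn; rewrite kE ltnn.
rewrite kb_measureE//; under eq_fun do rewrite sumE.
apply: cvg_EFin; first exact: nearW.
apply: (@L_mono_cvg (fun n => \1_(\big[setU/set0]_(i < n) F i)) _ 1).
- by move=> n; exact: measurable_indic.
- by move=> n u; rewrite indicE; case: (_ \in _); rewrite ?normr1 ?normr0.
- move=> m n u mn; rewrite !indicE ler_nat.
  have [/set_mem um|//] := boolP (u \in \big[setU/set0]_(i < m) F i).
  rewrite mem_set//; move: um; rewrite -!bigcup_mkord => -[k /= km Fk].
  by exists k => //=; exact: leq_trans mn.
move=> u; have [[k _ Bku]|nBu] := pselect ((\bigcup_k F k) u).
  apply: cvg_near_cst; exists k.+1 => // n /= kn.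
  rewrite !indicE !mem_set//; first by exists k.
  by rewrite -bigcup_mkord; exists k.
apply: cvg_near_cst; apply: nearW => n.
rewrite !indicE !memNset//; first by rewrite -bigcup_mkord => -[k /= _ Bk]; apply: nBu; exists k.
Qed.

HB.instance Definition _ := isMeasure.Build _ _ _ kb_measure kb0 kb_ge0 kb_sigma_additive.

Let kb1 : kb_measure setT = 1%E.
Proof.
by rewrite kb_measureE// indicT L_cst.
Qed.

HB.instance Definition _ := Measure_isProbability.Build _ _ _ kb_measure kb1.

Import HBNNSimple.

Let kb_integral f : bm f -> (forall u, 0 <= f u) ->
  (\int[kb_measure]_u (f u)%:E)%E = (L f)%:E.
Proof.
move=> bf f0; have [mf [C fC]] := bf.
have mEf : measurable_fun [set: borel S] (EFin \o f : borel S -> \bar R) by exact/measurable_EFinP.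
pose f_ := nnsfun_approx measurableT mEf.
have simple (g : {nnsfun borel S >-> R}) :
    (\int[kb_measure]_u (g u)%:E)%E = (L g)%:E.
  rewrite integralT_nnsfun sintegralE.
  pose s := finmap.enum_fset (fset_set (range g)).
  have gE : (g : S -> R) = (fun u => \sum_(r <- s) r * \1_(g @^-1` [set r]) u).
    by apply/funext => u; rewrite fimfunE -fsbig_finite.
  transitivity (L (fun u => \sum_(r <- s) r * \1_(g @^-1` [set r]) u))%:E; last by rewrite -gE.
  rewrite fsbig_finite//= -/s.
  have mg r : measurable (g @^-1` [set r] : set (borel S)) by [].
  suff : bm (fun u => \sum_(r <- s) r * \1_(g @^-1` [set r]) u) /\
    (\sum_(i <- s) i%:E * kb_measure (g @^-1` [set i]))%E =
    (L (fun u => \sum_(r <- s) r * \1_(g @^-1` [set r]) u))%:E by case.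
  elim: (s) => [|r s' [ihb ih]].
    rewrite big_nil; under eq_fun do rewrite big_nil; rewrite L_cst; split => //.
    exact: bmeas_cst.
  have b1 : bm (fun u => r * \1_(g @^-1` [set r]) u) by apply: bmeasZ; exact: bm_indic.
  rewrite big_cons ih kb_measureE//.
  have E : (fun u => \sum_(r0 <- r :: s') r0 * \1_(g @^-1` [set r0]) u) =
    (fun u => r * \1_(g @^-1` [set r]) u + \sum_(r <- s') r * \1_(g @^-1` [set r]) u).
    by apply/funext => u; rewrite big_cons.
  rewrite E; split; first exact: bmeasD.
  by rewrite LD// LZ//; exact: bm_indic.
have cv : (\int[kb_measure]_u (f_ n u)%:E)%E @[n --> \oo] --> (\int[kb_measure]_u (f u)%:E)%E.
  have := @cvg_monotone_convergence _ _ _ kb_measure _ measurableT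
    (fun i z => (f_ i z)%:E).
  rewrite (_ : (fun x => limn _) = EFin \o f); last first.
    by apply/funext => z; apply/cvg_lim => //; apply: cvg_nnsfun_approx => // x _; rewrite lee_fin.
  apply.
  - by move=> i; exact/measurable_EFinP.
  - by move=> i z _; rewrite lee_fin.
  - by move=> z _ a b ab; rewrite lee_fin; exact/lefP/nd_nnsfun_approx.
have f_cvg u : f_ n u @[n --> \oo] --> f u.
  have Ef0 x : setT x -> (0 <= (EFin \o f) x)%E by rewrite lee_fin.
  exact: (fine_cvg (cvg_nnsfun_approx measurableT mEf Ef0 (x := u) I)).
have f_nd m n u : (m <= n)%N -> f_ m u <= f_ n u.
  by move=> mn; exact/lefP/nd_nnsfun_approx.
have fle n u : f_ n u <= f u.
  by apply: (cvgr_to_ge (f_cvg u)); exists n => // m /= nm; exact: f_nd.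
have {}cv : (L (f_ n))%:E @[n --> \oo] --> (\int[kb_measure]_u (f u)%:E)%E.
  by rewrite (_ : (fun n => (L (f_ n))%:E) = (fun n => \int[kb_measure]_u (f_ n u)%:E)%E)//;
    apply/funext => n; rewrite simple.
apply: (cvg_unique (@ereal_hausdorff R) cv).
apply: cvg_EFin; first exact: nearW.
apply: (@L_mono_cvg (fun n => f_ n) f C) => //.
- by move=> n u; rewrite ger0_norm// (le_trans (fle n u))// (le_trans (ler_norm _)).
Qed.

(** The second conclusion localises the measure: a set that the chain started at [u0] never charges
    is null. It will place an invariant probability on the set where a harmonic function attains its
    maximum. *)
Lemma krylov_bogolyubov : exists nu : probability (borel S) R,
  invariant_probability K nu /\
  forall B : set (borel S), measurable B ->
    (forall n, iter n kop (\1_B) u0 = 0) -> nu B = 0%E.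
Proof.
exists kb_measure; split=> B mB.
  transitivity (\int[kb_measure]_u (kop (\1_B) u)%:E)%E; last first.
    apply: eq_integral => u _; rewrite /kop EFin_Rintegral ?integral_indic ?setIT//.
    by apply: (bint (kmass u)); exact: bm_indic.
  rewrite kb_integral; [|by apply: bmeas_kop; exact: bm_indic|].
    by rewrite L_kop; [exact: kb_measureE|exact: bm_indic].
  by move=> u; apply: Rintegral_ge0 => v _; rewrite indicE.
move=> B0; apply: (etrans (kb_measureE mB)); congr EFin.
rewrite /L (_ : (fun n => _) = (fun=> 0)).
  by apply: (@cvg_lim _ (@Rhausdorff R)); exact: cvg_cst.
apply/funext => n; rewrite /cesaro_mean big1 ?mulr0// => k _; exact: B0.
Qed.

End krylov_bogolyubov.

End strong_feller_kernel.

(** * Harmonic functions and solutions of the Poisson equation *)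

Section poisson_equation_solution.
Context {R : realType} {S : pointedMetricType R}.
Hypothesis S_compact : compact [set: S].
Variable K : R.-pker (borel S) ~> (borel S).
Hypothesis K_continuous : tv_continuous (fun u : S => kcharge K u).
Variable pi : probability (borel S) R.
Hypothesis K_pi : unique_invariant_probability K pi.
Implicit Types f g h : S -> R.

Local Notation bm f := (bmeas (f : borel S -> R)).
Local Notation kop := (kop K).

Lemma Rintegral_kop f : bm f -> \int[pi]_u kop f u = \int[pi]_u f u.
Proof.
move=> bf; rewrite [RHS](Rintegral_mixture (prob_setT pi) (k := K))// => B mB.
by case: K_pi => + _; apply.
Qed.

Lemma Rintegral_iter_kop n f : bm f -> \int[pi]_u iter n kop f u = \int[pi]_u f u.
Proof.
by move=> bf; elim: n => //= n ih; rewrite Rintegral_kop//; exact: iter_kop_bmeas.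
Qed.

Lemma measurable_continuous_lt f (c : R) : continuous f ->
  measurable ([set u | f u < c] : set (borel S)).
Proof.
move=> cf; rewrite (_ : [set u | f u < c] = f @^-1` `]-oo, c[%classic); last first.
  by apply/seteqP; split => u /=; rewrite in_itv.
by rewrite -[X in measurable X]setTI; exact: (continuous_borel cf).
Qed.

(** At a maximum point u the nonnegative function f c - f has integral 0 under [K u], so it vanishes
    almost everywhere: one step of the chain stays in the set of maxima, and hence so do all. *)
Lemma harmonic_max_absorbing f c : continuous f -> (forall u, kop f u = f u) ->
  (forall u, f u <= f c) -> forall n u, f u = f c ->
  iter n kop (\1_[set v | f v < f c]) u = 0.
Proof.
move=> cf hf fc; set B := [set v | f v < f c].
have mB : measurable (B : set (borel S)) := measurable_continuous_lt (f c) cf.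
have bf : bm f by exact: bmeas_continuous.
have bB : bm (\1_B).
  split; first exact: measurable_indic.
  by exists 1 => u; rewrite indicE; case: (_ \in B); rewrite ?normr1 ?normr0.
have bc : bm (cst (f c)) by exact: bmeas_cst.
have KB u : f u = f c -> kop (\1_B) u = 0.
  move=> uc; rewrite /kop /Rintegral integral_indic// setIT.
  have bd : bm (fun v => f c - f v) by exact: bmeasB.
  have : (\int[K u]_v `|(f c - f v)%:E| = 0)%E.
    under eq_integral => v _ do rewrite gee0_abs ?lee_fin ?subr_ge0//.
    rewrite -EFin_Rintegral; last by apply: (bint (kmass K u)).
    by rewrite (bintB (kmass K u))// (bint_cst (kmass K u)) -/(kop f u) hf uc subrr.
  move/ae_eq_integral_abs => /(_ measurableT)[].
    by apply/measurable_EFinP; case: bd.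
  move=> N [mN N0 sub]; apply/eqP; rewrite fine_eq0; last exact: (mass1_fin (kmass K u)).
  rewrite eq_le measure_ge0 andbT -N0; apply: le_measure; rewrite ?inE// => v Bv.
  apply: sub => /= /(_ I)[] /eqP; rewrite subr_eq0 => /eqP E.
  by move: Bv; rewrite /B/= E ltxx.
elim=> [|n ih] u uc /=; first by rewrite indicE memNset// /B/= uc ltxx.
have b0 : bm (cst 0) by exact: bmeas_cst.
have i1 v : 0 <= (\1_B v : R) <= 1 by rewrite indicE; case: (_ \in B); rewrite ?lexx ?ler01.
have ge0 v : 0 <= iter n kop (\1_B) v.
  rewrite -[leLHS](_ : iter n kop (cst 0) v = 0); last by rewrite iter_kop_cst.
  by apply: iter_kop_le => // w; case/andP: (i1 w).
have le1 v : iter n kop (\1_B) v <= 1.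
  rewrite -[leRHS](_ : iter n kop (cst 1) v = 1); last by rewrite iter_kop_cst.
  by apply: iter_kop_le => //; [exact: bmeas_cst|move=> w; case/andP: (i1 w)].
apply/eqP; rewrite eq_le; apply/andP; split; last first.
  rewrite -[leLHS](_ : kop (cst 0) u = 0); last by rewrite kop_cst.
  by apply: kop_le => //; exact: iter_kop_bmeas.
(* By induction the [n]-th iterate vanishes off [B], and it is at most 1, so it lies below the
   indicator of [B], which [kop] sends to 0 at [u]. *)
rewrite -(KB u uc); apply: kop_le => //; first exact: iter_kop_bmeas.
move=> v; rewrite indicE; have [/set_mem Bv|] := boolP (v \in B); first exact: le1.
move=> /negP nBv; rewrite ih//; apply/eqP; rewrite eq_le fc/= leNgt; apply/negP => vc.
by apply: nBv; rewrite inE.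
Qed.

(** Started at a maximum point, the averaging construction yields an invariant probability carried
    by the maxima, which uniqueness identifies with [pi]; likewise for the minima. If the two values
    differed, the complements of these null complements would be disjoint sets of full measure. *)
Lemma harmonic_cst f : continuous f -> (forall u, kop f u = f u) ->
  forall u v, f u = f v.
Proof.
have nat_ultra : exists U : set_system nat, UltraFilter U /\ \oo `<=` U.
  by apply: ultraFilterLemma.
have [U [UU Uoo]] := nat_ultra.
have key g : continuous g -> (forall u, kop g u = g u) ->
    exists2 c, (forall u, g u <= g c) & pi [set v | g v < g c] = 0%E.
  move=> cg hg; have [|||c _ cmax] := @compact_EVT_max S R g setT => //.
  - by exists point.
  - exact: continuous_subspaceT.
  have gc u : g u <= g c by apply: cmax; rewrite inE.
  have [nu [invnu nu0]] := krylov_bogolyubov S_compact K_continuous (UU := UU) Uoo c.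
  exists c => //.
  have mB : measurable ([set v | g v < g c] : set (borel S)).
    exact: measurable_continuous_lt.
  have [_ /(_ nu invnu _ mB)<-] := K_pi.
  by apply: nu0 => // n; exact: harmonic_max_absorbing.
move=> cf hf; have [c fc pic] := key f cf hf.
have [||e fe pie] := key (fun u => - f u).
- by move=> u; apply: cvgN; exact: cf.
- move=> u; have bf : bm f by exact: bmeas_continuous.
  rewrite (_ : (fun u => - f u) = (fun u => -1 * f u)); last by apply/funext => w; rewrite mulN1r.
  by rewrite kopZ// hf mulN1r.
have [fce|] := eqVneq (f c) (f e).
  suff H u : f u = f c by move=> u v; rewrite !H.
  by apply/eqP; rewrite eq_le fc/= fce -lerN2 fe.
move=> fce; have {}fce : f e < f c by rewrite lt_neqAle fc eq_sym fce.
have m1 : measurable ([set v | f v < f c] : set (borel S)) by exact: measurable_continuous_lt.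
have m2 : measurable ([set v | - f v < - f e] : set (borel S)).
  by apply: (@measurable_continuous_lt (fun v => - f v)) => u; apply: cvgN; exact: cf.
have : (pi setT <= pi [set v | (f v < f c)%R] + pi [set v | (- f v < - f e)%R])%E.
  rewrite (_ : setT = [set v | f v < f c] `|` [set v | - f v < - f e]).
    exact: measureU2.
  apply/esym/seteqP; split => // v _ /=; have [vc|cv] := ltP (f v) (f c); first by left.
  by right; rewrite ltrN2 (lt_le_trans fce).
by rewrite pic pie adde0 probability_setT lee_fin ler10.
Qed.

Section fredholm_limit.
Context {U : set_system nat} {UU : UltraFilter U}.

(* [kop] maps bounded sets of functions to equicontinuous ones, so along an
   ultrafilter pointwise limits are uniform. *)
Lemma fredholm_limit (phi r : nat -> S -> R) (r0 : S -> R) (C : R) :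
  (\forall n \near U, measurable_fun [set: borel S] (phi n : borel S -> R)) ->
  (\forall n \near U, forall u, `|phi n u| <= C) ->
  (\forall n \near U, forall u, phi n u = kop (phi n) u + r n u) ->
  continuous r0 ->
  (forall e : R, 0 < e -> \forall n \near U, forall u, `|r n u - r0 u| <= e) ->
  exists f, [/\ continuous f,
    forall e : R, 0 < e -> \forall n \near U, forall u, `|phi n u - f u| <= e &
    forall u, f u = kop f u + r0 u].
Proof.
move=> mphi phiC phiE cr0 rr0.
have FU : Filter U by exact: filter_filter.
have C1 : 0 < `|C| + 1 by rewrite ltr_wpDl.
pose f u := lim (phi n u @[n --> U]).
have ff u : phi n u @[n --> U] --> f u.
  apply: (@ultra_bounded_cvg _ _ _ _ C).
  by apply: filterS phiC => n; exact.
(* The index set [A] is fixed before the neighbourhood, which therefore serves all its indices at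
   once; this is what survives in the limit and makes it uniform. *)
have equi u (e : R) : 0 < e -> exists2 A, U A & \forall v \near u, forall n, A n ->
    `|phi n v - phi n u| <= e.
  move=> e0; have e40 : 0 < e / 4 by rewrite divr_gt0.
  have eC : 0 < e / 4 / (`|C| + 1) by rewrite divr_gt0.
  eexists; first exact: (filterI (filterI mphi phiC) (filterI phiE (rr0 _ e40))).
  have := kop_near K_continuous u eC.
  have /cvgrPdist_le/(_ _ e40) := cr0 u.
  apply: filterS2 => v r0uv kv n [[mn Cn] [E h2]].
  have h1 : `|kop (phi n) v - kop (phi n) u| <= e / 4.
    rewrite (le_trans (kv (phi n) (`|C| + 1) mn _))//.
    - move=> w; apply: (@le_trans _ _ C) => //.
      by rewrite (le_trans (ler_norm _))// lerDl.
    - by rewrite mulrC divfK// gt_eqF.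
  have := h2 v; have := h2 u; move: h1 r0uv.
  rewrite (E v) (E u) !ler_norml => /andP[? ?] /andP[? ?] /andP[? ?] /andP[? ?].
  by apply/andP; split; lra.
have fle u (e : R) : 0 < e -> \forall v \near u, `|f v - f u| <= e.
  move=> e0; have [A UA] := equi u e e0; apply: filterS => v H.
  apply: (cvgr_to_le (cvg_norm (cvgB (ff v) (ff u)))).
  by apply: filterS UA => n; exact: H.
have cf : continuous f.
  move=> u; apply/cvgrPdist_le => e e0; apply: filterS (fle u e e0) => v.
  by rewrite distrC.
have unif (e : R) : 0 < e -> \forall n \near U, forall u, `|phi n u - f u| <= e.
  move=> e0; have e30 : 0 < e / 3 by rewrite divr_gt0.
  suff H : \forall n \near U, [set: S] `<=` (fun u => `|phi n u - f u| <= e).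
    by apply: filterS H => n h u; exact: h.
  apply: ((compact_near_coveringP [set: S]).1 S_compact nat U) => u _.
  have [A UA Av] := equi u _ e30.
  have /cvgrPdist_le/(_ _ e30) UB := ff u.
  exists ([set v | (forall n, A n -> `|phi n v - phi n u| <= e / 3) /\ `|f v - f u| <= e / 3],
    A `&` [set n | `|f u - phi n u| <= e / 3]).
    by split; [apply: filterI => //; exact: fle|exact: filterI].
  move=> [v n]/= [[H1 H2] [An H3]]; have := H1 n An; move: H2 H3.
  rewrite !ler_norml => /andP[? ?] /andP[? ?] /andP[? ?].
  by apply/andP; split; lra.
exists f; split => // u; apply/eqP; rewrite -subr_eq0 -normr_le0; apply/ler_addgt0Pr => e e0.
rewrite add0r; have e40 : 0 < e / 4 by rewrite divr_gt0.
have [n [[[mn Cn] [E h2]] h3]] := filter_ex (filterI (filterI (filterI mphi phiC) (filterI phiE (rr0 _ e40))) (unif _ e40)).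
have bf : bm f by exact: bmeas_continuous.
have bn : bm (phi n) by split => //; exists C.
have h4 : `|kop (phi n) u - kop f u| <= e / 4.
  have [md _] := bmeasB bn bf.
  by have := kop_norm K md h3 u; rewrite kopB.
have := h3 u; have := h2 u; move: h4; rewrite (E u).
rewrite !ler_norml => /andP[? ?] /andP[? ?] /andP[? ?].
by apply/andP; split; lra.
Qed.

End fredholm_limit.

Lemma iter_kop_continuous n f : continuous f -> continuous (iter n kop f).
Proof.
move=> cf; case: n => //= n; apply: kop_continuous => //.
by apply: iter_kop_bmeas; exact: bmeas_continuous.
Qed.

Lemma sum_continuous (g : nat -> S -> R) n : (forall k, continuous (g k)) ->
  continuous (fun u => \sum_(k < n) g k u).
Proof.
move=> cg u; elim: n => [|n ih].
  rewrite (_ : (fun _ => _) = cst 0); first exact: cvg_cst.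
  by apply/funext => v; rewrite big_ord0.
rewrite (_ : (fun _ => _) = (fun u => \sum_(k < n) g k u + g n u)); last first.
  by apply/funext => v; rewrite big_ord_recr.
by apply: cvgD; [exact: ih|exact: cg].
Qed.

Lemma kop_sum (g : nat -> S -> R) n : (forall k, continuous (g k)) ->
  kop (fun u => \sum_(k < n) g k u) = fun u => \sum_(k < n) kop (g k) u.
Proof.
move=> cg; apply/funext => u; elim: n => [|n ih].
  rewrite big_ord0 -[RHS](_ : kop (cst 0) u = 0); last by rewrite kop_cst.
  by congr (kop _ u); apply/funext => v; rewrite big_ord0.
rewrite big_ord_recr/= -ih (_ : (fun u => _) = (fun u => \sum_(k < n) g k u + g n u)).
  by rewrite kopD//; apply: bmeas_continuous => //; exact: sum_continuous.
by apply/funext => v; rewrite big_ord_recr.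
Qed.

Lemma Rintegral_sum (g : nat -> S -> R) n : (forall k, continuous (g k)) ->
  \int[pi]_u (\sum_(k < n) g k u) = \sum_(k < n) \int[pi]_u g k u.
Proof.
move=> cg; elim: n => [|n ih].
  rewrite big_ord0 -[RHS](bint_cst (prob_setT pi)).
  by apply: eq_Rintegral => v _; rewrite big_ord0.
rewrite big_ord_recr/= -ih -(bintD (prob_setT pi)).
- by apply: eq_Rintegral => v _; rewrite big_ord_recr.
- by apply: bmeas_continuous => //; exact: sum_continuous.
- exact: bmeas_continuous.
Qed.

Lemma unif_Rintegral0 (U : set_system nat) (phi : nat -> S -> R) f :
  ProperFilter U -> continuous f -> (\forall n \near U, bm (phi n)) ->
  (\forall n \near U, \int[pi]_u phi n u = 0) ->
  (forall e : R, 0 < e -> \forall n \near U, forall u, `|phi n u - f u| <= e) ->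
  \int[pi]_u f u = 0.
Proof.
move=> UF cf bphi phi0 phif; apply/eqP; rewrite -normr_le0; apply/ler_addgt0Pr => e e0.
have [n [[bn n0] nf]] := filter_ex (filterI (filterI bphi phi0) (phif e e0)).
have bf : bm f by exact: bmeas_continuous.
have [md _] := bmeasB bn bf.
have := bint_norm_le (prob_setT pi) md nf.
by rewrite (bintB (prob_setT pi))// n0 sub0r normrN add0r.
Qed.

Lemma cst_Rintegral0 f : continuous f -> (forall u v, f u = f v) ->
  \int[pi]_u f u = 0 -> forall u, f u = 0.
Proof.
move=> cf fc <- u; rewrite -[LHS](bint_cst (prob_setT pi)).
by apply: eq_Rintegral => v _; exact: fc.
Qed.

Section existence.
Variable d : S -> R.
Hypothesis d_continuous : continuous d.
Hypothesis d_pi : \int[pi]_u d u = 0.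

Let bd : bm d. Proof. exact: bmeas_continuous. Qed.

Let cK k : continuous (iter k kop d). Proof. exact: iter_kop_continuous. Qed.

Let cesaro_continuous n : continuous (cesaro_mean K d n).
Proof.
by move=> u; apply: cvgM; [exact: cvg_cst|exact: (@sum_continuous (fun k => iter k.+1 kop d))].
Qed.

Let kop_cesaro n : kop (cesaro_mean K d n) = cesaro_mean K (kop d) n.
Proof.
apply/funext => u; rewrite /cesaro_mean kopZ; last first.
  by apply: bmeas_continuous => //; exact: (@sum_continuous (fun k => iter k.+1 kop d)).
rewrite (@kop_sum (fun k => iter k.+1 kop d)) //; congr (_ * _).
by apply: eq_bigr => k _; rewrite -iterSr.
Qed.

Let cesaro_pi n : \int[pi]_u cesaro_mean K d n u = 0.
Proof.
rewrite /cesaro_mean (bintZ (prob_setT pi)); last first.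
  by apply: bmeas_continuous => //; exact: (@sum_continuous (fun k => iter k.+1 kop d)).
rewrite (@Rintegral_sum (fun k => iter k.+1 kop d))// big1 ?mulr0// => k _.
by rewrite Rintegral_iter_kop.
Qed.

(** [S_] are the partial sums of the formal solution, the series of K^k d, which may diverge. Their
    averages [psi_] solve the Poisson equation up to [cesaro_mean K d], since S_(j+1) - K S_(j+1) =
    d - K^(j+1) d. *)
Let S_ j u := \sum_(k < j) iter k kop d u.
Let psi_ n u := n.+1%:R^-1 * \sum_(j < n.+1) S_ j.+1 u.

Let cS j : continuous (S_ j). Proof. exact: (@sum_continuous (fun k => iter k kop d)). Qed.

Let cpsi n : continuous (psi_ n).
Proof.
by move=> u; apply: cvgM; [exact: cvg_cst|exact: (@sum_continuous (fun j => S_ j.+1))].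
Qed.

Let psiE n u : psi_ n u = kop (psi_ n) u + (d u - cesaro_mean K d n u).
Proof.
rewrite /psi_ kopZ; last first.
  by apply: bmeas_continuous => //; exact: (@sum_continuous (fun j => S_ j.+1)).
rewrite (@kop_sum (fun j => S_ j.+1))//.
have E j : S_ j.+1 u - kop (S_ j.+1) u = d u - iter j.+1 kop d u.
  rewrite /S_ (@kop_sum (fun k => iter k kop d))// -sumrB.
  rewrite -(big_mkord xpredT (fun k => iter k kop d u - kop (iter k kop d) u)).
  rewrite (eq_bigr (fun k => - iter k.+1 kop d u - - iter k kop d u)) => [|k _].
    by rewrite (telescope_sumr (fun k => - iter k kop d u))// opprK addrC.
  by rewrite opprK addrC.
have -> : d u - cesaro_mean K d n u = n.+1%:R^-1 * (\sum_(j < n.+1) S_ j.+1 u) -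
    n.+1%:R^-1 * (\sum_(j < n.+1) kop (S_ j.+1) u).
  rewrite -mulrBr -sumrB (eq_bigr (fun j : 'I_n.+1 => d u - iter j.+1 kop d u)); last first.
    by move=> j _; exact: E.
  rewrite sumrB sumr_const card_ord -[d u *+ _]mulr_natl mulrBr mulKf//.
by rewrite addrC subrK.
Qed.

Let psi_pi n : \int[pi]_u psi_ n u = 0.
Proof.
rewrite /psi_ (bintZ (prob_setT pi)); last first.
  by apply: bmeas_continuous => //; exact: (@sum_continuous (fun j => S_ j.+1)).
rewrite (@Rintegral_sum (fun j => S_ j.+1))// big1 ?mulr0// => j _.
rewrite (@Rintegral_sum (fun k => iter k kop d))// big1// => k _.
by rewrite Rintegral_iter_kop.
Qed.

(** The error term [cesaro_mean K d] tends to 0 because its limit is harmonic with mean 0. If [psi_]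
    is bounded along [U] its limit is a solution. Otherwise psi_ / M, with M the supremum norm,
    converges uniformly to a harmonic function of mean 0, that is to 0, although each of its terms
    has norm 1. *)
Lemma poisson_exists : exists f, continuous f /\ forall u, f u - kop f u = d u.
Proof.
have [U [UU Uoo]] : exists U : set_system nat, UltraFilter U /\ \oo `<=` U.
  exact: ultraFilterLemma.
have [D D0 dD] := compact_bounded_fun S_compact d_continuous.
have [md _] := bd.
have nU (Q : nat -> Prop) : (forall n, Q n) -> \forall n \near U, Q n.
  by move=> q; apply: Uoo; exists 0%N => // n _; exact: q.
have cesaro0 (e : R) : 0 < e -> \forall n \near U, forall u, `|cesaro_mean K d n u| <= e.
  have [||||| f [cf fU fE]] := @fredholm_limit U UU (cesaro_mean K d)
    (fun n u => cesaro_mean K d n u - kop (cesaro_mean K d n) u) (cst 0) D.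
  - by apply: nU => n; exact: continuous_borel.
  - by apply: nU => n u; exact: cesaro_norm.
  - by apply: nU => n u; rewrite addrC subrK.
  - by move=> u; exact: cvg_cst.
  - move=> r r0; apply: Uoo.
    have /cvgrPdist_le/(_ _ r0) := harmonic_cvg (2 * D).
    apply: filterS => n; rewrite sub0r normrN => nr u; rewrite subr0 distrC kop_cesaro.
    by apply: le_trans (cesaro_kop K n u md dD) _; exact: le_trans (ler_norm _) nr.
  have f0 u : f u = 0.
    apply: cst_Rintegral0 => //.
      by apply: harmonic_cst => // v; rewrite [RHS]fE addr0.
    by apply: (unif_Rintegral0 _ cf _ _ fU); apply: nU => n //; exact: bmeas_continuous.
  move=> e0; apply: filterS (fU e e0) => n h u.
  by have := h u; rewrite f0 subr0.
have bpsi n : bm (psi_ n) by exact: bmeas_continuous.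
have normM n : exists M : R, (forall u, `|psi_ n u| <= M) /\ exists u, `|psi_ n u| = M.
  have [|||c _ cmax] := @compact_EVT_max S R (fun u => `|psi_ n u|) setT => //.
  - by exists point.
  - apply: continuous_subspaceT => u; apply: continuous_comp; first exact: cpsi.
    exact: norm_continuous.
  by exists `|psi_ n c|; split; [move=> u; apply: cmax; rewrite inE|exists c].
have [M hM] := choice normM.
have M0 n : 0 <= M n by have [h _] := hM n; exact: le_trans (h point).
have [[C MC]|unbdd] := pselect (exists C : R, U [set n | M n <= C]).
  have [||||| f [cf fU fE]] := @fredholm_limit U UU psi_
    (fun n u => d u - cesaro_mean K d n u) d C.
  - by apply: nU => n; case: (bpsi n).
  - by apply: filterS MC => n /= nC u; case: (hM n) => h _; exact: le_trans nC.
  - by apply: nU => n u; exact: psiE.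
  - exact: d_continuous.
  - move=> e e0; apply: filterS (cesaro0 e e0) => n h u.
    by rewrite addrAC subrr sub0r normrN.
  exists f; split => // u.
  by rewrite {1}fE addrAC subrr add0r.
(* For an ultrafilter, failing to be bounded means exceeding every bound along it. *)
have Mlarge (C : R) : U [set n | C < M n].
  have [UC|] := in_ultra_setVsetC [set n | M n <= C] UU; first by exfalso; apply: unbdd; exists C.
  by apply: filterS => n /= /negP; rewrite -ltNge.
have [||||| f [cf fU fE]] := @fredholm_limit U UU (fun n u => (M n)^-1 * psi_ n u)
    (fun n u => (M n)^-1 * (d u - cesaro_mean K d n u)) (cst 0) 1.
- by apply: nU => n; case: (bmeasZ (M n)^-1 (bpsi n)).
- apply: filterS (Mlarge 0) => n /= Mn u.
  rewrite normrM gtr0_norm ?invr_gt0// ler_pdivrMl// mulr1.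
  by case: (hM n).
- by apply: nU => n u; rewrite kopZ// {1}psiE mulrDr.
- by move=> u; exact: cvg_cst.
- move=> e e0.
  apply: filterS (Mlarge ((D + D) / e)) => n /= Mn u.
  have M1 : 0 < M n by apply: le_lt_trans Mn; rewrite divr_ge0// ?addr_ge0// ltW.
  rewrite subr0 normrM gtr0_norm ?invr_gt0// ler_pdivrMl//.
  rewrite (le_trans (ler_normB _ _))// (le_trans (lerD (dD u) (cesaro_norm K n u md dD)))//.
  by move: Mn; rewrite ltr_pdivrMr// => /ltW.
have f0 u : f u = 0.
  apply: cst_Rintegral0 => //.
    by apply: harmonic_cst => // v; rewrite [RHS]fE addr0.
  apply: (unif_Rintegral0 _ cf _ _ fU); apply: nU => n.
    exact: bmeasZ.
  by rewrite (bintZ (prob_setT pi))// psi_pi mulr0.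
(* The supremum 1 of the normalised function is attained, which contradicts a uniform bound by 1 /
   2. *)
have half0 : 0 < 2^-1 :> R by rewrite invr_gt0.
have [n [Mn h]] := filter_ex (filterI (Mlarge 0) (fU _ half0)).
have [_ [u uM]] := hM n; have := h u.
rewrite f0 subr0 normrM uM gtr0_norm ?invr_gt0// mulVf ?gt_eqF//.
by move=> ?; exfalso; lra.
Qed.

End existence.

Lemma poisson_unique f g : continuous f -> continuous g ->
  (forall u, f u - kop f u = g u - kop g u) ->
  exists c, f = fun u => g u + c.
Proof.
move=> cf cg fg.
have bf : bm f by exact: bmeas_continuous.
have bg : bm g by exact: bmeas_continuous.
have H : forall u v, f u - g u = f v - g v.
  apply: harmonic_cst; first by move=> u; apply: cvgB; [exact: cf|exact: cg].
  by move=> u; rewrite kopB//; have := fg u; lra.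
exists (f point - g point); apply/funext => u.
by rewrite -(H u point) addrC subrK.
Qed.

Lemma poisson_solutionE d psi : poisson_solution K d psi <->
  continuous psi /\ forall u, psi u - kop psi u = d u.
Proof.
suff E : continuous psi -> forall u, \int[K u]_v (psi u - psi v) = psi u - kop psi u.
  by split=> -[cpsi H]; split=> // u; [rewrite -E//|rewrite E].
move=> cpsi u; rewrite (bintB (kmass K u)) ?(bint_cst (kmass K u))//.
  exact: bmeas_cst.
exact: bmeas_continuous.
Qed.

Lemma kiter_kop n u f : bm f -> \int[kiter K n u]_v f v = iter n kop f u.
Proof.
elim: n u => [|n ih] u bf /=.
  have [mf _] := bf.
  rewrite /Rintegral integral_dirac//; last by apply/measurable_EFinP.
  by rewrite diracT mul1e.
rewrite (Rintegral_mixture (kmass K u) (k := kiter K n))//.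
by apply: eq_Rintegral => v _; rewrite ih.
Qed.

(** For any solution psi the partial sums telescope to psi - K^n psi, and the total variation
    hypothesis gives K^n psi -> pi(psi). The series is therefore psi - pi(psi), the solution of mean
    0. *)
Lemma poisson_series d : continuous d -> \int[pi]_u d u = 0 ->
  ereal_sup [set tv_norm (cadd (kcharge (kiter K n) u)
                               (copp (charge_of_finite_measure pi))) |
             u in [set: S]] @[n --> \oo] --> 0%E ->
  (forall u, cvgn (series (fun n => \int[kiter K n u]_v d v))) /\
  poisson_solution K d
    (fun u => limn (series (fun n => \int[kiter K n u]_v d v))).
Proof.
move=> cd dpi tv0.
have bd : bm d by exact: bmeas_continuous.
have [psi [cpsi psiE]] := poisson_exists cd dpi.
have bpsi : bm psi by exact: bmeas_continuous.
have [C C0 psiC] := compact_bounded_fun S_compact cpsi.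
set c := \int[pi]_u psi u.
have seriesE u n : series (fun n => \int[kiter K n u]_v d v) n = psi u - iter n kop psi u.
  rewrite /series/= (eq_bigr (fun k => - iter k.+1 kop psi u - - iter k kop psi u)) => [|k _].
    by rewrite (telescope_sumr (fun k => - iter k kop psi u))// opprK addrC.
  rewrite kiter_kop// (_ : d = fun u => psi u - kop psi u); last by apply/funext.
  rewrite iter_kopB//; last exact: bmeas_kop.
  by rewrite -iterSr opprK addrC.
have cvKn u : iter n kop psi u @[n --> \oo] --> c.
  apply/cvgrPdist_le => e e0.
  have C1 : 0 < C + 1 by rewrite ltr_wpDl.
  have eC : 0 < e / (C + 1) by rewrite divr_gt0.
  have /fine_cvgP[fin /cvgrPdist_le/(_ _ eC)] := tv0.
  apply: filterS2 fin => n fin; rewrite sub0r normrN => tvn.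
  move: fin tvn => /=; set E := ereal_sup _ => fin tvn.
  rewrite distrC -kiter_kop//.
  rewrite -(@charge_integral_kcharge _ _ _ (borel S) (kiter K n) u)//.
  rewrite -[c](@charge_integral_measure _ (borel S) R (charge_of_finite_measure pi) pi)//.
  rewrite -charge_integral_copp// -charge_integral_cadd//.
  apply: (@le_trans _ _ ((C + 1) * (e / (C + 1)))); last by rewrite mulrC divfK// gt_eqF.
  apply: charge_integral_le_tv.
  - by case: bpsi.
  - by move=> v; rewrite (le_trans (psiC v))// lerDl.
  apply: (@le_trans _ _ E); first by apply: ereal_sup_ubound; exists u.
  by rewrite -(fineK fin) lee_fin (le_trans (ler_norm _)).
have lim_u u : series (fun n => \int[kiter K n u]_v d v) n @[n --> \oo] --> psi u - c.
  by under eq_fun do rewrite seriesE; apply: cvgB; [exact: cvg_cst|exact: cvKn].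
split; first by move=> u; apply/cvg_ex; exists (psi u - c); exact: lim_u.
rewrite (_ : (fun u => _) = fun u => psi u - c); last first.
  by apply/funext => u; apply: (@cvg_lim _ (@Rhausdorff R)); exact: lim_u.
apply/poisson_solutionE; split.
  by move=> u; apply: cvgB; [exact: cpsi|exact: cvg_cst].
move=> u; rewrite kopB//; last exact: bmeas_cst.
by rewrite kop_cst -psiE; lra.
Qed.

End poisson_equation_solution.

(** * Processes on the half-strip *)

Section law_on.
Context d1 d2 (T1 : measurableType d1) (T2 : measurableType d2) {R : realType}.
Variables (mu : {measure set T1 -> \bar R}) (A : set T1) (f : T1 -> T2).
Variables (mA : measurable A) (mf : measurable_fun [set: T1] f).

(** The image under [f] of the restriction of [mu] to [A]. The measurability proofs are arguments so
    that the measure structure attached to it can use them. *)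
Definition law_on of measurable A & measurable_fun [set: T1] f :=
  fun B : set T2 => mu (A `&` f @^-1` B).

Let law := law_on mA mf.

Let mpre B : measurable B -> measurable (f @^-1` B).
Proof. by move=> mB; rewrite -[X in measurable X]setTI; exact: mf. Qed.

Let law0 : law set0 = 0%E.
Proof. by rewrite /law /law_on preimage_set0 setI0 measure0. Qed.

Let law_ge0 B : (0 <= law B)%E. Proof. exact: measure_ge0. Qed.

Let law_sigma_additive : semi_sigma_additive law.
Proof.
move=> B mB tB mUB; rewrite /law /law_on preimage_bigcup setI_bigcupr.
apply: measure_semi_sigma_additive.
- by move=> n; apply: measurableI => //; exact: mpre.
- apply/trivIsetP => /= i j _ _ ij; rewrite setIACA setIid -preimage_setI.
  by move/trivIsetP : tB => /(_ _ _ _ _ ij) ->//; rewrite preimage_set0 setI0.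
- by rewrite -setI_bigcupr -preimage_bigcup; apply: measurableI => //; exact: mpre.
Qed.

HB.instance Definition _ := isMeasure.Build _ _ _ (law_on mA mf)
  law0 law_ge0 law_sigma_additive.

Lemma integral_law_on (g : T2 -> \bar R) : (forall z, 0 <= g z)%E ->
  measurable_fun [set: T2] g ->
  (\int[law_on mA mf]_z g z = \int[mu]_(x in A) g (f x))%E.
Proof.
move=> g0 mg.
rewrite (@integral_mixture _ _ _ _ _ mu A (fun x => dirac (f x)) (law_on mA mf))//.
- apply: eq_integral => x _; rewrite integral_dirac//.
  by rewrite diracT mul1e.
- move=> B mB; rewrite (_ : (fun x => _) = (fun x => (\1_B (f x))%:E)); last first.
    by apply/funext => x; rewrite /dirac/=.
  by apply/measurable_EFinP; apply: measurableT_comp => //; exact: measurable_indic.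
- move=> B mB; rewrite /= /law_on.
  transitivity (\int[mu]_(x in A) (\1_(f @^-1` B) x)%:E)%E.
    by rewrite integral_indic//; [rewrite setIC|exact: mpre].
  by apply: eq_integral => x _; rewrite diracE indicE.
Qed.

End law_on.

Section strip_process.
Context {R : realType} {S : pointedMetricType R}.
Context {d : measure_display} {Omega : measurableType d}.
Variables (P : probability Omega R) (F : nat -> set (set Omega)).
Variables (Ks : R.-pker (state R S) ~> (state R S)) (z0 : state R S).
Variable xi : nat -> Omega -> state R S.
Hypothesis process : half_strip_process P F Ks z0 xi.

Local Open Scope ereal_scope.

Let F_sigma n : sigma_algebra setT (F n). Proof. by case: process => -[]. Qed.

Lemma F_measurable n A : F n A -> measurable A.
Proof. by case: process => -[_ + _] _ _ _ _; exact. Qed.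

Lemma F_adapted n A : measurable A -> F n (xi n @^-1` A).
Proof. by case: process => _ + _ _ _; exact. Qed.

Lemma F_mono m n A : (m <= n)%N -> F m A -> F n A.
Proof. by case: process => -[_ _ Fmn] _ _ _ _ mn; exact: Fmn. Qed.

Lemma F_T n : F n setT.
Proof. by have [F0 FC _] := F_sigma n; rewrite -(setD0 setT); exact: FC. Qed.

Lemma F_C n A : F n A -> F n (~` A).
Proof. by have [_ FC _] := F_sigma n => FA; rewrite -setTD; exact: FC. Qed.

Lemma F_I n A B : F n A -> F n B -> F n (A `&` B).
Proof.
have [_ _ FU] := F_sigma n => FA FB; rewrite -(setCK (A `&` B)); apply: F_C.
rewrite setCI -bigcup2E; apply: FU => -[|[|k]] /=; try exact: F_C.
by have [] := F_sigma n.
Qed.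

Lemma xi_measurable n : measurable_fun [set: Omega] (xi n).
Proof. by move=> _ A mA; rewrite setTI; apply: (@F_measurable n); exact: F_adapted. Qed.

Lemma xi_strip n w : half_strip (xi n w). Proof. by case: process. Qed.

Lemma xi0 w : xi 0 w = z0. Proof. by case: process. Qed.

(** The process is only known through conditional probabilities of sets. Given an event of [F n],
    these say that the law of the next state is a mixture of the measures [Ks (xi n w)]. *)
Lemma markov_step n A (f : state R S -> \bar R) : F n A ->
  (forall z, 0 <= f z) -> measurable_fun setT f ->
  \int[P]_(w in A) f (xi n.+1 w) = \int[P]_(w in A) \int[Ks (xi n w)]_z f z.
Proof.
move=> FA f0 mf; have mA := F_measurable FA.
rewrite -(integral_law_on P mA (xi_measurable n.+1))//.
apply: (@integral_mixture _ _ _ _ _ P A (fun w => Ks (xi n w))) => //.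
- move=> B mB; apply: (measurableT_comp (measurable_kernel Ks B mB)).
  exact: xi_measurable.
- move=> B mB; have [_ _ _ _ /(_ n B mB)[_ _ /(_ A FA)->]] := process.
  transitivity (\int[P]_(w in A) (\1_(xi n.+1 @^-1` B) w)%:E).
    rewrite integral_indic//; first by rewrite setIC.
    by apply: (@F_measurable n.+1); exact: F_adapted.
  by apply: eq_integral => w _; rewrite !indicE.
Qed.

Section supermartingale.
Variables (V b c : state R S -> \bar R) (D : set (state R S)).
Hypotheses (mD : measurable D) (V0 : forall z, 0 <= V z) (b0 : forall z, 0 <= b z)
  (c0 : forall z, 0 <= c z) (mV : measurable_fun setT V)
  (mb : measurable_fun setT b) (mc : measurable_fun setT c).
Hypothesis superV : forall z, half_strip z -> ~ D z ->
  \int[Ks z]_y V y + c z <= V z + b z.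

(** The part of [A] where [D] is avoided at times m, ..., m + k - 1; time m + k is left open. The
    first visit to [D] from time m on thus occurs at m + k on the intersection of [alive A m k] with
    the event that [xi (m + k)] is in [D], and no stopped process is needed. *)
Fixpoint alive (A : set Omega) (m k : nat) : set Omega :=
  if k is k'.+1 then alive A m k' `&` ~` (xi (m + k')%N @^-1` D) else A.

Lemma F_alive A m k : F m A -> F (m + k)%N (alive A m k).
Proof.
move=> FA; elim: k => [|k ih] /=; first by rewrite addn0.
apply: (@F_mono (m + k)); first by rewrite addnS.
by apply: F_I => //; apply: F_C; exact: F_adapted.
Qed.

Lemma F_aliveS A m k : F m A -> F (m + k)%N (alive A m k.+1).
Proof.
move=> FA /=; apply: F_I; first exact: F_alive.
by apply: F_C; exact: F_adapted.
Qed.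

Let mxi (f : state R S -> \bar R) n A : measurable_fun setT f ->
  measurable_fun A (fun w => f (xi n w)).
Proof.
by move=> mf; apply: measurable_funTS; apply: (measurableT_comp mf); exact: xi_measurable.
Qed.

Lemma alive_split A m k (f : state R S -> \bar R) : F m A ->
  (forall z, 0 <= f z) -> measurable_fun setT f ->
  \int[P]_(w in alive A m k) f (xi (m + k)%N w) =
  \int[P]_(w in alive A m k.+1) f (xi (m + k)%N w) +
  \int[P]_(w in alive A m k `&` (xi (m + k)%N @^-1` D)) f (xi (m + k)%N w).
Proof.
move=> FA f0 mf; have m1 := F_measurable (F_alive k FA).
have m2 : measurable (xi (m + k)%N @^-1` D).
  by apply: (@F_measurable (m + k)); exact: F_adapted.
rewrite -ge0_integral_setU//=.
- by rewrite -setIUr setvU setIT.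
- by apply: measurableI => //; exact: measurableC.
- exact: measurableI.
- exact: mxi.
- by apply/disj_setPS => w [[_ +] [_]].
Qed.

(** Among the paths still alive, those now in [D] are set aside with their value of [V], and the
    others make one step under [superV]. All terms stay where they are nonnegative, since the
    integrals may be infinite. *)
Lemma supermartingale_step A m k : F m A ->
  \int[P]_(w in alive A m k.+1) V (xi (m + k).+1 w) +
  (\int[P]_(w in alive A m k.+1) c (xi (m + k)%N w) +
   \int[P]_(w in alive A m k `&` (xi (m + k)%N @^-1` D)) V (xi (m + k)%N w)) <=
  \int[P]_(w in alive A m k) V (xi (m + k)%N w) +
  \int[P]_(w in alive A m k.+1) b (xi (m + k)%N w).
Proof.
move=> FA; have FA1 := F_aliveS k FA; have mA1 := F_measurable FA1.
rewrite (alive_split k FA V0 mV) [leLHS]addeA [leRHS]addeAC; apply: leeD2r.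
rewrite (markov_step FA1)// -!ge0_integralD//; try exact: mxi.
- apply: ge0_le_integral => //.
  + by move=> w _; rewrite adde_ge0// integral_ge0.
  + apply: emeasurable_funD; last exact: mxi.
    apply: (mxi (f := fun z => \int[Ks z]_y V y)).
    by apply: measurable_fun_integral_kernel => // U mU; exact: measurable_kernel.
  + by apply: emeasurable_funD; exact: mxi.
  + by move=> w [_ nD]; apply: superV => //; exact: xi_strip.
- by move=> w _; exact: integral_ge0.
- apply: (mxi (f := fun z => \int[Ks z]_y V y)).
  by apply: measurable_fun_integral_kernel => // U mU; exact: measurable_kernel.
Qed.

(** Optional stopping at the first visit to [D]: the value of [V] on survivors, the accumulated gain
    [c] and the values of [V] collected at the visit are paid for by the initial [V] and the
    accumulated error [b]. *)
Lemma supermartingale_sum A m n : F m A ->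
  \int[P]_(w in alive A m n) V (xi (m + n)%N w) +
  \sum_(k < n) (\int[P]_(w in alive A m k.+1) c (xi (m + k)%N w) +
   \int[P]_(w in alive A m k `&` (xi (m + k)%N @^-1` D)) V (xi (m + k)%N w)) <=
  \int[P]_(w in A) V (xi m w) +
  \sum_(k < n) \int[P]_(w in alive A m k.+1) b (xi (m + k)%N w).
Proof.
move=> FA; elim: n => [|n ih]; first by rewrite !big_ord0 !adde0 addn0.
rewrite big_ord_recr [X in _ <= _ + X]big_ord_recr addnS [X in _ + X]addeC [leLHS]addeA.
apply: (le_trans (leeD2r _ (supermartingale_step n FA))).
by rewrite addeAC [leRHS]addeA; exact: leeD2r.
Qed.

End supermartingale.

End strip_process.

Lemma nneseries_leP {R : realType} (u : nat -> \bar R) (M : \bar R) :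
  (forall k, 0 <= u k)%E -> (forall n, \sum_(k < n) u k <= M)%E ->
  (\sum_(0 <= k <oo) u k <= M)%E.
Proof.
move=> u0 uM; apply: lime_le.
  by apply: is_cvg_nneseries => n _ _; exact: u0.
by apply: nearW => n; rewrite big_mkord.
Qed.

Lemma measurable_fun_inv_ge0 d (T : measurableType d) {R : realType} (f : T -> R) :
  measurable_fun setT f -> (forall x, 0 <= f x) ->
  measurable_fun setT (fun x => (f x)^-1).
Proof.
move=> mf f0; rewrite (_ : (fun x => _) = (fun x => f x `^ (-1))).
  exact: (measurableT_comp (measurable_powR _)).
by apply/funext => x; rewrite powR_inv1.
Qed.

(** * Hitting estimates, recurrence and transience criteria *)

Section hitting.
Context {R : realType} {S : pointedMetricType R}.
Context {d : measure_display} {Omega : measurableType d}.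
Variables (P : probability Omega R) (F : nat -> set (set Omega)).
Variables (Ks : R.-pker (state R S) ~> (state R S)) (z0 : state R S).
Variable xi : nat -> Omega -> state R S.
Hypothesis process : half_strip_process P F Ks z0 xi.

Local Open Scope ereal_scope.

Lemma measurable_xi n A : measurable A -> measurable (xi n @^-1` A).
Proof. by move=> mA; apply: (F_measurable process (n := n)); exact: (F_adapted process). Qed.

(** A maximal inequality for paths that enter [D] through its part [D'], where [V] is at least [a]:
    the values of [V] collected at the first visit sum to at most its initial mean. *)
Lemma hitting_bound (V : state R S -> \bar R) D D' (a : R) A m : F m A ->
  measurable D -> measurable D' -> D' `<=` D -> (0 <= a)%R ->
  (forall z, 0 <= V z) -> measurable_fun setT V ->
  (forall z, half_strip z -> ~ D z -> \int[Ks z]_y V y <= V z) ->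
  (forall z, half_strip z -> D' z -> a%:E <= V z) ->
  a%:E * P (\bigcup_k (alive xi D A m k `&` xi (m + k)%N @^-1` D')) <=
  \int[P]_(w in A) V (xi m w).
Proof.
move=> FA mD mD' D'D a0 V0 mV superV aV.
pose E k := alive xi D A m k `&` xi (m + k)%N @^-1` D'.
have mal k : measurable (alive xi D A m k).
  by apply: (F_measurable process (n := (m + k)%N)); exact: (F_alive process).
have mE k : measurable (E k) by apply: measurableI => //; exact: measurable_xi.
have mUE : measurable (\bigcup_k E k) by exact: bigcupT_measurable.
have H : P (\bigcup_k E k) <= \sum_(0 <= k <oo) P (E k) by exact: measure_sigma_subadditive.
apply: le_trans (lee_wpmul2l _ H) _; first by rewrite lee_fin.
rewrite -nneseriesZl//; apply: nneseries_leP => [k|n]; first by rewrite mule_ge0 ?lee_fin.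
have z00 : forall z : state R S, 0 <= cst (0 : \bar R) z by [].
have mz0 : measurable_fun setT (cst (0 : \bar R) : state R S -> \bar R).
  exact: measurable_cst.
have superV' z : half_strip z -> ~ D z ->
    \int[Ks z]_y V y + cst (0 : \bar R) z <= V z + cst (0 : \bar R) z.
  by move=> hz nD; rewrite /cst/= !adde0; exact: superV.
have H1 := supermartingale_sum process mD V0 z00 z00 mV mz0 mz0 superV' n FA.
apply: le_trans (le_trans _ H1) _; last first.
  by rewrite big1 ?adde0// => k _; rewrite integral0.
rewrite -[leLHS]add0e leeD ?integral_ge0//.
apply: lee_sum => k _; rewrite integral0 add0e.
apply: (@le_trans _ _ (\int[P]_(w in E k) a%:E)).
  by rewrite integral_cst.
apply: (@le_trans _ _ (\int[P]_(w in E k) V (xi (m + k)%N w))).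
  apply: ge0_le_integral => //.
  - by apply: measurable_funTS; apply: (measurableT_comp mV); exact: (xi_measurable process).
  - by move=> w [_ Dw]; apply: aV => //; exact: (xi_strip process).
apply: ge0_subset_integral => //.
- by apply: measurableI => //; exact: measurable_xi.
- by apply: measurable_funTS; apply: (measurableT_comp mV); exact: (xi_measurable process).
- by move=> w [aw Dw]; split => //; exact: D'D.
Qed.

Lemma aliveP D A m k w :
  alive xi D A m k w <-> A w /\ forall j, (j < k)%N -> ~ D (xi (m + j)%N w).
Proof.
elim: k => [|k ih] /=; first by split=> [Aw|[]//]; split.
split=> [[/ih[Aw H] nD]|[Aw H]].
  by split=> // j; rewrite ltnS leq_eqVlt => /orP[/eqP->//|]; exact: H.
by split; [apply/ih; split => // j jk; apply: H; exact: ltnW|exact: H].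
Qed.

Lemma first_hit D A m n w : A w -> (m <= n)%N -> D (xi n w) ->
  exists k, [/\ alive xi D A m k w, D (xi (m + k)%N w) & (m + k <= n)%N].
Proof.
move=> Aw mn Dn.
have ex : exists k, `[< D (xi (m + k)%N w) >].
  by exists (n - m)%N; apply/asboolP; rewrite subnKC.
exists (ex_minn ex); case: ex_minnP => k /asboolP Dk kmin; split => //.
  apply/aliveP; split => // j jk Dj.
  by have := kmin j (asboolT Dj); rewrite leqNgt jk.
rewrite -leq_subRL//; apply: kmin; apply/asboolP; by rewrite subnKC.
Qed.

Lemma ae_le_zero (A : set Omega) : measurable A ->
  (forall e : R, (0 < e)%R -> P A <= e%:E) -> P.-negligible A.
Proof.
move=> mA H; apply/negligibleP => //; apply/eqP; rewrite eq_le measure_ge0 andbT.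
by apply/lee_addgt0Pr => e e0; rewrite add0e; exact: H.
Qed.

Lemma limn_esup_pinfty (u : nat -> \bar R) : limn_esup u = +oo ->
  forall m (M : R), exists2 k, (m <= k)%N & M%:E <= u k.
Proof.
move=> uoo m M; apply: contrapT => nH.
have uM k : (m <= k)%N -> u k <= M%:E.
  move=> mk; rewrite leNgt; apply/negP => Mu; apply: nH; exists k => //; exact: ltW.
have : limn_esup u <= M%:E.
  rewrite limn_esup_lim; apply: lime_le; first exact: is_cvg_esups.
  exists m => // n /= mn; apply: ge_ereal_sup => _ [k /= nk <-].
  by apply: uM; exact: leq_trans nk.
by rewrite uoo leye_eq.
Qed.

Lemma limn_einf_le (u : nat -> \bar R) (r : R) :
  (forall m, exists2 k, (m <= k)%N & u k <= r%:E) -> limn_einf u <= r%:E.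
Proof.
move=> H; rewrite limn_einf_lim; apply: lime_le; first exact: is_cvg_einfs.
apply: nearW => n; have [k nk ukr] := H n.
by apply: le_trans ukr; apply: ereal_inf_lbound; exists k.
Qed.

Lemma measurable_fst_le (r : R) : measurable [set z : state R S | (z.1 <= r)%R].
Proof.
rewrite (_ : mkset _ = fst @^-1` `]-oo, r]%classic); last first.
  by apply/seteqP; split => z /=; rewrite in_itv.
by rewrite -[X in measurable X]setTI; exact: measurable_fst.
Qed.

Lemma measurable_fst_ge (r : R) : measurable [set z : state R S | (r <= z.1)%R].
Proof.
rewrite (_ : mkset _ = fst @^-1` `[r, +oo[%classic); last first.
  by apply/seteqP; split => z /=; rewrite in_itv/= andbT.
by rewrite -[X in measurable X]setTI; exact: measurable_fst.
Qed.

Variable V : state R S -> R.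
Hypothesis mV : measurable_fun setT V.
Hypothesis V0 : forall z, (0 <= V z)%R.

Let mEV : measurable_fun setT (EFin \o V). Proof. exact/measurable_EFinP. Qed.

(** From a height at most C, the probability of reaching the region V >= n + 1 before descending to
    [r0] is at most v(C) / (n + 1). A path whose lower limit exceeds [r0] stays above [r0] from some
    time on, yet reaches every such region by non-confinement; these paths form a null set. *)
Lemma recurrence_criterion (v : R -> R) (r0 : R) :
  (forall z, half_strip z -> (r0 < z.1)%R -> \int[Ks z]_y (V y)%:E <= (V z)%:E) ->
  (forall C : R, 0 <= v C)%R ->
  (forall (C : R) z, half_strip z -> (z.1 <= C)%R -> (V z <= v C)%R) ->
  (forall N : R, exists M : R, forall z, half_strip z -> (M <= z.1)%R -> (N <= V z)%R) ->
  {ae P, forall w, limn_esup (fun n => ((xi n w).1)%:E) = +oo} ->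
  {ae P, forall w, limn_einf (fun n => ((xi n w).1)%:E) <= r0%:E}.
Proof.
move=> superV v0 Vv Vinf.
have [M_ hM] := choice (fun n : nat => Vinf n.+1%:R).
pose lo := [set z : state R S | (z.1 <= r0)%R].
pose hi n := [set z : state R S | (M_ n <= z.1)%R].
pose A m (C : nat) := xi m @^-1` [set z : state R S | (z.1 <= C%:R)%R].
(* From a height at most [C] at time [m], the union of [lo] and [hi n] is entered through [hi n]. *)
pose Q m C n := \bigcup_k (alive xi (lo `|` hi n) (A m C) m k `&` xi (m + k)%N @^-1` hi n).
have mlo : measurable lo by exact: measurable_fst_le.
have mhi n : measurable (hi n) by exact: measurable_fst_ge.
have FA m C : F m (A m C) by apply: (F_adapted process); exact: measurable_fst_le.
have mQ m C n : measurable (Q m C n).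
  apply: bigcupT_measurable => k; apply: measurableI; last exact: measurable_xi.
  exact: (F_measurable process (F_alive process (measurableU _ _ mlo (mhi n)) k (FA m C))).
have PQ m C n : n.+1%:R%:E * P (Q m C n) <= (v C%:R)%:E.
  apply: (@le_trans _ _ (\int[P]_(w in A m C) (V (xi m w))%:E)).
    apply: (@hitting_bound (EFin \o V)) => //.
    - exact: measurableU.
    - move=> z hz nlo; apply: superV => //; rewrite ltNge; apply/negP => zr.
      by apply: nlo; left.
    - by move=> z hz hiz; rewrite /= lee_fin; exact: hM.
  have mA : measurable (A m C) := F_measurable process (FA m C).
  apply: (@le_trans _ _ (\int[P]_(w in A m C) (v C%:R)%:E)).
    apply: ge0_le_integral => //.
    - by move=> w _; rewrite lee_fin.
    - by apply: measurable_funTS; apply: (measurableT_comp mEV); exact: (xi_measurable process).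
    - by move=> w Aw; rewrite lee_fin; apply: Vv => //; exact: (xi_strip process).
  rewrite integral_cst// -[leRHS]mule1; apply: lee_wpmul2l; first by rewrite lee_fin.
  exact: probability_le1.
pose Q' m C := \bigcap_n Q m C n.
have negQ' m C : P.-negligible (Q' m C).
  have mQ' : measurable (Q' m C) by exact: bigcapT_measurable.
  apply: ae_le_zero => // e e0.
  pose n := Num.truncn (v C%:R / e).
  have ne : (v C%:R <= n.+1%:R * e)%R.
    by rewrite -ler_pdivrMr// ltW// truncnS_gt.
  apply: (@le_trans _ _ (P (Q m C n))).
    by apply: le_measure; rewrite ?inE// => w; apply.
  rewrite -(@lee_pmul2l _ n.+1%:R%:E)//= ?lte_fin//.
  by apply: (le_trans (PQ m C n)); rewrite -EFinM lee_fin.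
move=> nonconf.
have nU : P.-negligible (\bigcup_m \bigcup_C Q' m C).
  by apply: negligible_bigcup => m; exact: negligible_bigcup.
apply: (negligibleS _ (negligibleU nonconf nU)) => w /= wbad.
have [nc|nc] := pselect (limn_esup (fun n => ((xi n w).1)%:E) = +oo); last by left.
right.
have [m hm] : exists m, forall k, (m <= k)%N -> (r0 < (xi k w).1)%R.
  apply: contrapT => nH; apply: wbad; apply: limn_einf_le => m.
  apply: contrapT => nk; apply: nH; exists m => k mk.
  rewrite ltNge; apply/negP => kr; apply: nk; exists k => //.
exists m => //; pose C := Num.truncn (`|(xi m w).1|)%R.
exists C.+1 => // n _.
have Aw : A m C.+1 w.
  by rewrite /A/= (le_trans (ler_norm _))// ltW// truncnS_gt.
have [j mj Mj] := limn_esup_pinfty nc m (M_ n).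
have [|k [ak Dk mkj]] := @first_hit (lo `|` hi n) _ m j w Aw mj.
  by right; rewrite /hi/= -lee_fin.
exists k => //; split => //; case: Dk => //.
by rewrite /lo/= leNgt hm// leq_addr.
Qed.

(** At the first visit to a far region V is at most 1 / (n + 1), while below a given level it is at
    least some c > 0, so a later return below that level has probability at most 1 / (c (n + 1)).
    Non-confinement guarantees the visit for every n; infinitely many returns are therefore
    negligible. *)
Lemma transience_criterion (r0 : R) :
  (forall z, half_strip z -> (r0 < z.1)%R -> \int[Ks z]_y (V y)%:E <= (V z)%:E) ->
  (forall r : R, exists2 c : R, (0 < c)%R &
    forall z, half_strip z -> (z.1 <= r)%R -> (c <= V z)%R) ->
  (forall e : R, (0 < e)%R -> exists M : R,
    forall z, half_strip z -> (M <= z.1)%R -> (V z <= e)%R) ->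
  {ae P, forall w, limn_esup (fun n => ((xi n w).1)%:E) = +oo} ->
  {ae P, forall w, (xi n w).1 @[n --> \oo] --> +oo%R}.
Proof.
move=> superV Vlow Vsmall nonconf.
have inv0 n : (0 < n.+1%:R^-1 :> R)%R by rewrite invr_gt0.
have [M_ hM] := choice (fun n : nat => Vsmall _ (inv0 n)).
pose hi n := [set z : state R S | (M_ n <= z.1)%R].
have mhi n : measurable (hi n) by exact: measurable_fst_ge.
(* Shifted levels: above each of them the supermartingale inequality holds. *)
pose rr (r : nat) : R := (r%:R + `|r0|)%R.
pose lo r := [set z : state R S | (z.1 <= rr r)%R].
have mlo r : measurable (lo r) by exact: measurable_fst_le.
pose E n m := alive xi (hi n) setT 0 m `&` xi (0 + m)%N @^-1` hi n.
have FE n m : F m (E n m).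
  apply: (F_I process); last exact: (F_adapted process).
  by have := F_alive process (mhi n) m (F_T process 0); rewrite add0n.
have mE n m : measurable (E n m) := F_measurable process (FE n m).
pose H r n m := \bigcup_k (alive xi (lo r) (E n m) m k `&` xi (m + k)%N @^-1` lo r).
have mH r n m : measurable (H r n m).
  apply: bigcupT_measurable => k; apply: measurableI; last exact: measurable_xi.
  exact: (F_measurable process (F_alive process (mlo r) k (FE n m))).
(* [E n m] is the event that the first visit to [hi n] takes place at time [m]; these events are
   disjoint. *)
have PE n : \sum_(0 <= m <oo) P (E n m) <= 1.
  rewrite (_ : limn _ = P (\bigcup_m E n m)).
    by apply: probability_le1; exact: bigcupT_measurable.
  apply: (@cvg_lim _ (@ereal_hausdorff R)); apply: measure_semi_sigma_additive => //.
    2: exact: bigcupT_measurable.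
  apply/trivIsetP => /=; suff lt_case i j : (i < j)%N -> E n i `&` E n j = set0.
    move=> i j _ _; rewrite neq_ltn => /orP[/lt_case//|/lt_case].
    by rewrite setIC.
  move=> ij; apply/seteqP; split => // w [[_ hi_i] [/aliveP[_ nhi] _]].
  exact: (nhi i ij).
have negI r : P.-negligible (\bigcap_n \bigcup_m H r n m).
  have [c c0 Vc] := Vlow (rr r).
  apply: ae_le_zero => [|e e0].
    by apply: bigcapT_measurable => n; exact: bigcupT_measurable.
  pose n := Num.truncn (e * c)^-1%R.
  have ne : (n.+1%:R^-1 <= c * e)%R.
    rewrite -[leRHS]invrK lef_pV2 ?posrE ?invr_gt0 ?mulr_gt0//.
    by rewrite ltW// mulrC truncnS_gt.
  apply: (@le_trans _ _ (P (\bigcup_m H r n m))).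
    apply: le_measure; rewrite ?inE//; last by move=> w; apply.
      by apply: bigcapT_measurable => k; exact: bigcupT_measurable.
    exact: bigcupT_measurable.
  rewrite -(@lee_pmul2l _ c%:E)//= ?lte_fin//.
  apply: (@le_trans _ _ (n.+1%:R^-1)%:E); last by rewrite -EFinM lee_fin.
  have H1 : P (\bigcup_m H r n m) <= \sum_(0 <= m <oo) P (H r n m).
    by apply: measure_sigma_subadditive => //; exact: bigcupT_measurable.
  apply: (le_trans (lee_wpmul2l _ H1)); first by rewrite lee_fin ltW.
  rewrite -nneseriesZl//.
  rewrite -[leRHS]mule1.
  apply: (@le_trans _ _ ((n.+1%:R^-1)%:E * \sum_(0 <= m <oo) P (E n m))); last first.
    by apply: lee_wpmul2l => //; rewrite lee_fin ltW.
  rewrite -nneseriesZl//.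
  apply: lee_nneseries => [m _ _|m _]; first by apply: mule_ge0 => //; rewrite lee_fin ltW.
  apply: (@le_trans _ _ (\int[P]_(w in E n m) (V (xi m w))%:E)).
    apply: (@hitting_bound (EFin \o V) (lo r) (lo r)) => //; first exact: ltW.
    - move=> z hz nlo; apply: superV => //; rewrite ltNge; apply/negP => zr.
      by apply: nlo; rewrite /lo/=/rr (le_trans zr)// (le_trans (ler_norm _))// lerDr.
  rewrite -integral_cst//; apply: ge0_le_integral => //.
  - by move=> w _; rewrite lee_fin.
  - by apply: measurable_funTS; apply: (measurableT_comp mEV); exact: (xi_measurable process).
  - by move=> w [_ hw]; rewrite lee_fin; exact: (hM n (xi m w) (xi_strip process m w) hw).
have nU : P.-negligible (\bigcup_r \bigcap_n \bigcup_m H r n m).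
  exact: negligible_bigcup.
apply: (negligibleS _ (negligibleU nonconf nU)) => w /= wbad.
have [nc|nc] := pselect (limn_esup (fun n => ((xi n w).1)%:E) = +oo); last by left.
right.
have [r hr] : exists r : nat, forall m, exists2 k, (m <= k)%N & ((xi k w).1 <= rr r)%R.
  apply: contrapT => nH; apply: wbad; apply/cvgryPge => a.
  apply: contrapT => na; apply: nH; exists (Num.truncn `|a|).+1 => m.
  apply: contrapT => nk; apply: na; exists m => // k /= mk.
  rewrite leNgt; apply/negP => ka; apply: nk; exists k => //; apply: ltW.
  rewrite (lt_le_trans ka)// /rr (le_trans (ler_norm _))// (le_trans (ltW (truncnS_gt _)))//.
  by rewrite lerDl.
exists r => // n _.
have [j _ Mj] := limn_esup_pinfty nc 0 (M_ n).
have [|m [am hm _]] := @first_hit (hi n) setT 0 j w I (leq0n j).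
  by rewrite /hi/= -lee_fin.
have [j' mj' lowj] := hr m.
exists m => //.
have [k [ak Dk _]] := @first_hit (lo r) (E n m) m j' w (conj am hm) mj' lowj.
by exists k.
Qed.

End hitting.

(** * Mean passage times *)

Lemma ratio_gap {R : realFieldType} (A x y : R) :
  x <= A -> y <= A -> x < y -> 0 < A -> 0 <= x ->
  (y - x) / 4 * ((A + x) * (A + y)) <= A * A * (y - x).
Proof.
move=> xA yA xy A0 x0.
have xA2 : (A + x) * (A + y) <= 4 * (A * A).
  rewrite (_ : 4 * (A * A) = (2 * A) * (2 * A)); last by ring.
  by apply: ler_pM; rewrite ?addr_ge0//; lra.
by nra.
Qed.

Lemma gap_contradiction {R : realFieldType} (l w p b a : R) :
  l - p <= w + b -> a <= l - w -> p <= a / 4 -> b <= a / 2 -> 0 < a -> False.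
Proof. by move=> *; lra. Qed.

Section passage.
Context {R : realType} {S : pointedMetricType R}.
Context {d : measure_display} {Omega : measurableType d}.
Variables (P : probability Omega R) (F : nat -> set (set Omega)).
Variables (Ks : R.-pker (state R S) ~> (state R S)) (z0 : state R S).
Variable xi : nat -> Omega -> state R S.
Hypothesis process : half_strip_process P F Ks z0 xi.
Variable r : R.

Local Open Scope ereal_scope.

(** The same infimum as [passage_time], for a single process instead of the family indexed by
    initial states. *)
Definition passage (w : Omega) : \bar R :=
  ereal_inf [set (n%:R)%:E | n in [set n : nat | ((xi n w).1 <= r)%R]].

Definition low := [set z : state R S | (z.1 <= r)%R].

Lemma measurable_low : measurable low.
Proof. exact: measurable_fst_le. Qed.

Definition above k := alive xi low setT 0 k.

Lemma measurable_above k : measurable (above k).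
Proof. exact: (F_measurable process (F_alive process measurable_low k (F_T process 0))). Qed.

Lemma aboveP k w : above k w <-> forall j, (j < k)%N -> (r < (xi j w).1)%R.
Proof.
split=> [/aliveP[_ H] j jk|H]; first by have := H j jk => /negP; rewrite -ltNge.
by apply/aliveP; split => // j jk; apply/negP; rewrite -ltNge; exact: H.
Qed.

(** The passage time counts the k for which times 0, ..., k are all spent above [r]. If the level is
    never reached, both sides are +oo, the infimum being over the empty set. *)
Lemma passage_series w : passage w = \sum_(0 <= k <oo) (\1_(above k.+1) w)%:E.
Proof.
have i0 k : 0 <= (\1_(above k) w : R)%:E by rewrite lee_fin indicE.
have [[j jr]|nhit] := pselect (exists j, ((xi j w).1 <= r)%R).
  have ex : exists k, ((xi k w).1 <= r)%R by exists j.
  pose k0 := ex_minn ex.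
  have [k0r kmin] : ((xi k0 w).1 <= r)%R /\ forall k, ((xi k w).1 <= r)%R -> (k0 <= k)%N.
    by rewrite /k0; case: ex_minnP.
  have pE : passage w = k0%:R%:E.
    apply/eqP; rewrite eq_le; apply/andP; split; first by apply: ereal_inf_lbound; exists k0.
    by apply: le_ereal_inf_tmp => _ [n /= nr <-]; rewrite lee_fin ler_nat kmin.
  have one k : (k < k0)%N -> \1_(above k.+1) w = 1%R :> R.
    move=> kk0; rewrite indicE mem_set//; apply/aboveP => i ik; rewrite ltNge; apply/negP => /kmin.
    by rewrite leqNgt (leq_ltn_trans _ kk0)// -ltnS.
  have zero k : (k0 <= k)%N -> \1_(above k.+1) w = 0%R :> R.
    move=> kk0; rewrite indicE memNset// => /aboveP/(_ k0); rewrite ltnS => /(_ kk0).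
    by rewrite ltNge k0r.
  rewrite pE; apply/esym; apply: (@cvg_lim _ (@ereal_hausdorff R)).
  apply: cvg_near_cst; exists k0 => // n /= k0n.
  rewrite (big_cat_nat (n := k0))//= [X in _ + X]big_nat_cond [X in _ + X]big1 ?adde0; last first.
    by move=> i /andP[/andP[k0i _] _]; rewrite zero.
  rewrite big_nat_cond (eq_bigr (fun=> 1%:E)) => [|i /andP[/andP[_ ik0] _]]; last by rewrite one.
  by rewrite -big_nat_cond sumEFin big_const_nat subn0 iter_addr_0.
have -> : passage w = +oo.
  rewrite /passage (_ : mkset _ = set0) ?image_set0 ?ereal_inf0//.
  by apply/seteqP; split => // n /= nr; apply: nhit; exists n.
have one k : \1_(above k.+1) w = 1%R :> R.
  rewrite indicE mem_set//; apply/aboveP => i ik; rewrite ltNge; apply/negP => ir.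
  by apply: nhit; exists i.
apply/esym/eq_infty => M; pose n := (Num.truncn `|M|).+1.
have : (n%:R%:E <= \sum_(0 <= k <oo) (\1_(above k.+1) w : R)%:E).
  apply: le_trans (nneseries_lim_ge n _) => //.
  by under eq_bigr do rewrite one; rewrite sumEFin big_const_nat subn0 iter_addr_0.
by apply: le_trans; rewrite lee_fin (le_trans (ler_norm _))// ltW// truncnS_gt.
Qed.

Lemma integral_passage :
  \int[P]_w passage w = \sum_(0 <= k <oo) P (above k.+1).
Proof.
under eq_integral do rewrite passage_series.
rewrite integral_nneseries//.
- apply: eq_eseriesr => k _; rewrite integral_indic ?setIT//; exact: measurable_above.
- by move=> k; apply/measurable_EFinP; apply: measurable_indic; exact: measurable_above.
Qed.

(** Foster's argument: each step started above [r] lowers the mean of [V] by at least [e], so the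
    expected number of such steps is at most V(z0) / e. *)
Lemma passage_finite (V : state R S -> R) (e : R) : (0 < e)%R ->
  measurable_fun setT V -> (forall z, (0 <= V z)%R) ->
  (forall z, half_strip z -> (r < z.1)%R ->
    \int[Ks z]_y (V y)%:E + e%:E <= (V z)%:E) ->
  \int[P]_w passage w < +oo.
Proof.
move=> e0 mV V0 superV; rewrite integral_passage.
have mEV : measurable_fun setT (EFin \o V) by exact/measurable_EFinP.
apply: (@le_lt_trans _ _ (e^-1 * V z0)%:E); last exact: ltry.
apply: nneseries_leP => // n.
have z00 : forall z : state R S, 0 <= cst (0 : \bar R) z by [].
have ze0 : forall z : state R S, 0 <= cst (e%:E : \bar R) z by move=> z; rewrite lee_fin ltW.
have superV' z : half_strip z -> ~ low z ->
    \int[Ks z]_y (EFin \o V) y + cst (e%:E : \bar R) z <= (EFin \o V) z + cst (0 : \bar R) z.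
  by move=> hz /negP; rewrite -ltNge /cst/= adde0 => /superV; exact.
have V0' z : 0 <= (EFin \o V) z by rewrite lee_fin.
have := supermartingale_sum process measurable_low V0' z00 ze0 mEV (measurable_cst _)
  (measurable_cst _) superV' n (F_T process 0).
rewrite [X in _ <= _ + X]big1 ?adde0; last by move=> k _; rewrite integral0.
under [X in _ <= X]eq_integral do rewrite (xi0 process)/=.
rewrite integral_cst// prob_setT mule1 => H.
rewrite -(@lee_pmul2l _ e%:E)//= ?lte_fin// -EFinM mulrA mulfV ?gt_eqF// mul1r.
apply: le_trans H; rewrite -[leLHS]add0e; apply: leeD; first exact: integral_ge0.
rewrite ge0_sume_distrr//; apply: lee_sum => k _.
rewrite integral_cst//; last exact: (measurable_above k.+1).
by rewrite leeDl// integral_ge0.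
Qed.

(** With tau the passage time, [pr k] is the probability of tau >= k, and [hit k] below that of tau
    = k. *)
Let pr k := fine (P (above k)).

Let prE k : (pr k)%:E = P (above k).
Proof. by rewrite /pr fineK// fin_num_measure//; exact: measurable_above. Qed.

Let pr0 k : (0 <= pr k)%R. Proof. exact: fine_ge0. Qed.

Let hit k := fine (P (above k `&` xi k @^-1` low)).

Let mhit k : measurable (above k `&` xi k @^-1` low).
Proof.
by apply: measurableI; [exact: measurable_above|apply: (measurable_xi process); exact: measurable_low].
Qed.

Let hitE k : (hit k)%:E = P (above k `&` xi k @^-1` low).
Proof. by rewrite /hit fineK// fin_num_measure. Qed.

Let pr_split k : pr k = (pr k.+1 + hit k)%R.
Proof.
apply/EFin_inj; rewrite EFinD !prE hitE.
have E : above k = above k.+1 `|` (above k `&` xi k @^-1` low).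
  apply/seteqP; split=> [w ak|w [[]//|[]//]].
  by have [lw|nlw] := pselect (low (xi k w)); [right|left].
rewrite {1}E measureU//; first exact: (measurable_above k.+1).
by apply/seteqP; split => // w [[_ nlw] [_ lw]]; exact: nlw.
Qed.

Let hit_sum n : (\sum_(k < n) hit k = 1 - pr n)%R.
Proof.
elim: n => [|n ih].
  by rewrite big_ord0 /pr /= probability_setT subrr.
by rewrite big_ord_recr/= ih; have := pr_split n; lra.
Qed.

(** Stopping W = N^4 / (N^2 + G^2) on reaching the low region, where W >= N^4 / (N^2 + rho^2), would
    raise its mean by a gap bounded below independently of N. The allowed increase is [B] times the
    expected time spent above eta N before passage; were the mean passage time finite, this would
    tend to 0 as N grows. *)
Lemma passage_infinite (G : state R S -> R) (rho eta B : R) :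
  measurable_fun setT G -> (forall z, (0 <= G z)%R) -> (0 < eta)%R -> (0 <= B)%R ->
  (0 <= rho)%R ->
  (forall z, half_strip z -> (z.1 <= r)%R -> (G z <= rho)%R) -> (rho < G z0)%R ->
  (forall N : R, (1 <= N)%R -> forall z, half_strip z -> (r < z.1)%R ->
    \int[Ks z]_y (N ^+ 4 / (N ^+ 2 + G y ^+ 2))%:E <=
    (N ^+ 4 / (N ^+ 2 + G z ^+ 2) + B * (\1_[set y | (eta * N < G y)%R] z))%:E) ->
  \int[P]_w passage w = +oo.
Proof.
move=> mG G0 eta0 B0 rho0 Grho Gz0 superV.
apply: contrapT => /eqP; rewrite -ltey integral_passage => Tfin.
set T := \sum_(0 <= k <oo) P (above k.+1) in Tfin.
have Tfin' : T \is a fin_num.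
  by rewrite ge0_fin_numE//; apply: nneseries_ge0.
have sum_le n : (\sum_(k < n) pr k.+1 <= fine T)%R.
  rewrite -lee_fin fineK// -sumEFin.
  under eq_bigr do rewrite prE.
  by rewrite -(big_mkord xpredT (fun k => P (above k.+1))); exact: nneseries_lim_ge.
have T0 : (0 <= fine T)%R by rewrite fine_ge0// nneseries_ge0.
pose sums := [set (\sum_(k < n) pr k.+1)%R | n in [set: nat]].
have hs : has_sup sums.
  by split; [exists (\sum_(k < 0) pr k.+1)%R, 0%N|exists (fine T) => _ [n _ <-]].
(* The lower bound of the gap: for rho and G z0 at most N, the two denominators N^2 + rho^2 and N^2
   + G z0^2 are at most 2 N^2, whence the factor 1 / 4 ([ratio_gap]). *)
pose a2 : R := ((G z0 ^+ 2 - rho ^+ 2) / 4)%R.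
have a20 : (0 < a2)%R.
  by rewrite divr_gt0// subr_gt0 ltr_pXn2r// nnegrE// ltW.
(* The visits above eta N will have total mass at most 2 e, so that [B] times it is at most a2 / 2;
   the summand 1 covers [B] = 0. *)
pose e : R := (a2 / (4 * (B + 1)))%R.
have B1 : (0 < B + 1)%R by rewrite ltr_wpDl.
have e0 : (0 < e)%R by rewrite divr_gt0// mulr_gt0.
(* After [n0] steps the series for the mean passage time has less than [e] left, whatever N; only
   finitely many times remain to be treated by letting N grow. *)
have [_ [n0 _ <-] n0sup] := sup_adherent e0 hs.
have tail n : (\sum_(k < n) pr k.+1 <= \sum_(k < n0) pr k.+1 + e)%R.
  rewrite -lerBlDr; apply/ltW/(le_lt_trans _ n0sup); rewrite lerD2r.
  by apply: ub_le_sup; [case: hs|exists n].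
(* the mass of the visits to high levels before time n0 vanishes *)
pose Q (N : R) k := above k.+1 `&` xi k @^-1` [set y | (eta * N < G y)%R].
have mGN (N : R) : measurable [set y : state R S | (eta * N < G y)%R].
  rewrite (_ : mkset _ = G @^-1` `](eta * N)%R, +oo[%classic); last first.
    by apply/seteqP; split => y /=; rewrite in_itv/= andbT.
  by rewrite -[X in measurable X]setTI; exact: mG.
have mQ N k : measurable (Q N k).
  apply: measurableI; first exact: measurable_above.
  exact: (measurable_xi process).
pose q N k := fine (P (Q N k)).
have qE N k : (q N k)%:E = P (Q N k) by rewrite /q fineK// fin_num_measure.
have q0 N k : (0 <= q N k)%R by exact: fine_ge0.
have qpr N k : (q N k <= pr k.+1)%R.
  rewrite -lee_fin qE prE; apply: le_measure; rewrite ?inE//.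
    exact: measurable_above.
  by move=> w [].
have qcvg k : \forall n \near \oo, (q n%:R k <= e / n0.+1%:R)%R.
  have : P (Q n%:R k) @[n --> \oo] --> P (\bigcap_n Q n%:R k).
    apply: nonincreasing_cvg_mu => //.
    - by rewrite -ge0_fin_numE ?fin_num_measure.
    - exact: bigcapT_measurable.
    - move=> m n mn; apply/subsetPset => w [ak Gk]; split => //=.
      by rewrite (le_lt_trans _ Gk)// ler_wpM2l ?(ltW eta0)// ler_nat.
  rewrite (_ : \bigcap_n _ = set0) ?measure0; last first.
    apply/seteqP; split => // w Qw.
    have [_ /=] := Qw (Num.truncn (G (xi k w) / eta)).+1 I.
    by rewrite ltNge mulrC -ler_pdivrMr// => /negP; apply; rewrite ltW// truncnS_gt.
  move/fine_cvgP => [_ /cvgrPdist_le/(_ (e / n0.+1%:R)%R)]; rewrite divr_gt0// => /(_ isT).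
  apply: filterS => n; rewrite sub0r normrN /= => h.
  exact: le_trans (ler_norm _) h.
have qcvg_all : \forall n \near \oo, forall k : 'I_n0, (q n%:R k <= e / n0.+1%:R)%R.
  by apply: filter_forall => k; exact: qcvg.
pose M := (Num.truncn (G z0)).+1.
have [n1 [n1q Mn1]] : exists n1, (forall k : 'I_n0, (q n1%:R k <= e / n0.+1%:R)%R) /\ (M <= n1)%N.
  have : \forall n \near \oo, (M <= n)%N by exists M.
  by move/(filterI qcvg_all) => /filter_ex[n []]; exists n.
pose N : R := n1%:R.
have NG : (G z0 <= N)%R by rewrite (le_trans (ltW (truncnS_gt _)))// ler_nat.
have N1 : (1 <= N)%R by rewrite ler1n (leq_trans _ Mn1).
have N0 : (0 < N)%R by exact: lt_le_trans ltr01 N1.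
have sumq n : (n0 <= n)%N -> (\sum_(k < n) q N k <= e + e)%R.
  move=> n0n; rewrite -(big_mkord xpredT (fun k => q N k)) (big_cat_nat (n := n0))//=.
  apply: lerD.
    rewrite big_mkord; apply: (@le_trans _ _ (\sum_(k < n0) e / n0.+1%:R)%R).
      by apply: ler_sum => k _; exact: n1q.
    rewrite sumr_const card_ord -[leLHS]mulr_natl [leLHS]mulrCA ler_piMr ?(ltW e0)//.
    by rewrite ler_pdivrMr// mul1r ler_nat.
  apply: (@le_trans _ _ (\sum_(n0 <= k < n) pr k.+1)%R).
    by apply: ler_sum => k _; exact: qpr.
  have := tail n; rewrite -!(big_mkord xpredT (fun k => pr k.+1)).
  by rewrite (big_cat_nat (n := n0))//= lerD2l.
have pr_anti m n : (m <= n)%N -> (pr n <= pr m)%R.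
  elim: n => [|n ih]; first by rewrite leqn0 => /eqP->.
  rewrite leq_eqVlt => /predU1P[->//|]; rewrite ltnS => /ih; apply: le_trans.
  by rewrite (pr_split n) lerDl fine_ge0.
have pr_small (e' : R) : (0 < e')%R -> exists2 n, (n0 <= n)%N & (pr n <= e')%R.
  move=> e'0; pose m := maxn n0 (Num.truncn (fine T / e')).+1.
  have m0 : (0 < m)%N by rewrite leq_max ltnS leq0n orbT.
  exists m; first exact: leq_maxl.
  have : (m%:R * pr m <= fine T)%R.
    apply: le_trans (sum_le m).
    rewrite mulr_natl -[m in (_ *+ m)%R]card_ord -sumr_const; apply: ler_sum => k _.
    by apply: pr_anti; exact: ltn_ord.
  rewrite -ler_pdivlMl ?ltr0n// => /le_trans; apply.
  rewrite ler_pdivrMl ?ltr0n// -ler_pdivrMr//.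
  by apply: (le_trans (ltW (truncnS_gt _))); rewrite ler_nat leq_maxr.
(* [n] is chosen after [N]: the value [lowW] is at most N^2, so the paths not yet stopped at time
   [n] cost at most a2 / 4. *)
have [|n n0n prn] := pr_small (a2 / (4 * N ^+ 2))%R.
  by rewrite divr_gt0// mulr_gt0// exprn_gt0.
pose W y : R := (N ^+ 4 / (N ^+ 2 + G y ^+ 2))%R.
pose b y : R := (B * (\1_[set y | (eta * N < G y)%R] y))%R.
have N20 : (0 < N ^+ 2)%R by rewrite exprn_gt0.
have den0 (x : R) : (0 < N ^+ 2 + x ^+ 2)%R by rewrite ltr_pwDl// sqr_ge0.
have W0 y : (0 <= W y)%R by rewrite divr_ge0 ?exprn_ge0 ?(ltW N0)// ltW.
have mW : measurable_fun setT W.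
  apply: measurable_funM; first exact: measurable_cst.
  apply: measurable_fun_inv_ge0 => [|y]; last exact: ltW.
  by apply: measurable_funD; [exact: measurable_cst|exact: measurable_funX].
have b0 y : (0 <= b y)%R by rewrite mulr_ge0// indicE.
have mb : measurable_fun setT b.
  by apply: measurable_funM; [exact: measurable_cst|exact: measurable_indic].
have mEW : measurable_fun setT (EFin \o W) by exact/measurable_EFinP.
have mEb : measurable_fun setT (EFin \o b) by exact/measurable_EFinP.
have z00 : forall z : state R S, 0 <= cst (0 : \bar R) z by [].
have EW0 z : 0 <= (EFin \o W) z by rewrite lee_fin.
have Eb0 z : 0 <= (EFin \o b) z by rewrite lee_fin.
have superV' z : half_strip z -> ~ low z ->
    \int[Ks z]_y (EFin \o W) y + cst (0 : \bar R) z <= (EFin \o W) z + (EFin \o b) z.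
  by move=> hz /negP; rewrite -ltNge /cst/= adde0 => /(superV N N1 z hz).
have := supermartingale_sum process measurable_low EW0 Eb0 z00 mEW mEb
  (measurable_cst _) superV' n (F_T process 0).
have -> : \int[P]_w (EFin \o W) (xi 0 w) = (W z0)%:E.
  under eq_integral do rewrite (xi0 process)/=.
  by rewrite integral_cst// prob_setT mule1.
move=> H.
pose lowW : R := (N ^+ 4 / (N ^+ 2 + rho ^+ 2))%R.
have : ((lowW * \sum_(k < n) hit k)%:E <= (W z0)%:E + (B * \sum_(k < n) q N k)%:E).
  apply: (le_trans (le_trans _ H)).
    rewrite -[leLHS]add0e; apply: leeD; first exact: integral_ge0.
    rewrite mulr_sumr -sumEFin; apply: lee_sum => k _; rewrite integral0 add0e.
    rewrite EFinM hitE -integral_cst; last exact: mhit.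
    apply: ge0_le_integral => //=.
    - by move=> w _; rewrite lee_fin divr_ge0 ?exprn_ge0 ?(ltW N0)// ltW.
    - by apply: measurable_funTS; apply: (measurableT_comp mEW); exact: (xi_measurable process).
    - move=> w [_ lw]; rewrite lee_fin; apply: ler_wpM2l; first by rewrite exprn_ge0// ltW.
      rewrite lef_pV2 ?posrE// lerD2l lerXn2r ?nnegrE//.
      by apply: Grho => //; exact: (xi_strip process).
  apply: leeD => //; rewrite mulr_sumr -sumEFin; apply: lee_sum => k _.
  rewrite (eq_integral (fun w => B%:E * (\1_(xi k @^-1` [set y | (eta * N < G y)%R]) w)%:E)); last first.
    by move=> w _; rewrite /b/= -EFinM; congr (_ * _)%:E; rewrite !indicE.
  have mk1 : measurable (xi k @^-1` [set y | (eta * N < G y)%R]) by exact: (measurable_xi process).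
  rewrite ge0_integralZl//; last 2 first.
  - exact: (measurable_above k.+1).
  - by apply: measurable_funTS; apply/measurable_EFinP; exact: measurable_indic.
  rewrite integral_indic//; last exact: (measurable_above k.+1).
  by rewrite EFinM qE setIC.
rewrite -EFinD lee_fin hit_sum => {}H.
have sq := sumq n n0n.
have X1 : (lowW - W z0 >= a2)%R.
  have rN : (rho <= N)%R by rewrite (le_trans (ltW Gz0)).
  have h1 : (rho ^+ 2 <= N ^+ 2)%R by rewrite lerXn2r ?nnegrE// ltW.
  have h2 : (G z0 ^+ 2 <= N ^+ 2)%R by rewrite lerXn2r ?nnegrE// ltW.
  have h3 : (rho ^+ 2 < G z0 ^+ 2)%R by rewrite ltrXn2r// ?nnegrE// ltW.
  have -> : (lowW - W z0 = N ^+ 4 * (G z0 ^+ 2 - rho ^+ 2) / ((N ^+ 2 + rho ^+ 2) * (N ^+ 2 + G z0 ^+ 2)))%R.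
    rewrite /lowW /W; field.
    by rewrite !gt_eqF.
  rewrite /a2 ler_pdivlMr ?mulr_gt0//.
  rewrite (_ : N ^+ 4 = N ^+ 2 * N ^+ 2)%R; last by rewrite -exprD.
  by apply: ratio_gap => //; exact: sqr_ge0.
have X2 : (lowW * pr n <= a2 / 4)%R.
  apply: (@le_trans _ _ (N ^+ 2 * (a2 / (4 * N ^+ 2)))%R); last first.
    by rewrite le_eqVlt; apply/orP; left; apply/eqP; field; rewrite gt_eqF.
  apply: ler_pM => //.
    by rewrite divr_ge0 ?exprn_ge0 ?(ltW N0)// ltW.
  rewrite /lowW ler_pdivrMr// (_ : N ^+ 4 = N ^+ 2 * N ^+ 2)%R; last by rewrite -exprD.
  by rewrite ler_wpM2l ?(ltW N20)// lerDl sqr_ge0.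
have X3 : (B * \sum_(k < n) q N k <= a2 / 2)%R.
  apply: (le_trans (ler_wpM2l B0 sq)).
  rewrite (_ : B * (e + e) = (a2 / 2) * (B / (B + 1)))%R; last by rewrite /e; field; rewrite gt_eqF.
  apply: ler_piMr; first by rewrite divr_ge0// ltW.
  by rewrite ler_pdivrMr// mul1r lerDl.
by move: H; rewrite mulrBr mulr1 => H; exact: (gap_contradiction H X1 X2 X3 a20).
Qed.

End passage.

(** * One-step inequalities *)

Section ln_bounds.
Context {R : realType}.
Implicit Types s t x : R.

(** By the mean value theorem between 1 and x. The product with x - 1 expresses the sign condition
    on the derivative for both positions of x. *)
Lemma ln_mvt (g dg : R -> R) x : 0 < x -> g 1 = 0 ->
  (forall y : R, 0 < y -> is_derive y 1 g (dg y)) ->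
  (forall y : R, 0 < y -> Num.min x 1 <= y <= Num.max x 1 -> 0 <= dg y * (x - 1)) ->
  0 <= g x.
Proof.
move=> x0 g1 dgP dg0.
have cont (a b : R) : 0 < a -> {within `[a, b], continuous g}.
  move=> a0; apply: derivable_within_continuous => y; rewrite in_itv/= => /andP[ay _].
  by have [] := dgP y (lt_le_trans a0 ay).
have [x1|x1] := leP x 1.
  have [|y|c] := @MVT_segment R g dg x 1 x1.
  - by move=> y; rewrite in_itv/= => /andP[xy _]; apply: dgP; exact: lt_trans xy.
  - exact: cont.
  rewrite in_itv/= => /andP[xc c1]; rewrite g1 sub0r => gE.
  have := dg0 c (lt_le_trans x0 xc); rewrite min_l// max_r// xc c1 => /(_ isT).
  by move: gE; nra.
have [|y|c] := @MVT_segment R g dg 1 x (ltW x1).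
- by move=> y; rewrite in_itv/= => /andP[xy _]; apply: dgP; exact: lt_trans xy.
- exact: cont.
rewrite in_itv/= => /andP[xc c1]; rewrite g1 subr0 => ->.
apply: dg0; first exact: lt_le_trans xc.
by rewrite min_r ?(ltW x1)// max_l ?(ltW x1)// xc c1.
Qed.

Lemma ln_between x y : Num.min x 1 <= y <= Num.max x 1 -> 0 <= (y - 1) * (x - 1).
Proof.
have [x1|x1] := leP x 1.
  by move=> /andP[? ?]; nra.
by move=> /andP[? ?]; nra.
Qed.

Lemma ln1D_le t : -1 < t -> ln (1 + t) <= t - t ^+ 2 / 2 + t ^+ 3 / 3.
Proof.
move=> t1; rewrite -subr_ge0.
pose g y : R := (y - 1) - (y - 1) ^+ 2 / 2 + (y - 1) ^+ 3 / 3 - ln y.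
rewrite (_ : _ - _ = g (1 + t)); last by rewrite /g [1 + t]addrC addrK.
apply: (@ln_mvt g (fun y => 1 - (y - 1) + (y - 1) ^+ 2 - y^-1)).
- by rewrite -ltrBlDl sub0r.
- by rewrite /g subrr ln1; ring.
- move=> y y0; rewrite /g.
  have ? := is_derive1_ln y0.
  apply: is_derive_eq.
  by rewrite /GRing.scale/=; lra.
move=> y y0 yx; have := ln_between yx.
have -> : 1 - (y - 1) + (y - 1) ^+ 2 - y^-1 = (y - 1) ^+ 3 / y by field; rewrite gt_eqF.
move=> h; rewrite mulrAC divr_ge0 ?(ltW y0)//.
by rewrite exprS mulrAC mulr_ge0// sqr_ge0.
Qed.

Lemma ln1D_ge t : 0 <= t -> t - t ^+ 2 / 2 <= ln (1 + t).
Proof.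
move=> t0; rewrite -subr_ge0.
pose g y : R := ln y - ((y - 1) - (y - 1) ^+ 2 / 2).
rewrite (_ : _ - _ = g (1 + t)); last by rewrite /g [1 + t]addrC addrK.
apply: (@ln_mvt g (fun y => y^-1 - (1 - (y - 1)))).
- by rewrite ltr_pwDl.
- by rewrite /g subrr ln1; ring.
- move=> y y0; rewrite /g.
  have ? := is_derive1_ln y0.
  apply: is_derive_eq.
  by rewrite /GRing.scale/=; lra.
move=> y y0 _.
have -> : y^-1 - (1 - (y - 1)) = (y - 1) ^+ 2 / y by field; rewrite gt_eqF.
by rewrite mulr_ge0 ?divr_ge0 ?sqr_ge0 ?(ltW y0)// [1 + t]addrC addrK.
Qed.

(** The coefficient 1 of the cubic term, instead of the Taylor value 1 / 3, gives the difference a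
    derivative with the sign of 1 - 3 y, which is negative for all y >= 1 / 2. *)
Lemma ln1D_ge_neg t : - 2^-1 <= t -> t <= 0 -> t - t ^+ 2 / 2 + t ^+ 3 <= ln (1 + t).
Proof.
move=> t2 t0; rewrite -subr_ge0.
pose g y : R := ln y - ((y - 1) - (y - 1) ^+ 2 / 2 + (y - 1) ^+ 3).
rewrite (_ : _ - _ = g (1 + t)); last by rewrite /g [1 + t]addrC addrK.
apply: (@ln_mvt g (fun y => y^-1 - (1 - (y - 1) + 3 * (y - 1) ^+ 2))).
- by lra.
- by rewrite /g subrr ln1; ring.
- move=> y y0; rewrite /g.
  have ? := is_derive1_ln y0.
  apply: is_derive_eq.
  by rewrite /GRing.scale/=; lra.
move=> y y0; rewrite min_l; last by lra.
rewrite max_r; last by lra.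
move=> /andP[ty y1].
have -> : y^-1 - (1 - (y - 1) + 3 * (y - 1) ^+ 2) = (y - 1) ^+ 2 * (1 - 3 * y) / y.
  by field; rewrite gt_eqF.
rewrite [1 + t]addrC addrK mulrAC divr_ge0 ?(ltW y0)//.
rewrite -mulrA mulr_ge0 ?sqr_ge0//; nra.
Qed.

(** The cubic remainder could not be integrated with fewer than three moments. For small t it is
    absorbed into eta t^2; for large t the quadratic gain is given up against t^2 itself. *)
Lemma ln1D_bound t (eta : R) : -1 < t -> 0 < eta <= 1 ->
  ln (1 + t) <= t - t ^+ 2 / 2 + eta * t ^+ 2 + t ^+ 2 * (eta < `|t|)%R%:R.
Proof.
move=> t1 /andP[eta0 eta1]; have t20 := sqr_ge0 t.
have [etat|teta] := ltP eta `|t|.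
  rewrite mulr1; have [t0|t0] := leP 0 t.
    apply: (le_trans (le_ln1Dx t1)).
    by have := mulr_ge0 (ltW eta0) t20; lra.
  apply: (le_trans (ln1D_le t1)).
  have : t ^+ 3 <= 0 by rewrite exprS; nra.
  by have := mulr_ge0 (ltW eta0) t20; lra.
rewrite mulr0 addr0; apply: (le_trans (ln1D_le t1)).
rewrite lerD2l exprS mulrAC ler_wpM2r//.
by move: teta; rewrite ler_norml => /andP[? ?]; lra.
Qed.

(** From exp(-s) >= 1 - s follows exp(s) <= 1 / (1 - s), and (1 - s)(1 + s + 2 s^2) = 1 + s^2 (1 - 2
    s) >= 1. *)
Lemma expR_quad s : s <= 2^-1 -> expR s <= 1 + s + 2 * s ^+ 2.
Proof.
move=> s2.
have h1 := expR_ge1Dx (- s); have h2 := expR_gt0 s.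
have : expR s * expR (- s) = 1 by rewrite expRxMexpNx_1.
by nra.
Qed.

Lemma ln1D_norm t : - 2^-1 <= t -> ln (1 + t) ^+ 2 <= 4 * t ^+ 2.
Proof.
move=> t2; have t1 : 0 < 1 + t by lra.
have up : ln (1 + t) <= t by apply: le_ln1Dx; lra.
have low : t / (1 + t) <= ln (1 + t).
  rewrite -lerN2 -lnV ?posrE//.
  rewrite [X in ln X](_ : _ = 1 + (- (t / (1 + t)))); last by field; rewrite gt_eqF.
  apply: le_ln1Dx; rewrite ltrN2 ltr_pdivrMr//; lra.
have [t0|t0] := leP 0 t.
  have l0 : 0 <= ln (1 + t) by apply: ln_ge0; lra.
  by nra.
have l2 : 2 * t <= ln (1 + t).
  by apply: le_trans low; rewrite ler_pdivlMr//; nra.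
by nra.
Qed.

(** The power is exp(-g L) with L = ln(1 + t). For t >= - 1 / 2 one has - L <= 1, so g <= 1 / 2
    brings the exponent into the range of [expR_quad]; the constant 8 is its 2 times the 4 of
    [ln1D_norm]. *)
Lemma powRN_bound t (g eta : R) : -1 < t -> 0 < eta <= 1 -> 0 < g <= 2^-1 -> - 2^-1 <= t ->
  (1 + t) `^ (- g) <= 1 - g * (t - t ^+ 2 / 2 - eta * t ^+ 2 - t ^+ 2 * (eta < `|t|)%R%:R)
    + 8 * g ^+ 2 * t ^+ 2.
Proof.
move=> t1 /andP[eta0 eta1] /andP[g0 g2] t2.
have t10 : 0 < 1 + t by lra.
have t20 := sqr_ge0 t.
rewrite /powR gt_eqF//.
set L := ln (1 + t).
have lowL : t - t ^+ 2 / 2 - eta * t ^+ 2 - t ^+ 2 * (eta < `|t|)%R%:R <= L.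
  have et0 : 0 <= eta * t ^+ 2 by rewrite mulr_ge0// ltW.
  have i0 : 0 <= t ^+ 2 * (eta < `|t|)%R%:R by rewrite mulr_ge0// ler0n.
  have [t0|t0] := leP 0 t; first by apply: le_trans (ln1D_ge t0); lra.
  apply: le_trans (ln1D_ge_neg t2 (ltW t0)).
  have [etat|teta] := ltP eta `|t|.
    by rewrite mulr1; rewrite [t ^+ 3]exprS; nra.
  rewrite mulr0 subr0 [t ^+ 3]exprS.
  by move: teta; rewrite ltr0_norm// => ?; nra.
have normL := ln1D_norm t2.
have upL : - L <= 1.
  have : t / (1 + t) <= L.
    rewrite -lerN2 -lnV ?posrE//.
    rewrite [X in ln X](_ : _ = 1 + (- (t / (1 + t)))); last by field; rewrite gt_eqF.
    apply: le_ln1Dx; rewrite ltrN2 ltr_pdivrMr//; lra.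
  have : -1 <= t / (1 + t) by rewrite ler_pdivlMr//; lra.
  by lra.
have sL : - g * L <= 2^-1 by nra.
apply: (le_trans (expR_quad sL)).
have g20 := sqr_ge0 g.
have : 2 * (- g * L) ^+ 2 <= 8 * g ^+ 2 * t ^+ 2.
  rewrite exprMn sqrrN (_ : 8 * g ^+ 2 * t ^+ 2 = 2 * (g ^+ 2 * (4 * t ^+ 2))); last by ring.
  by rewrite ler_wpM2l// ler_wpM2l.
by have := ler_wpM2l (ltW g0) lowL; lra.
Qed.

End ln_bounds.

(* For a one-step increment [D] of a process at height [a], the drift of a
   Lyapunov function [f] is controlled by the first two moments of [D] and by
   its truncated second moments [tail]. *)
Section one_step.
Context d (T : measurableType d) {R : realType}.
Variable mu : {measure set T -> \bar R}.
Hypothesis mu1 : mu setT = 1%E.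
Variable D : T -> R.
Hypothesis mD : measurable_fun setT D.
Hypothesis iD2 : mu.-integrable setT (EFin \o (fun w => D w ^+ 2)).

Definition tail (K : R) := \int[mu]_w (D w ^+ 2 * (K < `|D w|)%R%:R).

Let m1 := \int[mu]_w D w.
Let m2 := \int[mu]_w (D w ^+ 2).

Let iD : mu.-integrable setT (EFin \o D).
Proof.
have i1 : mu.-integrable setT (EFin \o cst (1 : R)) by apply: bint => //; exact: bmeas_cst.
apply: le_integrable (integrableD measurableT i1 iD2) => //.
  exact/measurable_EFinP.
move=> w _ /=; rewrite lee_fin [leRHS]ger0_norm ?addr_ge0 ?sqr_ge0//.
rewrite -[D w ^+ 2](real_normK (num_real _)).
by have := sqr_ge0 (`|D w| - 1); have := normr_ge0 (D w); move: `|D w| => x; nra.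
Qed.

Lemma measurable_norm_gt (K : R) : measurable_fun setT (fun w => (K < `|D w|)%R%:R : R).
Proof.
rewrite (_ : (fun _ => _) = \1_[set w | K < `|D w|]); last first.
  by apply/funext => w; rewrite indicE; congr (nat_of_bool _)%:R; apply/idP/idP; rewrite inE.
apply: measurable_indic.
rewrite (_ : mkset _ = (fun w => `|D w|) @^-1` `]K, +oo[%classic); last first.
  by apply/seteqP; split => y /=; rewrite in_itv/= andbT.
by rewrite -[X in measurable X]setTI; exact: (measurableT_comp (@normr_measurable R setT)).
Qed.

Lemma tail_integrable K : mu.-integrable setT (EFin \o (fun w => D w ^+ 2 * (K < `|D w|)%R%:R)).
Proof.
apply: le_integrable iD2 => //.
  by apply/measurable_EFinP; apply: measurable_funM; [exact: measurable_funX|exact: measurable_norm_gt].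
move=> w _ /=; rewrite lee_fin normrM ler_piMr//.
by rewrite ger0_norm ?ler0n// lern1 leq_b1.
Qed.

Let itail K : mu.-integrable setT (EFin \o (fun w => D w ^+ 2 * (K < `|D w|)%R%:R)).
Proof. exact: tail_integrable. Qed.

Lemma tail_ge0 K : 0 <= tail K.
Proof. by apply: Rintegral_ge0 => w _; rewrite mulr_ge0 ?sqr_ge0 ?ler0n. Qed.

Lemma tail_le K K' : K <= K' -> tail K' <= tail K.
Proof.
move=> KK'; apply: le_Rintegral => //; try exact: tail_integrable; move=> w _; rewrite ler_wpM2l ?sqr_ge0// ler_nat.
by case: (ltP K' `|D w|) => //; move/(le_lt_trans KK') => ->.
Qed.

(** The integrable majorant turns pointwise expansions into bounds by moments. Two truncation levels
    are provided because negative powers need both eta a and a / 2. *)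
Lemma quadratic_integral (c0 c1 c2 c3 c4 K3 K4 : R) (f : T -> R) :
  measurable_fun setT f -> (forall w, 0 <= f w) ->
  (forall w, f w <= c0 + c1 * D w + c2 * D w ^+ 2 +
     c3 * (D w ^+ 2 * (K3 < `|D w|)%R%:R) + c4 * (D w ^+ 2 * (K4 < `|D w|)%R%:R)) ->
  (\int[mu]_w (f w)%:E <=
    (c0 + c1 * m1 + c2 * m2 + c3 * tail K3 + c4 * tail K4)%:E)%E.
Proof.
move=> mf f0 fle.
have i0 : mu.-integrable setT (EFin \o cst c0) by apply: bint => //; exact: bmeas_cst.
have iZ c (g : T -> R) : mu.-integrable setT (EFin \o g) ->
    mu.-integrable setT (EFin \o (fun w => c * g w)).
  by move=> ig; exact: (integrableZl measurableT c ig).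
have iA (g h : T -> R) : mu.-integrable setT (EFin \o g) ->
    mu.-integrable setT (EFin \o h) -> mu.-integrable setT (EFin \o (fun w => g w + h w)).
  by move=> ig ih; exact: (integrableD measurableT ig ih).
have i1 := iA _ _ i0 (iZ c1 _ iD).
have i2 := iA _ _ i1 (iZ c2 _ iD2).
have i3 := iA _ _ i2 (iZ c3 _ (tail_integrable K3)).
have i4 := iA _ _ i3 (iZ c4 _ (tail_integrable K4)).
rewrite -[X in (_ <= (X + _ + _ + _ + _)%:E)%E](bint_cst mu1) /m1 /m2 /tail.
rewrite -!RintegralZl// -!RintegralD//; try exact: iZ.
rewrite EFin_Rintegral//; apply: ge0_le_integral => //.
- by move=> w _; rewrite lee_fin.
- exact/measurable_EFinP.
- by have /integrableP[] := i4.
- by move=> w _; rewrite lee_fin; exact: fle.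
Qed.

Variable a : R.
Hypothesis a1 : 1 <= a.
Hypothesis aD1 : forall w, 1 <= a + D w.

Let a0 : 0 < a. Proof. exact: lt_le_trans a1. Qed.

Let ratio w : a + D w = a * (1 + D w / a).
Proof. by field; rewrite gt_eqF. Qed.

Let ratio_gt w : -1 < D w / a.
Proof. by rewrite ltr_pdivlMr// mulN1r -subr_gt0 opprK addrC (lt_le_trans ltr01). Qed.

Let ratio_ind (eta : R) w : (eta < `|D w / a|) = (eta * a < `|D w|).
Proof. by rewrite normrM normfV (gtr0_norm a0) ltr_pdivlMr. Qed.

Lemma ln_step (eta : R) : 0 < eta <= 1 ->
  a * m1 - m2 / 2 + eta * m2 + tail (eta * a) <= 0 ->
  (\int[mu]_w (ln (a + D w))%:E <= (ln a)%:E)%E.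
Proof.
move=> eta01 H.
have a20 : 0 < a ^+ 2 by rewrite exprn_gt0.
apply: le_trans (@quadratic_integral (ln a) a^-1 ((- 2^-1 + eta) / a ^+ 2) (a ^- 2) 0
  (eta * a) 0 (fun w => ln (a + D w)) _ _ _) _.
- apply: (measurableT_comp (@measurable_ln R)).
  by apply: measurable_funD => //; exact: measurable_cst.
- by move=> w; exact: ln_ge0.
- move=> w; rewrite mul0r addr0 ratio lnM ?posrE//; last by rewrite -ltrBlDl sub0r.
  rewrite -!addrA lerD2l; apply: (le_trans (ln1D_bound (ratio_gt w) eta01)).
  rewrite ratio_ind le_eqVlt; apply/orP; left; apply/eqP.
  by field; rewrite gt_eqF.
rewrite lee_fin mul0r addr0 -!addrA gerDl.
rewrite (_ : _ + _ = (a * m1 - m2 / 2 + eta * m2 + tail (eta * a)) / a ^+ 2).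
  by rewrite ler_pdivrMr// mul0r.
by field; rewrite gt_eqF.
Qed.

Lemma powRN_step (g eta : R) : 0 < eta <= 1 -> 0 < g <= 2^-1 ->
  8 * g ^+ 2 * m2 + 4 * a `^ g * tail (a / 2) <=
    g * (a * m1 - m2 / 2 - eta * m2 - tail (eta * a)) ->
  (\int[mu]_w ((a + D w) `^ (- g))%:E <= (a `^ (- g))%:E)%E.
Proof.
move=> eta01 g01 H; have /andP[g0 g2] := g01.
have a20 : 0 < a ^+ 2 by rewrite exprn_gt0.
pose A := a `^ (- g).
have A0 : 0 < A by exact: powR_gt0.
apply: le_trans (@quadratic_integral A (- g * A / a)
  (A * (g / 2 + g * eta + 8 * g ^+ 2) / a ^+ 2) (A * g / a ^+ 2) (4 / a ^+ 2)
  (eta * a) (a / 2) (fun w => (a + D w) `^ (- g)) _ _ _) _.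
- apply: (measurableT_comp (measurable_powR _)).
  by apply: measurable_funD => //; exact: measurable_cst.
- by move=> w; exact: powR_ge0.
- move=> w.
  have tE : D w ^+ 2 = a ^+ 2 * (D w / a) ^+ 2 by field; rewrite gt_eqF.
  have [t2|t2] := leP (- 2^-1) (D w / a).
    rewrite ratio powRM ?(ltW a0)//; last by have := ratio_gt w; lra.
    have := powRN_bound (ratio_gt w) eta01 g01 t2; rewrite ratio_ind => /(ler_wpM2l (ltW A0)).
    move/le_trans; apply.
    rewrite -[leLHS]addr0; apply: lerD; last first.
      by rewrite mulr_ge0 ?divr_ge0 ?(ltW a20)// mulr_ge0 ?sqr_ge0 ?ler0n.
    rewrite le_eqVlt; apply/orP; left; apply/eqP.
    by field; rewrite gt_eqF.
  apply: (@le_trans _ _ 1).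
    by rewrite -(powRr0 (a + D w)) ler_powR// oppr_le0 ltW.
  have ind1 : (a / 2 < `|D w|) = true.
    have := t2; rewrite ltr_pdivrMr// => h; rewrite ltr0_norm; last by have := a0; lra.
    by lra.
  rewrite ind1 mulr1.
  have big : 1 <= 4 / a ^+ 2 * D w ^+ 2.
    rewrite tE mulrA divfK ?gt_eqF//.
    by nra.
  have i0 : 0 <= (eta * a < `|D w|)%R%:R :> R by rewrite ler0n.
  have t0 : D w / a < 0 by lra.
  have sq : 0 <= D w ^+ 2 by exact: sqr_ge0.
  have p1 : 0 <= A * g / a ^+ 2 * (D w ^+ 2 * (eta * a < `|D w|)%R%:R).
    apply: mulr_ge0; last exact: mulr_ge0.
    by apply: divr_ge0; [rewrite mulr_ge0 ?(ltW A0) ?(ltW g0)|exact: ltW].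
  have /andP[eta0 _] := eta01.
  have p2 : 0 <= A * (g / 2 + g * eta + 8 * g ^+ 2) / a ^+ 2 * D w ^+ 2.
    apply: mulr_ge0 => //; apply: divr_ge0; last exact: ltW.
    apply: mulr_ge0; first exact: ltW.
    by have := sqr_ge0 g; have := mulr_ge0 (ltW g0) (ltW eta0); lra.
  have p3 : 0 <= - g * A / a * D w.
    rewrite (_ : - g * A / a * D w = g * A * - (D w / a)); last by ring.
    by apply: mulr_ge0; [rewrite mulr_ge0 ?(ltW g0) ?(ltW A0)|rewrite oppr_ge0 ltW].
  by have := ltW A0; lra.
rewrite lee_fin -!addrA gerDl.
have AE : A * a `^ g = 1 by rewrite -powRD ?(gt_eqF a0) ?implybT// addNr powRr0.
rewrite (_ : _ + _ = - A * (g * (a * m1 - m2 / 2 - eta * m2 - tail (eta * a)) -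
   (8 * g ^+ 2 * m2 + 4 * a `^ g * tail (a / 2))) / a ^+ 2); last first.
  transitivity (- g * A / a * m1 + A * (g / 2 + g * eta + 8 * g ^+ 2) / a ^+ 2 * m2 +
     A * g / a ^+ 2 * tail (eta * a) + (A * a `^ g) * 4 / a ^+ 2 * tail (a / 2)).
    by rewrite AE mul1r !addrA.
  by field; rewrite gt_eqF.
by rewrite ler_pdivrMr// mul0r mulNr oppr_le0 mulr_ge0 ?(ltW A0)// subr_ge0.
Qed.

Lemma sqr_step (e : R) : 2 * a * m1 + m2 <= - e ->
  (\int[mu]_w ((a + D w) ^+ 2)%:E + e%:E <= (a ^+ 2)%:E)%E.
Proof.
move=> H.
apply: (@le_trans _ _ ((a ^+ 2 + 2 * a * m1 + 1 * m2 + 0 * tail 0 + 0 * tail 0)%:E + e%:E)%E); last first.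
  by rewrite -EFinD lee_fin; lra.
apply: leeD => //; apply: quadratic_integral.
- by apply: measurable_funX; apply: measurable_funD => //; exact: measurable_cst.
- by move=> w; exact: sqr_ge0.
- by move=> w; rewrite !mul0r !addr0 le_eqVlt; apply/orP; left; apply/eqP; ring.
Qed.

(** Exactly, W(a + D) = W(a) - r (2 a D + D^2) + r D^2 (2 a + D)^2 / (N^2 + (a + D)^2) with r = N^4
    / (N^2 + a^2)^2. The last term is at most 4 D^2, which is the error allowed for a > eta N. For a
    <= eta N it is at most 10 eta^2 D^2 plus twice the truncated D^2, because 2 (a^2 + (a + D)^2) <=
    10 eta^2 N^2 when |D| <= eta N; the drift outweighs it, since then r >= 1 / 4. *)
Lemma capped_step (N eta B : R) : 1 <= N -> 0 < eta <= 1 ->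
  0 <= 2 * a * m1 + m2 -> 4 * m2 <= B ->
  10 * eta ^+ 2 * m2 + 2 * tail a <= (2 * a * m1 + m2) / 4 ->
  (\int[mu]_w (N ^+ 4 / (N ^+ 2 + (a + D w) ^+ 2))%:E <=
    (N ^+ 4 / (N ^+ 2 + a ^+ 2) + B * (eta * N < a)%R%:R)%:E)%E.
Proof.
move=> N1 /andP[eta0 eta1] drift m2B near.
have N0 : 0 < N by exact: lt_le_trans N1.
have N20 : 0 < N ^+ 2 by rewrite exprn_gt0.
have a20 : 0 < a ^+ 2 by rewrite exprn_gt0.
pose A := N ^+ 2 + a ^+ 2; have A0 : 0 < A by rewrite addr_gt0.
pose W x := N ^+ 4 / (N ^+ 2 + x ^+ 2).
have W0 x : 0 <= W x by rewrite divr_ge0 ?exprn_ge0 ?(ltW N0)// addr_ge0 ?sqr_ge0.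
have mW : measurable_fun setT (fun w => W (a + D w)).
  apply: measurable_funM; first exact: measurable_cst.
  apply: measurable_fun_inv_ge0 => [|w]; last by rewrite addr_ge0 ?sqr_ge0.
  apply: measurable_funD; first exact: measurable_cst.
  by apply: measurable_funX; apply: measurable_funD => //; exact: measurable_cst.
pose r := N ^+ 4 / A ^+ 2.
have r0 : 0 <= r by rewrite divr_ge0 ?exprn_ge0 ?(ltW N0) ?(ltW A0).
have r1 : r <= 1.
  rewrite ler_pdivrMr ?exprn_gt0// mul1r (_ : N ^+ 4 = (N ^+ 2) ^+ 2); last by rewrite -exprM.
  by rewrite lerXn2r ?nnegrE ?(ltW N20) ?(ltW A0)// lerDl ltW.
have WE w : W (a + D w) = W a - r * (2 * a * D w + D w ^+ 2) +
    r * (D w ^+ 2 * (2 * a + D w) ^+ 2 / (N ^+ 2 + (a + D w) ^+ 2)).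
  rewrite /W /r -/A; have : 0 < N ^+ 2 + (a + D w) ^+ 2 by rewrite ltr_pwDl// sqr_ge0.
  move=> h; rewrite /A; field; rewrite !gt_eqF//.
have quot w : (2 * a + D w) ^+ 2 <= 2 * (a ^+ 2 + (a + D w) ^+ 2).
  by have := sqr_ge0 (D w); nra.
have den w : 0 < N ^+ 2 + (a + D w) ^+ 2 by rewrite ltr_pwDl// sqr_ge0.
have [far|near_] := ltP (eta * N) a; rewrite ?mulr1 ?mulr0 ?addr0.
  apply: le_trans (@quadratic_integral (W a) (- r * (2 * a)) (- r + 4) 0 0 0 0 (fun w => W (a + D w)) mW _ _) _ => //.
    move=> w; rewrite !mul0r !addr0 WE.
    have : r * (D w ^+ 2 * (2 * a + D w) ^+ 2 / (N ^+ 2 + (a + D w) ^+ 2)) <= 4 * D w ^+ 2.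
      rewrite -[D w ^+ 2 * _ / _]mulrA mulrCA mulrC ler_wpM2r ?sqr_ge0// mulrA ler_pdivrMr//.
      apply: (le_trans (ler_wpM2l r0 (quot w))).
      have ra : r * a ^+ 2 <= N ^+ 2.
        rewrite /r mulrAC ler_pdivrMr ?exprn_gt0// (_ : N ^+ 4 = N ^+ 2 * N ^+ 2); last by rewrite -exprD.
        by rewrite /A; have := ltW N20; have := ltW a20; nra.
      by have := sqr_ge0 (a + D w); nra.
    lra.
  by rewrite lee_fin !mul0r !addr0 -/(W a); have := mulr_ge0 r0 drift; lra.
have aN : a <= N by nra.
have r4 : 4^-1 <= r.
  rewrite ler_pdivlMr ?exprn_gt0// (_ : N ^+ 4 = (N ^+ 2) ^+ 2); last by rewrite -exprM.
  have aN2 : a ^+ 2 <= N ^+ 2 by rewrite lerXn2r ?nnegrE ?(ltW a0) ?(ltW N0).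
  have h1 : A <= 2 * N ^+ 2 by rewrite /A; lra.
  have : A ^+ 2 <= (2 * N ^+ 2) ^+ 2.
    by rewrite lerXn2r ?nnegrE ?(ltW A0)// mulr_ge0 ?(ltW N20).
  by lra.
apply: le_trans (@quadratic_integral (W a) (- r * (2 * a)) (- r + 10 * eta ^+ 2) 2 0 (eta * N) 0
  (fun w => W (a + D w)) mW _ _) _ => //.
  move=> w; rewrite mul0r addr0 WE.
  set Q := D w ^+ 2 * (2 * a + D w) ^+ 2 / _.
  have D0 := sqr_ge0 (D w).
  have Q0 : 0 <= Q by apply: divr_ge0; [apply: mulr_ge0 => //; exact: sqr_ge0|exact: ltW].
  have rQ : r * Q <= Q by rewrite ler_piMl.
  suff : Q <= 10 * eta ^+ 2 * D w ^+ 2 + 2 * (D w ^+ 2 * (eta * N < `|D w|)%R%:R) by lra.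
  have quad : (a + D w) ^+ 2 + a ^+ 2 <= (N ^+ 2 + (a + D w) ^+ 2).
    by rewrite addrC lerD2r lerXn2r ?nnegrE ?(ltW a0) ?(ltW N0).
  rewrite /Q ler_pdivrMr//.
  have [large|small] := ltP (eta * N) `|D w|.
    rewrite mulr1; apply: (le_trans (ler_wpM2l D0 (quot w))).
    have e20 : 0 <= 10 * eta ^+ 2 * D w ^+ 2.
      by apply: mulr_ge0 => //; apply: mulr_ge0 => //; exact: sqr_ge0.
    apply: (@le_trans _ _ (2 * D w ^+ 2 * (N ^+ 2 + (a + D w) ^+ 2))).
      by rewrite mulrCA mulrA; apply: ler_wpM2l; [exact: mulr_ge0|rewrite addrC].
    by rewrite ler_wpM2r ?(ltW (den w))// lerDr.
  rewrite mulr0 mulr0 addr0.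
  rewrite [leRHS](_ : _ = D w ^+ 2 * (10 * eta ^+ 2 * (N ^+ 2 + (a + D w) ^+ 2))); last by ring.
  apply: ler_wpM2l => //.
  apply: (le_trans (quot w)).
  have Dsmall : D w <= eta * N by apply: le_trans small; exact: ler_norm.
  have eN0 : 0 <= eta * N by rewrite mulr_ge0// ltW.
  have h1 : a ^+ 2 <= (eta * N) ^+ 2 by rewrite lerXn2r ?nnegrE ?(ltW a0).
  have h2 : (a + D w) ^+ 2 <= (2 * (eta * N)) ^+ 2.
    rewrite lerXn2r ?nnegrE//; [|exact: mulr_ge0|lra].
    by apply: le_trans (aD1 w).
  rewrite exprMn in h1; rewrite !exprMn in h2.
  have : 0 <= eta ^+ 2 * (a + D w) ^+ 2 by apply: mulr_ge0; exact: sqr_ge0.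
  by lra.
rewrite lee_fin mul0r addr0 -!addrA gerDl.
have tl : tail (eta * N) <= tail a by exact: tail_le.
have := ler_wpM2r drift r4.
lra.
Qed.

End one_step.

(** * From conditional moments to the kernel; calculus of uniform asymptotics *)

Section kernel_moments.
Context {R : realType} {S : pointedMetricType R}.

(** At time 0 the state is deterministic, so averaging the conditional expectation over the whole
    space gives the moment of [Ks z]. As the process can be started anywhere, the almost sure bound
    becomes one at every state. *)
Lemma moment_kernel (Ks : R.-pker (state R S) ~> (state R S)) d (Omega : measurableType d)
    (P : probability Omega R) (F : nat -> set (set Omega)) (z : state R S)
    (xi : nat -> Omega -> state R S) (p xB Bp : R) :
  half_strip_process P F Ks z xi ->
  cond_exp_le_on P (F 0%N)
    (fun w => (`|(xi 1%N w).1 - (xi 0%N w).1| `^ p)%:E)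
    [set w | xB <= (xi 0%N w).1] Bp ->
  xB <= z.1 ->
  (\int[Ks z]_w (`|w.1 - z.1| `^ p)%:E <= Bp%:E)%E.
Proof.
move=> process [Z [Z0 mZ ZE] Zle] xBz.
pose f (w : state R S) : \bar R := (`|w.1 - z.1| `^ p)%:E.
have mf : measurable_fun setT f.
  apply/measurable_EFinP; apply: (measurableT_comp (measurable_powR _)).
  apply: measurableT_comp => //; apply: measurable_funB; last exact: measurable_cst.
  exact: measurable_fst.
have f0 w : (0 <= f w)%E by rewrite lee_fin powR_ge0.
have := markov_step process (F_T process 0) f0 mf.
under [in RHS]eq_integral do rewrite (xi0 process).
rewrite integral_cst// prob_setT mule1 => E.
apply: (@le_trans _ _ (\int[P]_w f (xi 1%N w))%E); first by rewrite E.
have -> : (\int[P]_w f (xi 1%N w) = \int[P]_w Z w)%E.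
  rewrite (ZE setT (F_T process 0)); apply: eq_integral => w _.
  by rewrite (xi0 process).
apply: (@le_trans _ _ (\int[P]_w Bp%:E)%E); last by rewrite integral_cst// prob_setT mule1.
have Bp0 : (0 <= Bp%:E)%E.
  have [N [mN N0 subN]] := Zle.
  have [w Nw] : exists w, ~ N w.
    apply: contrapT => allN; have : (P setT <= P N)%E.
      apply: le_measure; rewrite ?inE// => w _; apply: contrapT => nN; apply: allN; by exists w.
    by rewrite N0 probability_setT lee_fin ler10.
  apply: (le_trans (Z0 w)); apply: contrapT => nle; apply: Nw; apply: subN => /= H.
  by apply: nle; apply: H; rewrite (xi0 process).
apply: ae_ge0_le_integral => //.
- move=> _ B mB; rewrite setTI; apply: (F_measurable process (n := 0%N)); exact: mZ.
- by case: Zle => N [mN N0 subN]; exists N; split => // w /= nw; apply: subN => /= H; apply: nw => _;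
    apply: H; rewrite (xi0 process).
Qed.

End kernel_moments.

Section asymptotics.
Context {R : realType} {I : Type}.
Implicit Types f g : R -> I -> R.

Definition unif0 f := forall e : R, 0 < e -> \forall x \near +oo, forall u, `|f x u| <= e.

Definition unifO f := exists C : R, \forall x \near +oo, forall u, `|f x u| <= C.

Lemma unif0_le f g : unif0 g ->
  (\forall x \near +oo, forall u, `|f x u| <= `|g x u|) -> unif0 f.
Proof.
move=> g0 fg e e0; apply: filterS2 fg (g0 _ e0) => x fgx gx u.
exact: le_trans (fgx u) (gx u).
Qed.

Lemma unif0_eq f g : unif0 g -> (\forall x \near +oo, forall u, f x u = g x u) -> unif0 f.
Proof. by move=> g0 fg; apply: unif0_le g0 _; apply: filterS fg => x H u; rewrite H. Qed.

Lemma unif0D f g : unif0 f -> unif0 g -> unif0 (fun x u => f x u + g x u).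
Proof.
move=> f0 g0 e e0; have e20 : 0 < e / 2 by rewrite divr_gt0.
apply: filterS2 (f0 _ e20) (g0 _ e20) => x fx gx u.
by rewrite (le_trans (ler_normD _ _))// [leRHS]splitr lerD.
Qed.

Lemma unif0N f : unif0 f -> unif0 (fun x u => - f x u).
Proof. by move=> f0 e /f0; apply: filterS => x H u; rewrite normrN. Qed.

Lemma unif0B f g : unif0 f -> unif0 g -> unif0 (fun x u => f x u - g x u).
Proof. by move=> f0 g0; apply: unif0D => //; exact: unif0N. Qed.

Lemma unif0M f g : unif0 f -> unifO g -> unif0 (fun x u => f x u * g x u).
Proof.
move=> f0 [C gC] e e0; have C1 : 0 < `|C| + 1 by rewrite ltr_wpDl.
have eC : 0 < e / (`|C| + 1) by rewrite divr_gt0.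
apply: filterS2 (f0 _ eC) gC => x fx gx u.
rewrite normrM -[leRHS](@divfK _ (`|C| + 1)) ?gt_eqF//; apply: ler_pM => //.
by rewrite (le_trans (gx u))// (le_trans (ler_norm _))// lerDl.
Qed.

Lemma unifO_cst (g : I -> R) (C : R) : (forall u, `|g u| <= C) -> unifO (fun _ u => g u).
Proof. by move=> gC; exists C; apply: nearW => x u; exact: gC. Qed.

Lemma unifOD f g : unifO f -> unifO g -> unifO (fun x u => f x u + g x u).
Proof.
move=> [C fC] [D gD]; exists (C + D); apply: filterS2 fC gD => x fx gx u.
by rewrite (le_trans (ler_normD _ _))// lerD.
Qed.

Lemma unifOM f g : unifO f -> unifO g -> unifO (fun x u => f x u * g x u).
Proof.
move=> [C fC] [D gD]; exists (C * D); apply: filterS2 fC gD => x fx gx u.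
by rewrite normrM ler_pM.
Qed.

Lemma unif0_O f : unif0 f -> unifO f.
Proof. by move=> f0; exists 1; exact: f0. Qed.

Lemma unifO_le f g : unifO g ->
  (\forall x \near +oo, forall u, `|f x u| <= `|g x u|) -> unifO f.
Proof.
move=> [C gC] fg; exists C; apply: filterS2 fg gC => x H1 H2 u.
exact: le_trans (H1 u) (H2 u).
Qed.

Lemma near_pinfty_ge (M : R) : \forall x \near +oo, M <= x.
Proof. by apply: nbhs_pinfty_ge; exact: num_real. Qed.

Lemma unif0_inv : unif0 (fun x _ => x^-1).
Proof.
move=> e e0; apply: filterS (near_pinfty_ge (e^-1)) => x ex u.
have x0 : 0 < x by rewrite (lt_le_trans _ ex)// invr_gt0.
by rewrite gtr0_norm ?invr_gt0// -[leRHS]invrK lef_pV2// posrE invr_gt0.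
Qed.

End asymptotics.

Lemma powR_lt0_small {R : realType} (q e : R) : q < 0 -> 0 < e ->
  \forall K \near +oo, K `^ q <= e.
Proof.
move=> q0 e0; apply: filterS (near_pinfty_ge (Num.max 1 (e `^ q^-1))) => K.
rewrite ge_max => /andP[K1 Ke].
have -> : e = (e `^ q^-1) `^ q by rewrite -powRrM mulVf ?lt_eqF// powRr1// ltW.
rewrite -lef_pV2 ?posrE ?powR_gt0//; last by rewrite (lt_le_trans _ K1).
rewrite -!powRN; apply: ge0_ler_powR => //; rewrite ?nnegrE ?powR_ge0//.
  by rewrite oppr_ge0 ltW.
by rewrite (le_trans _ K1).
Qed.

(** * Asymptotics of the kernel *)

Section disintegration.
Context {R : realType} {S : pointedMetricType R}.
Variables (Ks : R.-pker (state R S) ~> (state R S)).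
Variable L : R.-pker (state R S * borel S) ~> R.
Hypothesis L_Ks : disintegrates Ks L.

Let measurable_pair_l (v : borel S) : measurable_fun [set: R] (fun y => (y, v) : state R S).
Proof. exact: measurable_fun_pair. Qed.

(** The law of (y, v) when y has law L(z, v) and v is fixed; mixing over the marginal in v rebuilds
    [Ks z]. *)
Definition joint_law (zv : state R S * borel S) : {measure set (state R S) -> \bar R} :=
  law_on (L zv) measurableT (measurable_pair_l zv.2).

Lemma measurable_joint_law U : measurable U -> measurable_fun setT (joint_law ^~ U).
Proof.
move=> mU.
pose f (w : (state R S * borel S) * R) : state R S := (w.2, w.1.2).
have mf : measurable_fun setT f.
  apply: measurable_fun_pair; first exact: measurable_snd.
  by apply: (measurableT_comp measurable_snd); exact: measurable_fst.
have mA : measurable (f @^-1` U) by rewrite -[X in measurable X]setTI; exact: mf.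
have := @measurable_fun_xsection_finite_kernel _ _ _ _ _ L (f @^-1` U).
rewrite inE => /(_ mA); congr measurable_fun; apply/funext => zv.
rewrite /joint_law /= /law_on setTI; congr (L zv _).
by apply/seteqP; split => y /=; rewrite /xsection/= inE.
Qed.

HB.instance Definition _ := isKernel.Build _ _ _ _ R joint_law measurable_joint_law.

(** The hypothesis speaks of rectangles only; these are stable under intersection and generate the
    product sigma-algebra. *)
Lemma disintegrationE z B : half_strip z -> measurable B ->
  Ks z B = (\int[marginal Ks z]_v joint_law (z, v) B)%E.
Proof.
move=> z0 mB.
pose m2 : {measure set (state R S) -> \bar R} := mkcomp (marginal Ks) joint_law z.
transitivity (m2 B); last by [].
pose C : set (set (state R S)) :=
  [set C | exists A, measurable A /\ exists B, measurable B /\ C = A `*` B].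
apply: (measure_unique C (fun=> setT)) => //.
- rewrite measurable_prod_measurableType //; congr (<<s _ >>).
  rewrite predeqE; split => [[A1 mA1 [A2 mA2 <-]]|[A1 [mA1 [A2 [mA2 ->]]]]].
    by exists A1; split => //; exists A2.
  by exists A1 => //; exists A2.
- move=> /= _ _ [X1 [mX1 [X2 [mX2 ->]]]] [Y1 [mY1 [Y2 [mY2 ->]]]].
  rewrite -setXI; exists (X1 `&` Y1); split; first exact: measurableI.
  by exists (X2 `&` Y2); split => //; exact: measurableI.
- by move=> _; exists setT; split => //; exists setT; split => //; rewrite setXTT.
- by rewrite bigcup_const.
- move=> A [A1 [mA1 [A2 [mA2 ->]]]]; rewrite (L_Ks z0 mA1 mA2).
  transitivity (\int[marginal Ks z]_v joint_law (z, v) (A1 `*` A2))%E; last by [].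
  rewrite [LHS]integral_mkcond; apply: eq_integral => v _.
  rewrite /joint_law /= /law_on setTI patchE.
  have [vA|vA] := boolP (v \in A2).
    congr (L (z, v) _); apply/seteqP; split => [y A1y|y [] //].
    by split => //=; rewrite -in_setE.
  rewrite (_ : _ @^-1` _ = set0) ?measure0//; apply/seteqP; split => // y [_ /= ?].
  by move: vA; rewrite notin_setE; apply.
- by move=> _; rewrite prob_kernel ltry.
Qed.

Lemma integral_disintegration z (g : state R S -> \bar R) : half_strip z ->
  (forall w, 0 <= g w)%E -> measurable_fun setT g ->
  (\int[Ks z]_w g w = \int[marginal Ks z]_v \int[L (z, v)]_y g (y, v))%E.
Proof.
move=> z0 g0 mg.
rewrite (@integral_mixture _ _ _ _ _ (marginal Ks z) setT (fun v => joint_law (z, v)) (Ks z) g)//.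
- by apply: eq_integral => v _; rewrite integral_law_on.
- move=> B mB; apply: (measurableT_comp (measurable_joint_law mB)).
  exact: measurable_fun_pair.
- by move=> B mB; rewrite disintegrationE.
Qed.

End disintegration.

Section marginal_integral.
Context {R : realType} {S : pointedMetricType R}.
Variables (Ks : R.-pker (state R S) ~> (state R S)).

Lemma Rintegral_marginal z (f : S -> R) : bmeas (f : borel S -> R) ->
  \int[Ks z]_w f w.2 = \int[marginal Ks z]_v f v.
Proof.
move=> bf; have [mf [C fC]] := bf.
have msnd : measurable_fun [set: state R S] (@snd R (borel S)) by exact: measurable_snd.
have b2 : bmeas (fun w : state R S => f w.2).
  by split; [exact: measurableT_comp|exists C => w].
have m1 : marginal Ks z setT = 1%E by exact: prob_kernel.
apply/esym.
have -> : \int[marginal Ks z]_v f v = \int[law_on (Ks z) measurableT msnd]_v f v.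
  by congr fine; apply: eq_measure_integral => A mA _; rewrite /= /law_on setTI.
have l1 : law_on (Ks z) measurableT msnd setT = 1%E.
  by rewrite /law_on setTI preimage_setT prob_kernel.
have k1 : Ks z setT = 1%E by exact: prob_kernel.
have bC := bmeas_cst C : bmeas (cst C : borel S -> R).
have bC' := bmeas_cst C : bmeas (cst C : state R S -> R).
apply: (@addIr _ C).
rewrite -{1}(bint_cst l1 C) -(bintD l1 bf bC) -[X in _ = _ + X](bint_cst k1) -(bintD k1 b2 bC').
rewrite /Rintegral integral_law_on//.
- by move=> v; rewrite lee_fin -lerBlDr sub0r; have := fC v; rewrite ler_norml => /andP[].
- by apply/measurable_EFinP; exact: measurable_funD.
Qed.

End marginal_integral.

(** * Integrability and increments of the Lyapunov function *)

Section quadratic_growth.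
Context d (T : measurableType d) {R : realType}.
Variable mu : {measure set T -> \bar R}.
Hypothesis mu1 : mu setT = 1%E.
Variable D : T -> R.
Hypothesis mD : measurable_fun setT D.
Hypothesis iD2 : mu.-integrable setT (EFin \o (fun w => D w ^+ 2)).
Implicit Types f g : T -> R.

(** A product of two functions of linear growth in [D] has quadratic growth and is therefore
    integrable by the second moment alone; the expressions in the increment expansions below are all
    of this kind. *)
Definition lin_growth f := measurable_fun setT f /\
  exists2 C, 0 <= C & forall w, `|f w| <= C * (1 + `|D w|).

Definition quad_growth f := measurable_fun setT f /\
  exists2 C, 0 <= C & forall w, `|f w| <= C * (1 + D w ^+ 2).

Lemma norm_le_1sqr (x : R) : `|x| <= 1 + x ^+ 2.
Proof.
by rewrite -[x ^+ 2]real_normK ?num_real//; have := sqr_ge0 (`|x| - 1); have := normr_ge0 x; nra.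
Qed.

Lemma lin_growthD f g : lin_growth f -> lin_growth g -> lin_growth (fun w => f w + g w).
Proof.
move=> [mf [C C0 fC]] [mg [B B0 gB]]; split; first exact: measurable_funD.
exists (C + B); first exact: addr_ge0.
by move=> w; rewrite (le_trans (ler_normD _ _))// mulrDl lerD.
Qed.

Lemma lin_growth_bmeas f : bmeas f -> lin_growth f.
Proof.
move=> [mf [C fC]]; split => //; exists `|C|; rewrite ?normr_ge0// => w.
rewrite (le_trans (fC w))// (le_trans (ler_norm _))// ler_peMr// lerDl//.
Qed.

Lemma lin_growth_id : lin_growth D.
Proof. by split => //; exists 1 => // w; rewrite mul1r lerDr. Qed.

Lemma quad_growthM f g : lin_growth f -> lin_growth g -> quad_growth (fun w => f w * g w).
Proof.
move=> [mf [C C0 fC]] [mg [B B0 gB]]; split; first exact: measurable_funM.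
exists (C * B * 2); first by rewrite !mulr_ge0.
move=> w; rewrite normrM (le_trans (ler_pM _ _ (fC w) (gB w)))//.
rewrite mulrACA -!mulrA ler_wpM2l// ler_wpM2l//.
rewrite -[D w ^+ 2]real_normK ?num_real//.
by have := sqr_ge0 (`|D w| - 1); nra.
Qed.

Lemma quad_growth_lin f : lin_growth f -> quad_growth f.
Proof.
move=> lf; have := quad_growthM lf (lin_growth_bmeas (bmeas_cst 1)).
by under eq_fun do rewrite /= mulr1.
Qed.

Lemma quad_growthD f g : quad_growth f -> quad_growth g -> quad_growth (fun w => f w + g w).
Proof.
move=> [mf [C C0 fC]] [mg [B B0 gB]]; split; first exact: measurable_funD.
exists (C + B); first exact: addr_ge0.
by move=> w; rewrite (le_trans (ler_normD _ _))// mulrDl lerD.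
Qed.

Lemma quad_growthZ c f : quad_growth f -> quad_growth (fun w => c * f w).
Proof.
move=> [mf [C C0 fC]]; split; first exact: measurable_funM.
exists (`|c| * C); first by rewrite mulr_ge0.
by move=> w; rewrite normrM -mulrA ler_wpM2l.
Qed.

Lemma quad_growthB f g : quad_growth f -> quad_growth g -> quad_growth (fun w => f w - g w).
Proof.
move=> qf qg; have := quad_growthD qf (quad_growthZ (- 1) qg).
by under eq_fun do rewrite mulN1r.
Qed.

Lemma quad_growthX f : lin_growth f -> quad_growth (fun w => f w ^+ 2).
Proof. by move=> lf; have := quad_growthM lf lf; under eq_fun do rewrite -expr2. Qed.

Let i1D : mu.-integrable setT (EFin \o (fun w => 1 + D w ^+ 2)).
Proof.
have i1 : mu.-integrable setT (EFin \o cst (1 : R)) by apply: bint => //; exact: bmeas_cst.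
exact: (integrableD measurableT i1 iD2).
Qed.

Lemma quad_growth_integrable f : quad_growth f -> mu.-integrable setT (EFin \o f).
Proof.
move=> [mf [C C0 fC]].
apply: (le_integrable measurableT _ _ (integrableZl measurableT C i1D)).
  exact/measurable_EFinP.
move=> w _ /=; rewrite lee_fin (le_trans (fC w))// ler_norm//.
Qed.

Lemma qintD f g : quad_growth f -> quad_growth g ->
  \int[mu]_w (f w + g w) = \int[mu]_w f w + \int[mu]_w g w.
Proof. by move=> qf qg; rewrite RintegralD//; exact: quad_growth_integrable. Qed.

Lemma qintB f g : quad_growth f -> quad_growth g ->
  \int[mu]_w (f w - g w) = \int[mu]_w f w - \int[mu]_w g w.
Proof. by move=> qf qg; rewrite RintegralB//; exact: quad_growth_integrable. Qed.

Lemma qintZ c f : quad_growth f -> \int[mu]_w (c * f w) = c * \int[mu]_w f w.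
Proof. by move=> qf; rewrite RintegralZl//; exact: quad_growth_integrable. Qed.

Lemma qint_norm_le f C : measurable_fun setT f -> 0 <= C ->
  (forall w, `|f w| <= C * (1 + D w ^+ 2)) ->
  `|\int[mu]_w f w| <= C * (1 + \int[mu]_w (D w ^+ 2)).
Proof.
move=> mf C0 fC; have qf : quad_growth f by split => //; exists C.
apply: le_trans (le_normr_Rintegral _ _) _ => //; first exact: quad_growth_integrable.
rewrite -{1}(bint_cst mu1 1) -RintegralD//; last by apply: bint => //; exact: bmeas_cst.
rewrite -RintegralZl//; apply: le_Rintegral => //.
- exact: (integrable_abse (quad_growth_integrable qf)).
- exact: (integrableZl measurableT C i1D).
Qed.

(** Where |D| > K, the negative power |D|^(2 - p) is at most K^(2 - p). This is how a moment of
    order above 2 makes truncated second moments decay. *)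
Lemma tail_moment (p B K : R) : 2 < p -> 0 < K ->
  (\int[mu]_w (`|D w| `^ p)%:E <= B%:E)%E -> tail mu D K <= B * K `^ (2 - p).
Proof.
move=> p2 K0 DB; have Kp : 0 <= K `^ (2 - p) by exact: powR_ge0.
rewrite -lee_fin /tail EFin_Rintegral; last exact: tail_integrable.
have mp : measurable_fun setT (fun w => (`|D w| `^ p)%:E).
  apply/measurable_EFinP; apply: (measurableT_comp (measurable_powR _)).
  exact: (measurableT_comp (@normr_measurable R setT)).
apply: (@le_trans _ _ (\int[mu]_w ((K `^ (2 - p))%:E * (`|D w| `^ p)%:E))%E); last first.
  rewrite ge0_integralZl//.
  by rewrite [leRHS]EFinM [leRHS]muleC; apply: lee_wpmul2l => //; rewrite lee_fin.
apply: ge0_le_integral => //.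
- by move=> w _; rewrite lee_fin mulr_ge0 ?sqr_ge0 ?ler0n.
- apply/measurable_EFinP; apply: measurable_funM; first exact: measurable_funX.
  exact: measurable_norm_gt.
- exact: measurable_funeM.
move=> w _; rewrite -EFinM lee_fin.
have [KD|_] := ltP K `|D w|; last by rewrite mulr0 mulr_ge0// powR_ge0.
rewrite mulr1 -[D w ^+ 2]real_normK ?num_real//.
have D0 : 0 < `|D w| by exact: lt_trans KD.
have -> : `|D w| ^+ 2 = `|D w| `^ (2 - p) * `|D w| `^ p.
  by rewrite -powRD ?subrK ?powR_mulrn//; rewrite (gt_eqF D0) implybT.
rewrite ler_wpM2r ?powR_ge0//.
rewrite -(opprB p 2) !powRN lef_pV2 ?posrE ?powR_gt0//.
by apply: ge0_ler_powR; rewrite ?nnegrE ?subr_ge0 ?ltW.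
Qed.

End quadratic_growth.

Section increment_bounds.
Context {R : realFieldType}.
Implicit Types x y c C : R.

(** The middle bound holds because x + 1 <= (1 + |D|)(|y| + 1). The difference of the inverses is -
    D over the product of the two denominators, so replacing |y| + 1 by x + 1 once more gives order
    x^(-2) at the price of a factor quadratic in D. *)
Lemma inv_norm1_bounds x y : 0 <= x -> let D := `|y| - x in
  [/\ 0 < (`|y| + 1)^-1 <= 1, (`|y| + 1)^-1 <= (1 + `|D|) / (x + 1) &
    `|(`|y| + 1)^-1 - (x + 1)^-1| <= 2 * (1 + D ^+ 2) / (x + 1) ^+ 2].
Proof.
move=> x0 D; have y0 : 0 <= `|y| by [].
have yE : `|y| = x + D by rewrite /D addrC subrK.
move: yE y0; set a := `|y|; move: D => D -> xD0.
have x1 : 0 < x + 1 by lra.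
have y1 : 0 < x + D + 1 by lra.
have D0 := normr_ge0 D; have Dn : - `|D| <= D by rewrite lerNl -normrN ler_norm.
have H : (x + D + 1)^-1 <= (1 + `|D|) / (x + 1).
  rewrite ler_pdivlMr// mulrC ler_pdivrMr//.
  have := mulr_ge0 D0 xD0; nra.
split => //.
  by rewrite invr_gt0 y1/= invf_le1//; lra.
have -> : (x + D + 1)^-1 - (x + 1)^-1 = - D * (x + D + 1)^-1 / (x + 1).
  by field; rewrite !gt_eqF.
rewrite !normrM normrN (gtr0_norm (_ : 0 < (x + 1)^-1)) ?invr_gt0//.
rewrite (gtr0_norm (_ : 0 < (x + D + 1)^-1)) ?invr_gt0//.
have -> : 2 * (1 + D ^+ 2) / (x + 1) ^+ 2 = 2 * (1 + D ^+ 2) / (x + 1) / (x + 1).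
  by rewrite expr2 invfM !mulrA.
apply: ler_wpM2r; first by rewrite invr_ge0 ltW.
apply: (@le_trans _ _ (`|D| * ((1 + `|D|) / (x + 1)))); first by rewrite ler_wpM2l.
rewrite mulrA ler_wpM2r ?invr_ge0 ?ltW//.
rewrite -[D ^+ 2]real_normK ?num_real//.
by have := sqr_ge0 (`|D| - 1); nra.
Qed.

(** [e] is the increment of phi / (|X| + 1), with [a] and [b] the values of phi after and before the
    step. Boundedness serves growth and truncation, the order 1 / x the square, and the order 1 /
    x^2 the mean. *)
Lemma correction_bounds x y a b C : 0 <= x -> `|a| <= C -> `|b| <= C ->
  let D := `|y| - x in let e := a / (`|y| + 1) - b / (x + 1) in
  [/\ `|e| <= 2 * C, `|e| <= C * (2 + `|D|) / (x + 1) &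
    `|e - (a - b) / (x + 1)| <= C * (2 * (1 + D ^+ 2)) / (x + 1) ^+ 2].
Proof.
move=> x0 aC bC D e; have [/andP[i0 i1] iD id] := inv_norm1_bounds y x0.
have C0 : 0 <= C by exact: le_trans aC.
have x1 : 0 < x + 1 by lra.
have j0 : 0 < (x + 1)^-1 by rewrite invr_gt0.
have j1 : (x + 1)^-1 <= 1 by rewrite invf_le1//; lra.
have eC : `|e| <= C * (`|y| + 1)^-1 + C * (x + 1)^-1.
  rewrite /e (le_trans (ler_normB _ _))// !normrM (gtr0_norm i0) (gtr0_norm j0).
  by apply: lerD; rewrite ler_wpM2r// ltW.
split.
- by apply: (le_trans eC); have := ler_wpM2l C0 i1; have := ler_wpM2l C0 j1; lra.
- apply: (le_trans eC); have := ler_wpM2l C0 iD; rewrite -/D.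
  move: (x + 1)^-1 (`|y| + 1)^-1 => j i; lra.
have -> : e - (a - b) / (x + 1) = a * ((`|y| + 1)^-1 - (x + 1)^-1) by rewrite /e; lra.
by rewrite normrM -mulrA; apply: ler_pM.
Qed.

(* [D + b - a] is the leading part of the increment and [e] its correction. *)
Lemma square_correction x D a b e C : 0 <= x -> `|a| <= C -> `|b| <= C ->
  `|e| <= 2 * C -> `|e| <= C * (2 + `|D|) / (x + 1) ->
  `|(D + (b - a) + e) ^+ 2 - (D + (b - a)) ^+ 2| <= C * (6 + 18 * C) * (1 + D ^+ 2) / (x + 1).
Proof.
move=> x0 aC bC eC eD; have C0 : 0 <= C by exact: le_trans aC.
have -> : (D + (b - a) + e) ^+ 2 - (D + (b - a)) ^+ 2 = e * (2 * (D + (b - a)) + e) by ring.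
have A : `|2 * (D + (b - a)) + e| <= 2 * `|D| + 6 * C.
  have := ler_normD (2 * (D + (b - a))) e; have := ler_normD D (b - a).
  have := ler_normB b a; rewrite normrM (ger0_norm (_ : 0 <= 2))//; lra.
rewrite normrM (le_trans (ler_pM _ _ eD A))// -!mulrA [_^-1 * _]mulrC !mulrA.
rewrite ler_wpM2r//; first by rewrite invr_ge0; lra.
rewrite -!mulrA ler_wpM2l// -[D ^+ 2]real_normK ?num_real//.
have := normr_ge0 D; move: `|D| => t t0.
have : 2 * t <= 1 + t ^+ 2 by have := sqr_ge0 (t - 1); lra.
by have := mulr_ge0 C0 (sqr_ge0 (t - 1)); have := mulr_ge0 C0 (sqr_ge0 t); lra.
Qed.

(** If |D'| > K >= 8 C, then |D| > K / 2 >= 4 C and so |D'| <= 2 |D|; squaring gives the factor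
    4. *)
Lemma tail_correction D D' C K : 0 <= C -> `|D'| <= `|D| + 4 * C -> 8 * C <= K ->
  D' ^+ 2 * (K < `|D'|)%R%:R <= 4 * (D ^+ 2 * (K / 2 < `|D|)%R%:R).
Proof.
move=> C0 DD CK; have [KD|_] := ltP K `|D'|; last first.
  by rewrite mulr0 mulr_ge0// mulr_ge0 ?sqr_ge0 ?ler0n.
have -> : K / 2 < `|D| by lra.
rewrite !mulr1 -[D' ^+ 2]real_normK ?num_real// -[D ^+ 2]real_normK ?num_real//.
have : `|D'| <= 2 * `|D| by lra.
by have := normr_ge0 D'; have := normr_ge0 D; nra.
Qed.

End increment_bounds.

Section lyapunov_increment.
Context {R : realType} {S : pointedMetricType R}.
Variable mu : {measure set (state R S) -> \bar R}.
Hypothesis mu1 : mu setT = 1%E.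
Variables (psi phi : S -> R) (C : R).
Hypotheses (mpsi : measurable_fun [set: borel S] (psi : borel S -> R))
  (mphi : measurable_fun [set: borel S] (phi : borel S -> R)).
Hypotheses (psiC : forall u, `|psi u| <= C) (phiC : forall u, `|phi u| <= C).

(** The kernel is encoded on all of R * S; the absolute value extends the function from the
    half-strip with the same bounds everywhere, and the 1 keeps the denominator positive at height
    0. *)
Definition lyapunov (w : state R S) := `|w.1| + psi w.2 + phi w.2 / (`|w.1| + 1).

Lemma measurable_lyapunov : measurable_fun setT lyapunov.
Proof.
have m1 : measurable_fun [set: state R S] (fun w => `|w.1|).
  by apply: measurableT_comp => //; exact: measurable_fst.
apply: measurable_funD.
  apply: measurable_funD => //.
  by apply: measurableT_comp => //; exact: measurable_snd.
apply: measurable_funM.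
  by apply: measurableT_comp => //; exact: measurable_snd.
apply: measurable_fun_inv_ge0; last by move=> w; rewrite addr_ge0.
by apply: measurable_funD.
Qed.

Variables (x : R) (u : S).
Hypothesis x0 : 0 <= x.

Let D (w : state R S) := `|w.1| - x.
Let Del w := lyapunov w - lyapunov (x, u).

Hypothesis iD2 : mu.-integrable setT (EFin \o (fun w => D w ^+ 2)).

Let C0 : 0 <= C. Proof. exact: le_trans (psiC u). Qed.
Let x1 : 0 < x + 1. Proof. by rewrite ltr_wpDl. Qed.

Lemma measurable_norm_increment : measurable_fun setT D.
Proof.
apply: measurable_funB => //.
by apply: measurableT_comp => //; exact: measurable_fst.
Qed.
Let mD := measurable_norm_increment.

Let mDel : measurable_fun setT Del.
Proof. by apply: measurable_funB => //; exact: measurable_lyapunov. Qed.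

Let e (w : state R S) := phi w.2 / (`|w.1| + 1) - phi u / (x + 1).

Let DelE w : Del w = D w + (psi w.2 - psi u) + e w.
Proof. by rewrite /Del /D /e /lyapunov/= (ger0_norm x0); lra. Qed.

Let bsnd (f : S -> R) B : measurable_fun [set: borel S] (f : borel S -> R) ->
  (forall v, `|f v| <= B) -> bmeas (fun w : state R S => f w.2).
Proof.
move=> mf fB; split; last by exists B => w.
by apply: measurableT_comp => //; exact: measurable_snd.
Qed.

Let bpsi : bmeas (fun w : state R S => psi w.2). Proof. exact: bsnd. Qed.
Let bphi : bmeas (fun w : state R S => phi w.2). Proof. exact: bsnd. Qed.

Let lb f : bmeas f -> lin_growth D f. Proof. exact: lin_growth_bmeas. Qed.
Let lc c : lin_growth D (fun=> c). Proof. exact: (lb (bmeas_cst c)). Qed.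
Let lD : lin_growth D D. Proof. exact: lin_growth_id. Qed.

Let lDel : lin_growth D Del.
Proof.
split; first exact: mDel.
exists (1 + 4 * C); first by rewrite addr_ge0// mulr_ge0.
move=> w; have [e1 _ _] := correction_bounds w.1 x0 (phiC w.2) (phiC u).
rewrite DelE (le_trans (ler_normD _ _))//.
have := ler_normD (D w) (psi w.2 - psi u); have := ler_normB (psi w.2) (psi u).
have := psiC w.2; have := psiC u; have := mulr_ge0 C0 (normr_ge0 (D w)); move: e1.
by rewrite -/(e w); move=> *; lra.
Qed.

Let q f : lin_growth D f -> quad_growth D f. Proof. exact: quad_growth_lin. Qed.

Lemma lyapunov_increment_integrable : mu.-integrable setT (EFin \o (fun w => Del w ^+ 2)).
Proof.
exact: (quad_growth_integrable mu1 iD2 (quad_growthX lDel)).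
Qed.

Lemma lyapunov_increment_mean :
  `|\int[mu]_w Del w - (\int[mu]_w D w + (\int[mu]_w psi w.2 - psi u)
      + (\int[mu]_w phi w.2 - phi u) / (x + 1))| <=
  C * 2 / (x + 1) ^+ 2 * (1 + \int[mu]_w (D w ^+ 2)).
Proof.
set I := (X in _ - X).
have -> : I = \int[mu]_w (D w + (psi w.2 - psi u) + (phi w.2 - phi u) / (x + 1)).
  have E (f : state R S -> R) : bmeas f -> \int[mu]_w (f w - f (x, u)) = \int[mu]_w f w - f (x, u).
    by move=> bf; rewrite (bintB mu1 bf (bmeas_cst _)) (bint_cst mu1).
  have bB (f : state R S -> R) : bmeas f -> bmeas (fun w => f w - f (x, u)).
    by move=> bf; apply: bmeasB => //; exact: bmeas_cst.
  have Epsi : \int[mu]_w (psi w.2 - psi u) = \int[mu]_w psi w.2 - psi u := E _ bpsi.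
  have Ephi : \int[mu]_w (phi w.2 - phi u) = \int[mu]_w phi w.2 - phi u := E _ bphi.
  have lpsi : lin_growth D (fun w => psi w.2 - psi u) by apply: lb; exact: (bB _ bpsi).
  have qphi : quad_growth D (fun w => (phi w.2 - phi u) / (x + 1)).
    by apply: q; apply: lb; apply: bmeasM; [exact: (bB _ bphi)|exact: bmeas_cst].
  rewrite (qintD mu1 iD2 (q (lin_growthD lD lpsi)) qphi) (qintD mu1 iD2 (q lD) (q lpsi)).
  rewrite Epsi /I addrA; congr (_ + _).
  under [RHS]eq_Rintegral do rewrite mulrC.
  by rewrite (bintZ mu1 _ (bB _ bphi)) Ephi mulrC.
rewrite -(qintB mu1 iD2); last 2 first.
- exact: q lDel.
- apply: q; apply: lin_growthD.
    by apply: lin_growthD => //; apply: lb; apply: bmeasB => //; exact: bmeas_cst.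
  by apply: lb; apply: bmeasM; [apply: bmeasB => //; exact: bmeas_cst|exact: bmeas_cst].
apply: (qint_norm_le mu1 iD2).
- apply: measurable_funB => //; apply: measurable_funD.
    by apply: measurable_funD => //; apply: measurable_funB => //; case: bpsi.
  by apply: measurable_funM => //; apply: measurable_funB => //; case: bphi.
- by rewrite !mulr_ge0 ?invr_ge0 ?sqr_ge0.
move=> w; have [_ _ e3] := correction_bounds w.1 x0 (phiC w.2) (phiC u).
have -> : Del w - (D w + (psi w.2 - psi u) + (phi w.2 - phi u) / (x + 1)) =
    e w - (phi w.2 - phi u) / (x + 1) by rewrite DelE; ring.
rewrite (_ : C * 2 / (x + 1) ^+ 2 * (1 + D w ^+ 2) = C * (2 * (1 + D w ^+ 2)) / (x + 1) ^+ 2)//.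
by ring.
Qed.

Lemma lyapunov_increment_square :
  `|\int[mu]_w (Del w ^+ 2) - (\int[mu]_w (D w ^+ 2) + 2 * (\int[mu]_w (D w * psi w.2))
      - 2 * psi u * \int[mu]_w D w + \int[mu]_w (psi w.2 ^+ 2)
      - 2 * psi u * \int[mu]_w psi w.2 + psi u ^+ 2)| <=
  C * (6 + 18 * C) / (x + 1) * (1 + \int[mu]_w (D w ^+ 2)).
Proof.
have qD2 := quad_growthX lD.
have qDp : quad_growth D (fun w => D w * psi w.2) by apply: quad_growthM => //; exact: lb.
have qp : quad_growth D (fun w => psi w.2) by apply: q; exact: lb.
have qpp : quad_growth D (fun w => psi w.2 ^+ 2).
  exact: (quad_growthX (lb bpsi)).
have qc : quad_growth D (fun=> psi u ^+ 2) by exact: (q (lc _)).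
set I := (X in _ - X).
have -> : I = \int[mu]_w (D w ^+ 2 + 2 * (D w * psi w.2) - 2 * psi u * D w
    + psi w.2 ^+ 2 - 2 * psi u * psi w.2 + psi u ^+ 2).
  have q1 := quad_growthD qD2 (quad_growthZ 2 qDp).
  have q2 := quad_growthB q1 (quad_growthZ (2 * psi u) (q lD)).
  have q3 := quad_growthD q2 qpp.
  have q4 := quad_growthB q3 (quad_growthZ (2 * psi u) qp).
  rewrite (qintD mu1 iD2 q4 qc) (qintB mu1 iD2 q3 (quad_growthZ _ qp)).
  rewrite (qintD mu1 iD2 q2 qpp) (qintB mu1 iD2 q1 (quad_growthZ _ (q lD))).
  rewrite (qintD mu1 iD2 qD2 (quad_growthZ _ qDp)) (bint_cst mu1).
  rewrite (qintZ mu1 iD2 2 qDp) (qintZ mu1 iD2 _ qp) (qintZ mu1 iD2 _ (q lD)).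
  by rewrite /I.
rewrite (_ : (fun w => D w ^+ 2 + _ - _ + _ - _ + _) = (fun w => (D w + (psi w.2 - psi u)) ^+ 2)); last first.
  by apply/funext => w; ring.
have lA : lin_growth D (fun w => D w + (psi w.2 - psi u)).
  by apply: lin_growthD => //; apply: lb; apply: bmeasB => //; exact: bmeas_cst.
have qA : quad_growth D (fun w => (D w + (psi w.2 - psi u)) ^+ 2).
  exact: quad_growthX lA.
have qDel : quad_growth D (fun w => Del w ^+ 2).
  exact: quad_growthX lDel.
rewrite -(qintB mu1 iD2 qDel qA); apply: (qint_norm_le mu1 iD2).
- by case: (quad_growthB qDel qA).
- by rewrite !mulr_ge0 ?invr_ge0 ?addr_ge0// ?mulr_ge0// ltW.
move=> w; have [e1 e2 _] := correction_bounds w.1 x0 (phiC w.2) (phiC u).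
have := square_correction x0 (psiC u) (psiC w.2) e1 e2; rewrite -/(e w) -DelE => h.
apply: le_trans h _.
by rewrite [leRHS]mulrAC.
Qed.

Lemma lyapunov_increment_tail K : 8 * C <= K -> tail mu Del K <= 4 * tail mu D (K / 2).
Proof.
move=> CK; have iT := tail_integrable mD iD2 (K / 2).
rewrite /tail -RintegralZl//; apply: le_Rintegral => //.
- exact: (tail_integrable mDel lyapunov_increment_integrable).
- exact: (integrableZl measurableT 4 iT).
move=> w _; apply: (tail_correction C0) => //.
have [e1 _ _] := correction_bounds w.1 x0 (phiC w.2) (phiC u).
rewrite DelE (le_trans (ler_normD _ _))//.
have := ler_normD (D w) (psi w.2 - psi u); have := ler_normB (psi w.2) (psi u).
by have := psiC w.2; have := psiC u; move: e1; rewrite -/(e w); move=> *; lra.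
Qed.

End lyapunov_increment.

(** * Uniform bounds for the charges and the conditional drifts *)

Section charge_integral_linearity.
Context d (T : measurableType d) {R : realType}.
Variable nu : {charge set T -> \bar R}.
Implicit Types f g : T -> R.

Lemma charge_integralD f g : bmeas f -> bmeas g ->
  charge_integral nu (fun x => f x + g x) = charge_integral nu f + charge_integral nu g.
Proof.
move=> bf bg; have [p [n [_ E]]] := charge_integral_jordan nu; rewrite !E.
have D (m : {finite_measure set T -> \bar R}) :
    \int[m]_x (f x + g x) = \int[m]_x f x + \int[m]_x g x.
  have moo := finite_measure_lty m.
  by rewrite RintegralD//; exact: bmeas_integrable.
by rewrite !D; ring.
Qed.

Lemma charge_integralZ c f : bmeas f ->
  charge_integral nu (fun x => c * f x) = c * charge_integral nu f.
Proof.
move=> bf; have [p [n [_ E]]] := charge_integral_jordan nu; rewrite !E.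
have Z (m : {finite_measure set T -> \bar R}) : \int[m]_x (c * f x) = c * \int[m]_x f x.
  have moo := finite_measure_lty m.
  by rewrite RintegralZl//; exact: bmeas_integrable.
by rewrite !Z mulrBr.
Qed.

Lemma charge_integral_bounded : exists2 M, 0 <= M &
  forall f C, measurable_fun setT f -> (forall x, `|f x| <= C) ->
    `|charge_integral nu f| <= C * M.
Proof.
have [p [n [_ E]]] := charge_integral_jordan nu.
exists (fine (p setT) + fine (n setT)); first by rewrite addr_ge0 ?fine_ge0.
move=> f C mf fC; have bf : bmeas f by split => //; exists C.
rewrite E (le_trans (ler_normB _ _))// mulrDr.
have B (m : {finite_measure set T -> \bar R}) : `|\int[m]_x f x| <= C * fine (m setT).
  have moo := finite_measure_lty m.
  apply: le_trans (le_normr_Rintegral _ _) _ => //; first exact: bmeas_integrable.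
  rewrite -Rintegral_cst//; apply: le_Rintegral => //.
    by apply: bmeas_integrable => //; split; [exact: measurableT_comp|exists C => u; rewrite normr_id].
  by apply: bmeas_integrable => //; exact: bmeas_cst.
exact: lerD.
Qed.

End charge_integral_linearity.

Section tv_continuous_charges.
Context {R : realType} {S : pointedMetricType R}.
Hypothesis S_compact : compact [set: S].
Variable nu : S -> {charge set (borel S) -> \bar R}.
Hypothesis nu_continuous : tv_continuous nu.
Local Notation bm f := (bmeas (f : borel S -> R)).

Lemma charge_integral_near u (e : R) : 0 < e -> \forall v \near u, forall (f : S -> R) (C : R),
  measurable_fun [set: borel S] (f : borel S -> R) -> (forall w, `|f w| <= C) ->
  `|charge_integral (nu v) f - charge_integral (nu u) f| <= C * e.
Proof.
move=> e0; have := tv_continuous_near nu_continuous u e0.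
apply: filterS => v H f C mf fC.
have C0 : 0 <= C by rewrite (le_trans _ (fC point)).
have [C00|Cneq] := eqVneq C 0.
  have [M M0 B] := charge_integral_bounded (nu v).
  have [M' M0' B'] := charge_integral_bounded (nu u).
  have := B f C mf fC; have := B' f C mf fC.
  rewrite C00 !mul0r !normr_le0 => /eqP E1 /eqP E2.
  by rewrite E1 E2 subrr.
have Cp : 0 < C by rewrite lt_neqAle eq_sym Cneq.
have bf : bm f by split => //; exists C.
have := H (fun w => C^-1 * f w).
rewrite !charge_integralZ// -mulrBr normrM gtr0_norm ?invr_gt0//.
move=> h; rewrite -ler_pdivrMl//; apply: h; first exact: measurable_funM.
by move=> w; rewrite normrM gtr0_norm ?invr_gt0// ler_pdivrMl// mulr1.
Qed.

Lemma charge_integral_continuous f : bm f -> continuous (fun u => charge_integral (nu u) f).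
Proof.
move=> [mf [C fC]] u; apply/cvgrPdist_le => e e0.
have C0 : 0 <= C by rewrite (le_trans _ (fC point)).
have C1 : 0 < C + 1 by rewrite ltr_wpDl.
have : 0 < e / (C + 1) by rewrite divr_gt0.
move=> /(charge_integral_near u); apply: filterS => v /(_ f (C + 1) mf); rewrite distrC.
rewrite mulrC divfK ?gt_eqF//; apply => w.
by rewrite (le_trans (fC w))// lerDl.
Qed.

(** Continuity raises the bound valid at a point by at most 1 nearby, and compactness of [S] makes
    it uniform. Integer bounds let the covering argument run along [\oo]. *)
Lemma charge_integral_unif_bounded : exists2 M, 0 <= M &
  forall u (f : S -> R) C, measurable_fun [set: borel S] (f : borel S -> R) ->
    (forall x, `|f x| <= C) -> `|charge_integral (nu u) f| <= C * M.
Proof.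
pose Q (n : nat) u := forall (f : S -> R) C,
  measurable_fun [set: borel S] (f : borel S -> R) ->
  (forall x, `|f x| <= C) -> `|charge_integral (nu u) f| <= C * n%:R.
suff : \forall n \near \oo, [set: S] `<=` Q n.
  move=> [n _ /(_ n (leqnn n)) H]; exists n%:R => // u; exact: H.
apply: ((compact_near_coveringP [set: S]).1 S_compact nat \oo) => u _.
have [M M0 B] := charge_integral_bounded (nu u).
exists ([set v | forall (f : S -> R) (C : R),
  measurable_fun [set: borel S] (f : borel S -> R) -> (forall w, `|f w| <= C) ->
  `|charge_integral (nu v) f - charge_integral (nu u) f| <= C * 1], [set n | M + 1 <= n%:R]).
  split; first exact: charge_integral_near.
  exists (Num.truncn (M + 1)).+1 => // n /= Mn.
  by rewrite (le_trans (ltW (truncnS_gt _)))// ler_nat.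
move=> [v n] /= [vu Mn] f C mf fC.
have C0 : 0 <= C by rewrite (le_trans _ (fC point)).
have := vu f C mf fC; have := B f C mf fC.
have := ler_normD (charge_integral (nu v) f - charge_integral (nu u) f) (charge_integral (nu u) f).
rewrite subrK; have := ler_wpM2l C0 Mn; lra.
Qed.

End tv_continuous_charges.

Section sup_littleo.
Context {R : realType} {I : Type}.

Lemma sup_littleo_near (f : R -> I -> \bar R) g (e : R) : sup_littleo f g -> 0 < e ->
  \forall x \near +oo, forall i, (f x i <= (e * g x)%:E)%E.
Proof.
move=> fg e0; apply: filterS (fg e e0) => x H i; apply: le_trans H.
by apply: ereal_sup_ubound; exists i.
Qed.

End sup_littleo.

Section bounded_family.
Context {R : realType} {S : pointedMetricType R}.
Hypothesis S_compact : compact [set: S].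
Variable lam : S -> S -> R.
Hypothesis lam_bounded : forall u, bounded_measurable (lam u).
Hypothesis lam_continuous : forall u, sup_dist (lam v) (lam u) @[v --> u] --> 0%E.

Lemma sup_dist_near u (e : R) : 0 < e ->
  \forall v \near u, forall w, `|lam v w - lam u w| <= e.
Proof.
move=> e0; have /fine_cvgP[fin /cvgrPdist_lt/(_ _ e0)] := lam_continuous u.
apply: filterS2 fin => v vfin; rewrite sub0r normrN => vlt w.
rewrite -lee_fin; apply: (@le_trans _ _ (sup_dist (lam v) (lam u))).
  by apply: ereal_sup_ubound; exists w.
by rewrite -(fineK vfin) lee_fin (le_trans (ler_norm _))// ltW.
Qed.

Lemma lam_unif_bounded : exists2 M, 0 <= M & forall u v, `|lam u v| <= M.
Proof.
pose Q (n : nat) u := forall v, `|lam u v| <= n%:R.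
suff : \forall n \near \oo, [set: S] `<=` Q n.
  move=> [n _ /(_ n (leqnn n)) H]; exists n%:R => // u; exact: H.
apply: ((compact_near_coveringP [set: S]).1 S_compact nat \oo) => u _.
have [_ [M B]] := lam_bounded u.
exists ([set v | forall w, `|lam v w - lam u w| <= 1], [set n | M + 1 <= n%:R]).
  split; first exact: sup_dist_near.
  exists (Num.truncn (M + 1)).+1 => // n /= Mn.
  by rewrite (le_trans (ltW (truncnS_gt _)))// ler_nat.
move=> [v n] /= [vu Mn] w.
have := vu w; have := B w; have := ler_normD (lam v w - lam u w) (lam u w).
by rewrite subrK; lra.
Qed.

Variable K : R.-pker (borel S) ~> (borel S).
Hypothesis K_continuous : tv_continuous (fun u : S => kcharge K u).

Lemma kop_family_continuous (f : S -> R) : bmeas (f : borel S -> R) ->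
  continuous (fun u => kop K (fun v => lam u v * f v) u).
Proof.
move=> bf u; have [M M0 lamM] := lam_unif_bounded.
have [mf [C fC]] := bf; have C0 : 0 <= C by rewrite (le_trans _ (fC point)).
have bl v : bmeas (lam v : borel S -> R) by have [ml [B lB]] := lam_bounded v; split => //; exists B.
apply/cvgrPdist_le => e e0.
have e1 : 0 < e / 2 / (C + 1) by rewrite !divr_gt0// ltr_wpDl.
have e2 : 0 < e / 2 / (M * C + 1) by rewrite !divr_gt0// ltr_wpDl// mulr_ge0.
apply: filterS2 (sup_dist_near u e1) (kop_near K_continuous u e2) => v l1 l2.
have b v' : bmeas ((fun w => lam v' w * f w) : borel S -> R) by exact: bmeasM.
have h1 : `|kop K (fun w => lam v w * f w) v - kop K (fun w => lam u w * f w) v| <= e / 2.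
  rewrite /kop -(bintB (kmass K v) (b v) (b u)).
  apply: (bint_norm_le (kmass K v)); first by case: (bmeasB (b v) (b u)).
  move=> w; rewrite -mulrBl normrM.
  rewrite -[leRHS](@divfK _ (C + 1)) ?gt_eqF ?ltr_wpDl//; apply: ler_pM => //.
  by rewrite (le_trans (fC w))// lerDl.
have h2 : `|kop K (fun w => lam u w * f w) v - kop K (fun w => lam u w * f w) u| <= e / 2.
  have MC : 0 < M * C + 1 by rewrite ltr_wpDl// mulr_ge0.
  rewrite -[leRHS](@divfK _ (M * C + 1)) ?gt_eqF// mulrC.
  apply: l2; first by case: (b u).
  by move=> w; rewrite normrM (le_trans (ler_pM _ _ (lamM u w) (fC w)))// lerDl.
rewrite distrC [leRHS]splitr.
by apply: le_trans (lerD h1 h2); rewrite (le_trans _ (ler_normD _ _))// addrA subrK.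
Qed.

End bounded_family.

(** * Limits of the one-step moments *)

Section kernel_asymptotics.
Context {R : realType} {S : pointedMetricType R}.
Hypothesis S_compact : compact [set: S].
Variable Ks : R.-pker (state R S) ~> (state R S).
Hypothesis Ks_strip : half_strip_kernel Ks.
Variables (p xB Bp : R).
Hypothesis p_gt2 : 2 < p.
Hypothesis moment_p : forall z, half_strip z -> xB <= z.1 ->
  (\int[Ks z]_w (`|w.1 - z.1| `^ p)%:E <= Bp%:E)%E.

(** On the half-strip, which carries [Ks], this is the increment of the height; the absolute value
    matches [lyapunov]. *)
Definition norm_increment x (w : state R S) := `|w.1| - x.
Local Notation D := norm_increment.

Lemma kernel_mass z : Ks z setT = 1%E. Proof. exact: prob_kernel. Qed.

Lemma measurable_half_strip : measurable (half_strip : set (state R S)).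
Proof. exact: measurable_fst_ge. Qed.

Lemma Ks_strip0 z : half_strip z -> Ks z (~` half_strip) = 0%E.
Proof.
move=> z0; have mH := measurable_half_strip.
have E : (1 = Ks z half_strip + Ks z (~` half_strip))%E.
  rewrite -(kernel_mass z) -[in LHS](setUv half_strip).
  by apply: measureU => //; [exact: measurableC|exact: setICr].
move: E; rewrite (Ks_strip z0).
have : Ks z (~` half_strip) \is a fin_num by apply: (mass1_fin (kernel_mass z)); exact: measurableC.
by move=> /fineK <-; rewrite -EFinD => -[] h; congr EFin; lra.
Qed.

Section point.
Variables (x : R) (u : S).
Hypotheses (x0 : 0 <= x) (xxB : xB <= x).

Let mD : measurable_fun setT (D x). Proof. exact: measurable_norm_increment. Qed.

Lemma norm_increment_moment : (\int[Ks (x, u)]_w (`|D x w| `^ p)%:E <= Bp%:E)%E.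
Proof.
apply: le_trans (@moment_p (x, u) x0 xxB).
have mpow (f : state R S -> R) : measurable_fun setT f ->
    measurable_fun setT (fun w => (`|f w| `^ p)%:E).
  move=> mf; apply/measurable_EFinP; apply: (measurableT_comp (measurable_powR _)).
  exact: (measurableT_comp (@normr_measurable R setT)).
apply: ge0_le_integral => //.
- exact: mpow.
- apply: mpow; apply: measurable_funB; last exact: measurable_cst.
  exact: measurable_fst.
move=> w _; rewrite lee_fin; apply: ge0_ler_powR; rewrite ?nnegrE//.
  by rewrite (le_trans _ (ltW p_gt2)).
by rewrite /D -[in leLHS](ger0_norm x0); exact: ler_dist_dist.
Qed.

Lemma norm_increment_integrable : (Ks (x, u)).-integrable setT (EFin \o (fun w => D x w ^+ 2)).
Proof.
have mp : measurable_fun setT (fun w => `|D x w| `^ p).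
  apply: (measurableT_comp (measurable_powR _)).
  exact: (measurableT_comp (@normr_measurable R setT)).
have ip : (Ks (x, u)).-integrable setT (EFin \o (fun w => `|D x w| `^ p)).
  apply/integrableP; split; first exact/measurable_EFinP.
  apply: le_lt_trans (ltry Bp); apply: le_trans norm_increment_moment.
  apply: ge0_le_integral => //.
  - by apply: measurableT_comp => //; exact/measurable_EFinP.
  - exact/measurable_EFinP.
  - by move=> w _ /=; rewrite lee_fin ger0_norm// powR_ge0.
have i1 : (Ks (x, u)).-integrable setT (EFin \o cst (1 : R)).
  by apply: (bint (kernel_mass _)); exact: bmeas_cst.
apply: (le_integrable measurableT _ _ (integrableD measurableT i1 ip)).
  by apply/measurable_EFinP; exact: measurable_funX.
move=> w _ /=; rewrite lee_fin ger0_norm ?sqr_ge0// ger0_norm ?addr_ge0 ?powR_ge0//.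
rewrite -[D x w ^+ 2]real_normK ?num_real//; move: `|D x w| (normr_ge0 (D x w)) => t t0.
have [t1|t1] := leP t 1.
  by rewrite (le_trans (_ : _ <= 1)) ?lerDl ?powR_ge0// expr_le1.
rewrite (le_trans (_ : _ <= t `^ p)) ?lerDr//.
by rewrite -powR_mulrn// ler_powR ?ltW.
Qed.

Lemma increment_momentE k : (k = 1 \/ k = 2)%N ->
  increment_moment Ks k x u = (\int[Ks (x, u)]_w (D x w ^+ k))%:E.
Proof.
move=> k12; have mH := measurable_half_strip.
have iD : (Ks (x, u)).-integrable setT (EFin \o (fun w => D x w ^+ k)).
  apply: (quad_growth_integrable (kernel_mass _) norm_increment_integrable).
  case: k12 => ->; last exact: quad_growthX (lin_growth_id mD).
  by under eq_fun do rewrite expr1; exact: quad_growth_lin (lin_growth_id mD).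
rewrite EFin_Rintegral// (negligible_integral (measurableC mH) measurableT iD); last first.
  exact: Ks_strip0.
rewrite setTD setCK; apply: eq_integral => w; rewrite inE => w0.
by rewrite /= /D ger0_norm.
Qed.

End point.

Lemma near_valid : \forall x \near +oo, 0 <= x /\ xB <= x.
Proof. by apply: filterS2 (near_pinfty_ge 0) (near_pinfty_ge xB). Qed.

Variables (dd ee sigma2 : S -> R).
Hypotheses (dd_continuous : continuous dd) (ee_continuous : continuous ee)
  (sigma2_continuous : continuous sigma2).
Hypothesis mu1_dd_ee : sup_littleo
  (fun (x : R) (u : S) => `|increment_moment Ks 1 x u - (dd u + ee u / x)%:E|%E)
  (fun x => x^-1).
Hypothesis mu2_sigma2 : sup_littleo
  (fun (x : R) (u : S) => `|increment_moment Ks 2 x u - (sigma2 u)%:E|%E) (fun=> 1).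

Lemma mean_asymptotics :
  unif0 (fun x u => x * \int[Ks (x, u)]_w D x w - x * dd u - ee u).
Proof.
move=> e e0; have := sup_littleo_near mu1_dd_ee e0.
apply: filterS2 (filterI near_valid (near_pinfty_ge 1)) => x [[x0 xxB] x1] H u.
have xp : 0 < x by rewrite (lt_le_trans _ x1).
have := H u; rewrite increment_momentE//; last by left.
under eq_Rintegral do rewrite expr1.
rewrite -EFinB /= lee_fin ler_pdivlMr// mulrC -{1}(gtr0_norm xp) -normrM.
by congr (`| _ | <= _); field; rewrite gt_eqF.
Qed.

Lemma square_asymptotics : unif0 (fun x u => \int[Ks (x, u)]_w (D x w ^+ 2) - sigma2 u).
Proof.
move=> e e0; have := sup_littleo_near mu2_sigma2 e0.
apply: filterS2 near_valid => x [x0 xxB] H u.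
have := H u; rewrite increment_momentE//; last by right.
by rewrite -EFinB /= lee_fin mulr1.
Qed.

Variable K : R.-pker (borel S) ~> (borel S).
Variable Gam : S -> {charge set (borel S) -> \bar R}.
Hypothesis Gam_continuous : tv_continuous Gam.
Hypothesis K_continuous : tv_continuous (fun u : S => kcharge K u).
Hypothesis Ks_K_Gam : sup_littleo
    (fun (x : R) (u : S) => tv_norm
      (cadd (cadd (kcharge (marginal Ks) (x, u)) (copp (kcharge K u)))
            (copp (cscale x^-1 (Gam u)))))
    (fun x => x^-1).

Local Notation bm f := (bmeas (f : borel S -> R)).
Local Notation CG u f := (charge_integral (Gam u) f).

(** The bound is uniform in [f] as well as in [u], since it is to be applied to v |-> lam u v f v,
    which changes with [u]. *)
Lemma marginal_asymptotics (e : R) : 0 < e -> \forall x \near +oo, forall u (f : S -> R) (C : R),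
  measurable_fun [set: borel S] (f : borel S -> R) -> (forall v, `|f v| <= C) ->
  `|\int[Ks (x, u)]_w f w.2 - kop K f u - x^-1 * CG u f| <= C * (e / x).
Proof.
move=> e0; have := sup_littleo_near Ks_K_Gam e0.
apply: filterS2 (near_pinfty_ge 1) => x x1 H u f C mf fC.
have bf : bm f by split => //; exists C.
have xi0 : 0 <= x^-1 by rewrite invr_ge0 (le_trans _ x1).
rewrite Rintegral_marginal//.
have := charge_integral_le_tv mf fC (H u).
by rewrite !(charge_integral_cadd, charge_integral_copp, charge_integral_cscale, charge_integral_kcharge).
Qed.

Lemma marginal_mean_asymptotics (f : S -> R) : bm f ->
  unif0 (fun x u => x * (\int[Ks (x, u)]_w f w.2 - kop K f u) - CG u f).
Proof.
move=> [mf [C fC]] e e0; have C0 : 0 <= C by rewrite (le_trans _ (fC point)).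
have C1 : 0 < C + 1 by rewrite ltr_wpDl.
have eC : 0 < e / (C + 1) by rewrite divr_gt0.
apply: filterS2 (near_pinfty_ge 1) (marginal_asymptotics eC) => x x1 H u.
have xp : 0 < x by rewrite (lt_le_trans _ x1).
have fC1 v : `|f v| <= C + 1 by rewrite (le_trans (fC v))// lerDl.
have := H u f (C + 1) mf fC1.
rewrite mulrA mulrCA divff ?gt_eqF// mulr1 ler_pdivlMr// mulrC -{1}(gtr0_norm xp) -normrM.
by congr (`| _ | <= _); field; rewrite gt_eqF.
Qed.

Lemma CG_unifO (f : S -> R) : bm f -> unifO (fun (_ : R) u => CG u f).
Proof.
move=> [mf [C fC]]; have [M M0 B] := charge_integral_unif_bounded S_compact Gam_continuous.
by apply: (@unifO_cst _ _ _ (C * M)) => u; exact: B.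
Qed.

Lemma unif0_div (f : R -> S -> R) : unifO (fun x u => x * f x u) -> unif0 f.
Proof.
move=> Of; apply: unif0_eq (unif0M (@unif0_inv R S) Of) _.
apply: filterS (near_pinfty_ge 1) => x x1 u.
by rewrite mulKf// gt_eqF// (lt_le_trans _ x1).
Qed.

Lemma marginal_cvg (f : S -> R) : bm f ->
  unif0 (fun x u => \int[Ks (x, u)]_w f w.2 - kop K f u).
Proof.
move=> bf; apply: unif0_div.
have := unifOD (unif0_O (marginal_mean_asymptotics bf)) (CG_unifO bf).
by move=> h; apply: unifO_le h _; apply: nearW => x u; rewrite subrK.
Qed.

(** The marginal of [Ks] and [K] both have mass 1, so the expansion tested on the constant 1 leaves
    only the mass of [Gam u], which must then be arbitrarily small. *)
Lemma Gam_cst c u : CG u (fun=> c) = 0.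
Proof.
suff H : CG u (fun=> 1) = 0.
  have := charge_integralZ (Gam u) c (bmeas_cst 1); rewrite /= H mulr0.
  by rewrite (_ : (fun _ => c * 1) = (fun=> c))//; apply/funext => v; rewrite mulr1.
apply/eqP; rewrite -normr_le0; apply/ler_addgt0Pr => e e0; rewrite add0r.
have b1 : bm (fun=> 1) := bmeas_cst 1.
have := filter_ex (marginal_mean_asymptotics b1 e0) => -[x /(_ u)].
by rewrite kop_cst (bint_cst (kernel_mass _)) subrr mulr0 sub0r normrN.
Qed.

Lemma mean_cvg : unif0 (fun x u => \int[Ks (x, u)]_w D x w - dd u).
Proof.
apply: unif0_div.
have [C C0 eC] := compact_bounded_fun S_compact ee_continuous.
have := unifOD (unif0_O mean_asymptotics) (unifO_cst eC).
by move=> h; apply: unifO_le h _; apply: nearW => x u; rewrite subrK mulrBr.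
Qed.

Lemma square_unifO : unifO (fun x u => \int[Ks (x, u)]_w (D x w ^+ 2)).
Proof.
have [C C0 sC] := compact_bounded_fun S_compact sigma2_continuous.
have := unifOD (unif0_O square_asymptotics) (unifO_cst sC).
by move=> h; apply: unifO_le h _; apply: nearW => x u; rewrite subrK.
Qed.

Variable L : R.-pker (state R S * borel S) ~> R.
Hypothesis L_Ks : disintegrates Ks L.
Variable lam : S -> S -> R.
Hypothesis lam_bounded : forall u, bounded_measurable (lam u).
Hypothesis lam_continuous : forall u, sup_dist (lam v) (lam u) @[v --> u] --> 0%E.
Hypothesis drift_lam : ereal_sup
      [set `|cond_drift L x uv.1 uv.2 - (lam uv.1 uv.2)%:E|%E |
        uv in [set: S * S]] @[x --> +oo] --> 0%E.

Let bl u : bm (lam u).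
Proof. by have [ml [B lB]] := lam_bounded u; split => //; exists B. Qed.

Lemma cond_drift_near (e : R) : 0 < e -> \forall x \near +oo, forall u v,
  cond_drift L x u v \is a fin_num /\ `|fine (cond_drift L x u v) - lam u v| <= e.
Proof.
move=> e0; have /fine_cvgP[fin /cvgrPdist_lt/(_ _ e0)] := drift_lam.
apply: filterS2 fin => x xfin; rewrite sub0r normrN => xlt u v.
have H : (`|cond_drift L x u v - (lam u v)%:E| <= e%:E)%E.
  apply: le_trans (_ : _ <= ereal_sup [set `|cond_drift L x uv.1 uv.2 - (lam uv.1 uv.2)%:E|%E |
        uv in [set: S * S]])%E _; first by apply: ereal_sup_ubound; exists (u, v).
  by rewrite -(fineK xfin) lee_fin (le_trans (ler_norm _))// ltW.
by move: H; case: (cond_drift L x u v) => [r| |] //=; rewrite lee_fin.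
Qed.

Lemma strip_Rintegral_eq z (f g : state R S -> R) : half_strip z ->
  (Ks z).-integrable setT (EFin \o f) -> (Ks z).-integrable setT (EFin \o g) ->
  (forall w, half_strip w -> f w = g w) -> \int[Ks z]_w f w = \int[Ks z]_w g w.
Proof.
move=> z0 fi gi fg; have mH := measurable_half_strip.
apply: EFin_inj; rewrite !EFin_Rintegral//.
rewrite (negligible_integral (measurableC mH) measurableT fi) ?Ks_strip0//.
rewrite (negligible_integral (measurableC mH) measurableT gi) ?Ks_strip0//.
rewrite setTD setCK; apply: eq_integral => w; rewrite inE => w0.
by rewrite /= fg.
Qed.

Section conditional_drift.
Variables (x : R) (u : S) (f : S -> R) (C : R).
Hypotheses (x0 : 0 <= x) (xxB : xB <= x).
Hypotheses (mf : measurable_fun [set: borel S] (f : borel S -> R))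
  (fC : forall v, 0 <= f v <= C).
Let z : state R S := (x, u).
Let nu : {measure set (borel S) -> \bar R} := marginal Ks z.
Let Lv (v : borel S) : {measure set R -> \bar R} := L (z, v).

Let C0 : 0 <= C. Proof. by have /andP[/le_trans] := fC u; apply. Qed.

Let measurable_Lv (h : R -> \bar R) : (forall y, 0 <= h y)%E -> measurable_fun setT h ->
  measurable_fun setT (fun v => \int[Lv v]_y h y)%E.
Proof.
move=> h0 mh; apply: measurable_fun_integral_kernel => // U mU.
apply: (measurableT_comp (measurable_kernel L _ mU)).
exact: measurable_fun_pair.
Qed.

Lemma disintegrated_product (h : R -> R) : measurable_fun setT h -> (forall y, 0 <= h y) ->
  (forall y, h y <= `| `|y| - x|) -> (forall v, \int[Lv v]_y (h y)%:E \is a fin_num)%E ->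
  nu.-integrable setT (EFin \o (fun v : borel S => f v * fine (\int[Lv v]_y (h y)%:E))) /\
  \int[Ks z]_w (h w.1 * f w.2) = \int[nu]_v (f v * fine (\int[Lv v]_y (h y)%:E)).
Proof.
move=> mh h0 hD hfin.
have mhf : measurable_fun setT (fun w : state R S => h w.1 * f w.2).
  apply: measurable_funM.
    by apply: measurableT_comp => //; exact: measurable_fst.
  by apply: measurableT_comp => //; exact: measurable_snd.
have f0 v : 0 <= f v by case/andP: (fC v).
have hf0 (w : state R S) : (0 <= (h w.1 * f w.2)%:E)%E by rewrite lee_fin mulr_ge0.
have E : (\int[Ks z]_w (h w.1 * f w.2)%:E =
    \int[nu]_v (f v * fine (\int[Lv v]_y (h y)%:E))%:E)%E.
  rewrite (@integral_disintegration _ _ Ks L L_Ks z (fun w => (h w.1 * f w.2)%:E))//; last first.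
    exact/measurable_EFinP.
  apply: eq_integral => v _ /=; rewrite EFinM fineK//.
  transitivity (\int[Lv v]_y ((f v)%:E * (h y)%:E))%E.
    by apply: eq_integral => y _; rewrite -EFinM mulrC.
  rewrite ge0_integralZl ?lee_fin//.
  - exact/measurable_EFinP.
  - by move=> y _; rewrite lee_fin.
have i : (Ks z).-integrable setT (EFin \o (fun w => h w.1 * f w.2)).
  have iD2 := @norm_increment_integrable x u x0 xxB.
  apply: (quad_growth_integrable (kernel_mass z) iD2); split => //.
  exists C => // w; rewrite ger0_norm ?mulr_ge0// mulrC.
  have /andP[_ fw] := fC w.2; apply: ler_pM => //.
  by rewrite (le_trans (hD w.1))//; exact: norm_le_1sqr.
have mF : measurable_fun setT (fun v : borel S => (f v * fine (\int[Lv v]_y (h y)%:E))%:E).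
  apply/measurable_EFinP; apply: measurable_funM => //.
  apply: measurableT_comp => //; apply: measurable_Lv; last exact/measurable_EFinP.
  by move=> y; rewrite lee_fin.
split; last by rewrite /Rintegral E.
apply/integrableP; split => //.
apply: le_lt_trans (_ : _ <= \int[Ks z]_w (h w.1 * f w.2)%:E)%E _.
  rewrite E; apply: ge0_le_integral => //.
  - by apply: measurableT_comp.
  - move=> v _ /=; rewrite lee_fin ger0_norm// mulr_ge0// fine_ge0//.
    by apply: integral_ge0 => y _; rewrite lee_fin.
by rewrite -EFin_Rintegral// ltry.
Qed.

(** The disintegration formula concerns nonnegative functions, so y - x is split into its positive
    and negative parts [hp] and [hn], both cut off at negative heights; finiteness of the drift
    makes the two integrals finite and lets them be subtracted. *)
Lemma conditional_drift_integral :
  (forall v, cond_drift L x u v \is a fin_num) ->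
  measurable_fun [set: borel S] (fun v => fine (cond_drift L x u v)) /\
  \int[Ks z]_w (D x w * f w.2) = \int[nu]_v (f v * fine (cond_drift L x u v)).
Proof.
move=> cfin.
pose I : set R := `[0, +oo[%classic.
have mI : measurable I by exact: measurable_itv.
have IE y : (y \in I) = (0 <= y) by rewrite mem_setE in_itv/= andbT.
pose hp y := Num.max (y - x) 0 * \1_I y; pose hn y := Num.max (- (y - x)) 0 * \1_I y.
have mhp : measurable_fun setT hp.
  apply: measurable_funM; last exact: measurable_indic.
  by apply: measurable_maxr => //; exact: measurable_funB.
have mhn : measurable_fun setT hn.
  apply: measurable_funM; last exact: measurable_indic.
  by apply: measurable_maxr => //; apply: measurableT_comp => //; exact: measurable_funB.
have hp0 y : 0 <= hp y by rewrite mulr_ge0 ?indicE ?ler0n// le_max lexx orbT.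
have hn0 y : 0 <= hn y by rewrite mulr_ge0 ?indicE ?ler0n// le_max lexx orbT.
have hpE y : 0 <= y -> hp y = Num.max (y - x) 0.
  by move=> y0; rewrite /hp indicE IE y0 mulr1.
have hnE y : 0 <= y -> hn y = Num.max (- (y - x)) 0.
  by move=> y0; rewrite /hn indicE IE y0 mulr1.
have hpN y : y < 0 -> hp y = 0.
  by move=> y0; rewrite /hp indicE IE leNgt y0 mulr0.
have hnN y : y < 0 -> hn y = 0.
  by move=> y0; rewrite /hn indicE IE leNgt y0 mulr0.
have hpD y : hp y <= `| `|y| - x|.
  have [y0|y0] := leP 0 y; last by rewrite hpN.
  by rewrite hpE// (ger0_norm y0) ge_max ler_norm normr_ge0.
have hnD y : hn y <= `| `|y| - x|.
  have [y0|y0] := leP 0 y; last by rewrite hnN.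
  by rewrite hnE// (ger0_norm y0) ge_max normr_ge0 -normrN ler_norm.
have cE v : (cond_drift L x u v = \int[Lv v]_y (hp y)%:E - \int[Lv v]_y (hn y)%:E)%E.
  rewrite /cond_drift integralE; congr (_ - _)%E; rewrite integral_mkcond;
    apply: eq_integral => y _; rewrite patchE; have [yI|yI] := boolP (y \in _).
  - rewrite funeposE hpE; last by rewrite -IE.
    by rewrite EFin_max.
  - by rewrite hpN// ltNge -IE.
  - rewrite funenegE hnE; last by rewrite -IE.
    by rewrite EFin_max.
  - by rewrite hnN// ltNge -IE.
have fins v : ((\int[Lv v]_y (hp y)%:E \is a fin_num) /\ (\int[Lv v]_y (hn y)%:E \is a fin_num))%E.
  by have := cfin v; rewrite cE fin_numB => /andP[].
have fcE v : fine (cond_drift L x u v) =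
    fine (\int[Lv v]_y (hp y)%:E)%E - fine (\int[Lv v]_y (hn y)%:E)%E.
  by have [f1 f2] := fins v; rewrite cE fineB.
have [ip Ep] := disintegrated_product mhp hp0 hpD (fun v => (fins v).1).
have [im En] := disintegrated_product mhn hn0 hnD (fun v => (fins v).2).
split.
  rewrite (_ : (fun v => _) = (fun v => fine (\int[Lv v]_y (hp y)%:E)%E - fine (\int[Lv v]_y (hn y)%:E)%E)); last exact/funext.
  apply: measurable_funB; apply: measurableT_comp => //; apply: measurable_Lv; try exact/measurable_EFinP;
    by move=> y; rewrite lee_fin.
have -> : \int[nu]_v (f v * fine (cond_drift L x u v)) =
    \int[nu]_v (f v * fine (\int[Lv v]_y (hp y)%:E)%E - f v * fine (\int[Lv v]_y (hn y)%:E)%E).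
  by apply: eq_Rintegral => v _; rewrite fcE mulrBr.
have iD2 := @norm_increment_integrable x u x0 xxB.
have f0 v : 0 <= f v by case/andP: (fC v).
have m2 : measurable_fun setT (fun w : state R S => f w.2).
  by apply: measurableT_comp => //; exact: measurable_snd.
have iK (h : R -> R) : measurable_fun setT h -> (forall y, 0 <= h y) ->
    (forall y, h y <= `| `|y| - x|) -> (Ks z).-integrable setT (EFin \o (fun w => h w.1 * f w.2)).
  move=> mh h0 hD; apply: (quad_growth_integrable (kernel_mass z) iD2); split.
    by apply: measurable_funM => //; apply: measurableT_comp => //; exact: measurable_fst.
  exists C => // w; rewrite ger0_norm ?mulr_ge0// mulrC.
  have /andP[_ fw] := fC w.2; apply: ler_pM => //.
  by rewrite (le_trans (hD w.1))//; exact: norm_le_1sqr.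
rewrite RintegralB// -Ep -En -RintegralB//; try exact: iK.
apply: strip_Rintegral_eq => //.
- apply: (quad_growth_integrable (kernel_mass z) iD2); apply: quad_growthM.
    exact: lin_growth_id (measurable_norm_increment x).
  apply: lin_growth_bmeas; split => //; exists C => w.
  by have /andP[f1 f2] := fC w.2; rewrite ger0_norm.
- exact: (integrableB measurableT (iK hp mhp hp0 hpD) (iK hn mhn hn0 hnD)).
move=> [y v] /= y0; rewrite hpE// hnE// -mulrBl; congr (_ * _).
rewrite /D/= (ger0_norm y0); have [h1|h1] := leP (y - x) 0.
  by rewrite max_l ?oppr_ge0// sub0r opprK.
by rewrite max_r ?subr0// oppr_le0 ltW.
Qed.

End conditional_drift.

Lemma lam_marginal_cvg (f : S -> R) : bm f -> unif0 (fun x u =>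
  \int[Ks (x, u)]_w (lam u w.2 * f w.2) - kop K (fun v => lam u v * f v) u).
Proof.
move=> [mf [C fC]]; have C0 : 0 <= C by rewrite (le_trans _ (fC point)).
have [B B0 lB] := lam_unif_bounded S_compact lam_bounded lam_continuous.
have [M M0 GM] := charge_integral_unif_bounded S_compact Gam_continuous.
apply: unif0_div; exists (B * C * (1 + M)).
apply: filterS2 (near_pinfty_ge 1) (marginal_asymptotics ltr01) => x x1 H u.
have xp : 0 < x by rewrite (lt_le_trans _ x1).
have mlf : measurable_fun [set: borel S] ((fun v => lam u v * f v) : borel S -> R).
  by apply: measurable_funM => //; case: (bl u).
have lfC v : `|lam u v * f v| <= B * C by rewrite normrM ler_pM.
have h1 := H u _ _ mlf lfC; have h2 := GM u _ _ mlf lfC.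
rewrite normrM (gtr0_norm xp) -ler_pdivlMl// mulrDr mulr1 mulrDr.
move: h1; set Y := _ - _ - _ => h1.
have -> : \int[Ks (x, u)]_w (lam u w.2 * f w.2) - kop K (fun v => lam u v * f v) u =
   Y + x^-1 * CG u (fun v => lam u v * f v) by rewrite /Y subrK.
rewrite (le_trans (ler_normD _ _))// lerD//.
  by rewrite (le_trans h1)// mul1r mulrC.
by rewrite normrM gtr0_norm ?invr_gt0// ler_wpM2l// invr_ge0 ltW.
Qed.

Let cond_drift_cvg_ge0 (f : S -> R) C : measurable_fun [set: borel S] (f : borel S -> R) ->
  (forall v, 0 <= f v <= C) -> unif0 (fun x u =>
  \int[Ks (x, u)]_w (D x w * f w.2) - kop K (fun v => lam u v * f v) u).
Proof.
move=> mf fC.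
have C0 : 0 <= C by have /andP[/le_trans] := fC point; apply.
have bf : bm f by split => //; exists C => v; have /andP[f0 f1] := fC v; rewrite ger0_norm.
apply: (@unif0_eq _ _ _ (fun x u =>
  (\int[Ks (x, u)]_w (D x w * f w.2) - \int[Ks (x, u)]_w (lam u w.2 * f w.2)) +
  (\int[Ks (x, u)]_w (lam u w.2 * f w.2) - kop K (fun v => lam u v * f v) u))); last first.
  by apply: nearW => x u; rewrite addrA subrK.
apply: unif0D; last exact: lam_marginal_cvg.
move=> e e0; have eC : 0 < e / (C + 1) by rewrite divr_gt0// ltr_wpDl.
have [B B0 lB] := lam_unif_bounded S_compact lam_bounded lam_continuous.
apply: filterS2 near_valid (cond_drift_near eC) => x [x0 xxB] H u.
have [mcd E] := conditional_drift_integral x0 xxB mf fC (fun v => (H u v).1).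
have m1 : marginal Ks (x, u) setT = 1%E by exact: prob_kernel.
have blf : bm (fun v => lam u v * f v) by exact: bmeasM.
have bcd : bm (fun v => f v * fine (cond_drift L x u v)).
  apply: bmeasM => //; split => //; exists (e / (C + 1) + B) => v.
  have [_ h] := H u v; have := ler_normD (fine (cond_drift L x u v) - lam u v) (lam u v).
  by rewrite subrK; have := lB u v; lra.
rewrite E (Rintegral_marginal Ks (x, u) blf) -(bintB m1 bcd blf).
apply: (bint_norm_le m1); first by case: (bmeasB bcd blf).
move=> v; rewrite [lam u v * _]mulrC -mulrBr normrM mulrC.
have [_ h] := H u v; rewrite -[leRHS](@divfK _ (C + 1)) ?gt_eqF ?ltr_wpDl//.
apply: ler_pM => //; have /andP[f0 f1] := fC v.
by rewrite ger0_norm// (le_trans f1)// lerDl.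
Qed.

(** Conditioning on the next S-coordinate replaces D by a mean uniformly close to [lam u]. The sign
    restriction is removed by writing [f] as the difference of the nonnegative functions f + C and
    C. *)
Lemma cond_drift_cvg (f : S -> R) : bm f -> unif0 (fun x u =>
  \int[Ks (x, u)]_w (D x w * f w.2) - kop K (fun v => lam u v * f v) u).
Proof.
move=> bf; have [mf [C fC]] := bf; have C0 : 0 <= C by rewrite (le_trans _ (fC point)).
have bC : bm (fun=> C) := bmeas_cst C.
have bfC : bm (fun v => f v + C) by exact: bmeasD.
have := unif0B (@cond_drift_cvg_ge0 (fun v => f v + C) (C + C) bfC.1 _)
  (@cond_drift_cvg_ge0 (fun=> C) C bC.1 _).
move=> h; apply: unif0_eq (h _ _) _.
- by move=> v; have := fC v; rewrite ler_norml => /andP[h1 h2]; rewrite -lerBlDr sub0r h1 lerD2r.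
- by move=> v; rewrite C0 lexx.
apply: filterS near_valid => x [x0 xxB] u.
have iD2 := @norm_increment_integrable x u x0 xxB.
have lD := lin_growth_id (measurable_norm_increment x : measurable_fun setT (D x)).
have l2 (g : S -> R) : bm g -> lin_growth (D x) (fun w => g w.2).
  move=> [mg [B gB]]; apply: lin_growth_bmeas; split; last by exists B => w.
  by apply: measurableT_comp => //; exact: measurable_snd.
have qf := quad_growthM lD (l2 _ bf); have qC := quad_growthM lD (l2 _ bC).
have -> : \int[Ks (x, u)]_w (D x w * (f w.2 + C)) =
    \int[Ks (x, u)]_w (D x w * f w.2) + \int[Ks (x, u)]_w (D x w * C).
  by rewrite -(qintD (kernel_mass _) iD2 qf qC); apply: eq_Rintegral => w _; rewrite mulrDr.
have -> : kop K (fun v => lam u v * (f v + C)) u =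
    kop K (fun v => lam u v * f v) u + kop K (fun v => lam u v * C) u.
  rewrite /kop -(bintD (kmass K u) (bmeasM (bl u) bf) (bmeasM (bl u) bC)).
  by apply: eq_Rintegral => w _; rewrite mulrDr.
by ring.
Qed.

(** Both sides are limits of E[D]: one by averaging the conditional drifts, the other by the
    Lamperti expansion. *)
Lemma lam_mean u : kop K (lam u) u = dd u.
Proof.
apply/eqP; rewrite -subr_eq0 -normr_le0; apply/ler_addgt0Pr => e e0; rewrite add0r.
have b1 : bm (fun=> 1) := bmeas_cst 1.
have := filter_ex (unif0B mean_cvg (cond_drift_cvg b1) e0) => -[x /(_ u)].
rewrite (_ : (fun w => D x w * 1) = D x); last by apply/funext => w; rewrite mulr1.
rewrite (_ : (fun v => lam u v * 1) = lam u); last by apply/funext => w; rewrite mulr1.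
by congr (`| _ | <= _); ring.
Qed.

Section lyapunov_asymptotics.
Variables (psi phi : S -> R).
Hypotheses (psi_continuous : continuous psi) (phi_continuous : continuous phi).
Hypothesis psi_dd : forall u, psi u - kop K psi u = dd u.

(** The limit of E[(D + psi(eta') - psi(u))^2], with eta' the next S-coordinate: in its expansion
    the terms in psi d and psi K psi combine by d = psi - K psi. The last bracket has mean 0 under
    [pi] by invariance. *)
Definition increment_variance u :=
  sigma2 u + 2 * kop K (fun v => lam u v * psi v) u + (kop K (fun v => psi v ^+ 2) u - psi u ^+ 2).

Let G := lyapunov psi phi.

Let common_bound : exists2 C, 0 <= C & forall u, `|psi u| <= C /\ `|phi u| <= C.
Proof.
have [A A0 pA] := compact_bounded_fun S_compact psi_continuous.
have [B B0 pB] := compact_bounded_fun S_compact phi_continuous.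
exists (A + B); first exact: addr_ge0.
by move=> u; rewrite (le_trans (pA u)) ?lerDl// (le_trans (pB u)) ?lerDr.
Qed.

Let bpsi : bm psi. Proof. exact: bmeas_continuous. Qed.
Let bphi : bm phi. Proof. exact: bmeas_continuous. Qed.
Let bpsi2 : bm (fun v => psi v ^+ 2).
Proof. by have := bmeasM bpsi bpsi; under eq_fun do rewrite -expr2. Qed.

Let unif0_inv1 : unif0 (fun (x : R) (_ : S) => (x + 1)^-1).
Proof.
apply: unif0_le (@unif0_inv R S) _; apply: filterS (near_pinfty_ge 1) => x x1 _.
have xp : 0 < x by rewrite (lt_le_trans _ x1).
have xp1 : 0 < x + 1 by rewrite addr_gt0.
by rewrite !gtr0_norm ?invr_gt0// lef_pV2 ?posrE// lerDl.
Qed.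

Let unifO_second (c : R) : unifO (fun x u => c * (1 + \int[Ks (x, u)]_w (D x w ^+ 2))).
Proof.
apply: unifOM; first by apply: (@unifO_cst _ _ _ `|c|) => u.
by apply: unifOD square_unifO; apply: (@unifO_cst _ _ _ 1) => u; rewrite normr1.
Qed.

Let psiO : unifO (fun (_ : R) u => psi u).
Proof. by have [C _ pC] := compact_bounded_fun S_compact psi_continuous; exact: unifO_cst pC. Qed.

Lemma increment_square_cvg :
  unif0 (fun x u => \int[Ks (x, u)]_w ((G w - G (x, u)) ^+ 2) - increment_variance u).
Proof.
have [C C0 pC] := common_bound.
have P1 := unif0M unif0_inv1 (unifO_second (C * (6 + 18 * C))).
have P2 := unif0M (cond_drift_cvg bpsi) (@unifO_cst R S (fun=> 2) `|2| (fun=> lexx _)).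
have P3 := unif0M (unif0D mean_cvg (marginal_cvg bpsi)) psiO.
have P4 := unif0M P3 (@unifO_cst R S (fun=> 2) `|2| (fun=> lexx _)).
have main := unif0D (unif0D square_asymptotics P2) (unif0B (marginal_cvg bpsi2) P4).
apply: (@unif0_eq _ _ _ (fun x u =>
  (\int[Ks (x, u)]_w ((G w - G (x, u)) ^+ 2) -
  (\int[Ks (x, u)]_w (D x w ^+ 2) + 2 * (\int[Ks (x, u)]_w (D x w * psi w.2))
      - 2 * psi u * \int[Ks (x, u)]_w D x w + \int[Ks (x, u)]_w (psi w.2 ^+ 2)
      - 2 * psi u * \int[Ks (x, u)]_w psi w.2 + psi u ^+ 2)) + _) (unif0D _ main)); last first.
  by apply: nearW => x u; rewrite /increment_variance -psi_dd; ring.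
apply: unif0_le P1 _; apply: filterS near_valid => x [x0 xxB] u.
have := lyapunov_increment_square (kernel_mass (x, u)) bpsi.1 bphi.1
  (fun u => (pC u).1) (fun u => (pC u).2) u x0 (norm_increment_integrable u x0 xxB).
by move=> h; apply: (le_trans h); rewrite mulrA [_^-1 * _]mulrC ler_norm.
Qed.

(** Multiplied by x, the drift of X is x d + e and that of psi is x (K psi - psi) + Gam psi, up to
    o(1); the terms of order x cancel by the Poisson equation, and phi / (X + 1) adds K phi -
    phi. *)
Lemma increment_mean_cvg : unif0 (fun x u =>
  G (x, u) * \int[Ks (x, u)]_w (G w - G (x, u)) - (ee u + CG u psi + (kop K phi u - phi u))).
Proof.
have [C C0 pC] := common_bound.
pose m x u := \int[Ks (x, u)]_w (G w - G (x, u)).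
have bO (f : S -> R) : continuous f -> unifO (fun (_ : R) u => f u).
  by move=> cf; have [B _ fB] := compact_bounded_fun S_compact cf; exact: unifO_cst fB.
have P1 := unif0M unif0_inv1 (unifO_second (C * 2)).
have cphi := marginal_cvg bphi.
have kphi : unifO (fun (_ : R) u => kop K phi u - phi u).
  by apply: bO => u; apply: cvgB; [exact: kop_continuous|exact: phi_continuous].
have P2 := unif0M unif0_inv1 (unifOD (unif0_O cphi) kphi).
have P3 := unif0D mean_asymptotics (marginal_mean_asymptotics bpsi).
have main := unif0D P3 (unif0B cphi P2).
have xm : unif0 (fun x u => x * m x u - (ee u + CG u psi + (kop K phi u - phi u))).
  apply: (@unif0_eq _ _ _ (fun x u =>
    x * (m x u - (\int[Ks (x, u)]_w D x w + (\int[Ks (x, u)]_w psi w.2 - psi u)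
      + (\int[Ks (x, u)]_w phi w.2 - phi u) / (x + 1))) + _) (unif0D _ main)); last first.
    apply: filterS (near_pinfty_ge 1) => x x1 u; rewrite -psi_dd.
    have xp1 : x + 1 != 0 by rewrite gt_eqF// ltr_wpDl// (le_trans _ x1).
    by field.
  apply: unif0_le P1 _; apply: filterS2 near_valid (near_pinfty_ge 1) => x [x0 xxB] x1 u.
  have := lyapunov_increment_mean (kernel_mass (x, u)) bpsi.1 bphi.1
    (fun u => (pC u).1) (fun u => (pC u).2) u x0 (norm_increment_integrable u x0 xxB).
  rewrite normrM (ger0_norm x0) => h.
  have xp1 : 0 < x + 1 by rewrite ltr_wpDl.
  rewrite (le_trans (ler_wpM2l x0 h))// (le_trans _ (ler_norm _))//.
  have : 0 <= 1 + \int[Ks (x, u)]_w (D x w ^+ 2).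
    by rewrite addr_ge0// Rintegral_ge0// => w _; exact: sqr_ge0.
  rewrite -/(D x); set M := 1 + _ => M0.
  have -> : x * (C * 2 / (x + 1) ^+ 2 * M) = x / (x + 1) * ((x + 1)^-1 * (C * 2 * M)).
    by field; rewrite gt_eqF.
  rewrite ler_piMl//; last by rewrite ler_pdivrMr// mul1r lerDl.
  by rewrite mulr_ge0 ?invr_ge0 ?mulr_ge0// ltW.
(* Boundedness of x E[D] gives E[D] -> 0; since G - x is bounded, G may then replace x as the
   factor. *)
have m0 : unif0 m.
  apply: unif0_div; have := unifOD (unif0_O xm) (unifOD (unifOD (bO _ ee_continuous) (CG_unifO bpsi)) kphi).
  by move=> h; apply: unifO_le h _; apply: nearW => x u; rewrite subrK.
have GO : unifO (fun x u => G (x, u) - x).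
  exists (C + C); apply: filterS (near_pinfty_ge 1) => x x1 u.
  have x0 : 0 <= x by rewrite (le_trans _ x1).
  have -> : G (x, u) - x = psi u + phi u / (x + 1) by rewrite /G /lyapunov/= (ger0_norm x0); ring.
  rewrite (le_trans (ler_normD _ _))//.
  rewrite lerD ?(pC u).1// normrM (le_trans _ (pC u).2)// ler_piMr//.
  have xp1 : 0 < x + 1 by rewrite ltr_wpDl.
  by rewrite gtr0_norm ?invr_gt0// invf_le1// lerDr.
apply: unif0_eq (unif0D xm (unif0M m0 GO)) _.
by apply: nearW => x u; rewrite /m; ring.
Qed.

Lemma increment_integrable x u : 0 <= x -> xB <= x ->
  (Ks (x, u)).-integrable setT (EFin \o (fun w => (G w - G (x, u)) ^+ 2)).
Proof.
have [C C0 pC] := common_bound => x0 xxB.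
apply: (lyapunov_increment_integrable (kernel_mass (x, u)) bpsi.1 bphi.1
  (fun u => (pC u).1) (fun u => (pC u).2) _ x0 (norm_increment_integrable u x0 xxB)).
Qed.

Lemma increment_tail : exists2 C, 0 < C & forall x u K, 0 <= x -> xB <= x -> C <= K ->
  tail (Ks (x, u)) (fun w => G w - G (x, u)) K <= 4 * Bp * (K / 2) `^ (2 - p).
Proof.
have [C C0 pC] := common_bound; exists (8 * C + 1); first by rewrite ltr_wpDl// mulr_ge0.
move=> x u A x0 xxB CA.
have CA' : 8 * C <= A by rewrite (le_trans _ CA)// lerDl.
have A0 : 0 < A by rewrite (lt_le_trans _ CA)// ltr_wpDl// mulr_ge0.
have := lyapunov_increment_tail (kernel_mass (x, u)) bpsi.1 bphi.1
  (fun u => (pC u).1) (fun u => (pC u).2) u x0 (norm_increment_integrable u x0 xxB) CA'.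
move=> h; apply: (le_trans h); rewrite -mulrA ler_wpM2l//.
apply: tail_moment => //; first exact: measurable_norm_increment.
- exact: norm_increment_integrable.
- by rewrite divr_gt0.
- exact: norm_increment_moment.
Qed.

(** A limit of second moments. Its mean under [pi] is the coefficient of 2 theta - 1 in [delta],
    which is why [delta] is monotone in theta. *)
Lemma increment_variance_ge0 u : 0 <= increment_variance u.
Proof.
apply/ler_addgt0Pr => e e0.
have [x /(_ u)] := filter_ex (increment_square_cvg e0).
have : 0 <= \int[Ks (x, u)]_w ((G w - G (x, u)) ^+ 2) by apply: Rintegral_ge0 => w _; exact: sqr_ge0.
by rewrite ler_norml => h /andP[h1 h2]; lra.
Qed.

Lemma increment_variance_continuous : continuous increment_variance.
Proof.
move=> u; apply: cvgD.
  apply: cvgD; first exact: sigma2_continuous.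
  by apply: cvgM; [exact: cvg_cst|exact: kop_family_continuous].
apply: cvgB; first exact: kop_continuous.
by under eq_fun do rewrite expr2; rewrite expr2; apply: cvgM; exact: psi_continuous.
Qed.

End lyapunov_asymptotics.

Variable pi : probability (borel S) R.
Hypothesis K_pi : unique_invariant_probability K pi.
Hypothesis dd_pi : \int[pi]_u dd u = 0.
Let del := delta K pi Gam ee sigma2 lam.

Let pi1 : (pi : {measure set (borel S) -> \bar R}) setT = 1%E. Proof. exact: prob_setT. Qed.

Let blam f u : bm f -> bm (fun v => lam u v * f v).
Proof. by move=> bf; exact: bmeasM. Qed.

(** The constant contributes [CG u c], which is 0, to the first integral, and 2 c d_u to the second
    one, by [lam_mean]; the latter has mean 0 under [pi]. *)
Lemma delta_translate psi c theta : continuous psi ->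
  del (fun u => psi u + c) theta = del psi theta.
Proof.
move=> cpsi; have bpsi : bm psi by exact: bmeas_continuous.
have bc : bm (fun=> c) := bmeas_cst c.
have bdd : bm dd by exact: bmeas_continuous.
have H1 : \int[pi]_u (ee u + CG u (fun v => psi v + c)) = \int[pi]_u (ee u + CG u psi).
  by apply: eq_Rintegral => u _; rewrite charge_integralD// Gam_cst addr0.
have E u : sigma2 u + 2 * (\int[K u]_v (lam u v * (psi v + c))) =
    sigma2 u + 2 * (\int[K u]_v (lam u v * psi v)) + 2 * c * dd u.
  have -> : \int[K u]_v (lam u v * (psi v + c)) = \int[K u]_v (lam u v * psi v + c * lam u v).
    by apply: eq_Rintegral => v _; ring.
  rewrite (bintD (kmass K u) (blam u bpsi) (bmeasZ c (bl u))) (bintZ (kmass K u) c (bl u)).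
  by rewrite -[\int[K u]_v lam u v]/(kop K (lam u) u) lam_mean; ring.
have b1 : bm (fun u => sigma2 u + 2 * (\int[K u]_v (lam u v * psi v))).
  apply: bmeas_continuous => // u; apply: cvgD; first exact: sigma2_continuous.
  by apply: cvgM; [exact: cvg_cst|exact: kop_family_continuous].
have H2 : \int[pi]_u (sigma2 u + 2 * (\int[K u]_v (lam u v * (psi v + c)))) =
    \int[pi]_u (sigma2 u + 2 * (\int[K u]_v (lam u v * psi v))).
  transitivity (\int[pi]_u (sigma2 u + 2 * (\int[K u]_v (lam u v * psi v)) + 2 * c * dd u)).
    by apply: eq_Rintegral => u _; exact: E.
  by rewrite (bintD pi1 b1 (bmeasZ _ bdd)) (bintZ pi1 _ bdd) dd_pi mulr0 addr0.
by rewrite /del /delta H1 H2.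
Qed.

Lemma increment_variance_pi psi : continuous psi ->
  \int[pi]_u increment_variance psi u =
  \int[pi]_u (sigma2 u + 2 * (\int[K u]_v (lam u v * psi v))).
Proof.
move=> cpsi; have bpsi : bm psi by exact: bmeas_continuous.
have b2 : bm (fun v => psi v ^+ 2).
  by have := bmeasM bpsi bpsi; under eq_fun do rewrite -expr2.
have b1 : bm (fun u => sigma2 u + 2 * (\int[K u]_v (lam u v * psi v))).
  apply: bmeas_continuous => // u; apply: cvgD; first exact: sigma2_continuous.
  by apply: cvgM; [exact: cvg_cst|exact: kop_family_continuous].
have bk : bm (kop K (fun v => psi v ^+ 2)) by exact: bmeas_kop.
rewrite (bintD pi1 b1 (bmeasB bk b2)) (bintB pi1 bk b2).
by rewrite (Rintegral_kop K_pi b2) subrr addr0.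
Qed.

Lemma delta_mono psi theta theta' : poisson_solution K dd psi ->
  theta <= theta' -> del psi theta <= del psi theta'.
Proof.
move=> /(poisson_solutionE S_compact)[cpsi psi_dd] tt'; rewrite /del /delta lerD2l ler_wpM2r//.
  rewrite -increment_variance_pi//; apply: Rintegral_ge0 => u _.
  exact: (increment_variance_ge0 cpsi (@cst_continuous _ _ 0) psi_dd).
by rewrite lerB// ler_wpM2l.
Qed.

Lemma continuous_nonneg_translate (f : S -> R) : continuous f ->
  exists c, forall u, 0 <= f u + c.
Proof.
move=> cf; have [C C0 fC] := compact_bounded_fun S_compact cf.
by exists C => u; have := fC u; rewrite ler_norml => /andP[h _]; rewrite -lerBlDr sub0r.
Qed.

(** All that the classification needs to know about psi and phi: G is the height up to a bounded
    term, G E[D] + (2 theta - 1) / 2 E[D^2] tends to delta / 2 uniformly in the S-coordinate, and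
    truncated second moments decay. *)
Lemma lyapunov_function psi0 theta : poisson_solution K dd psi0 ->
  exists (G : state R S -> R) (s : S -> R) (C B : R),
  [/\ measurable_fun setT G, forall z, `|z.1| + 1 <= G z <= `|z.1| + C,
    0 < C /\ 0 < B, forall u, 0 <= s u <= C &
    forall e, 0 < e -> \forall x \near +oo, forall u, let D w := G w - G (x, u) in
    [/\ (Ks (x, u)).-integrable setT (EFin \o (fun w => D w ^+ 2)),
      `|G (x, u) * \int[Ks (x, u)]_w D w - (del psi0 theta / 2 - (2 * theta - 1) / 2 * s u)| <= e,
      `|\int[Ks (x, u)]_w (D w ^+ 2) - s u| <= e &
      forall A, C <= A -> tail (Ks (x, u)) D A <= B * A `^ (2 - p)]].
Proof.
move=> /(poisson_solutionE S_compact)[cpsi0 psi0_dd].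
have [c0 psi0c] := continuous_nonneg_translate cpsi0.
rewrite -(delta_translate (c0 + 1) theta cpsi0).
(* Translation leaves [delta] unchanged and makes psi at least 1; together with phi >= 0 this keeps
   G at least 1. *)
set psi := fun u => psi0 u + (c0 + 1).
have cpsi : continuous psi by move=> u; apply: cvgD; [exact: cpsi0|exact: cvg_cst].
have bpsi0 : bm psi0 by exact: bmeas_continuous.
have bpsi : bm psi by exact: bmeas_continuous.
have psi_dd u : psi u - kop K psi u = dd u.
  have -> : kop K psi u = kop K psi0 u + (c0 + 1).
    by rewrite /psi (kopD K bpsi0 (bmeas_cst (c0 + 1)))/= (congr1 (@^~ u) (kop_cst K _)).
  by rewrite -psi0_dd /psi; ring.
have psi1 u : 1 <= psi u by rewrite /psi addrA lerDr.
pose s := increment_variance psi.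
have cs : continuous s by exact: increment_variance_continuous.
pose et u := ee u + CG u psi.
have cet : continuous et.
  by move=> u; apply: cvgD; [exact: ee_continuous|exact: charge_integral_continuous].
(* [et] is the limit of G E[D] without phi. With phi solving the Poisson equation for h minus its
   mean, G E[D] + (2 theta - 1) / 2 E[D^2] converges to that mean, which is delta / 2. *)
pose h u := et u + (2 * theta - 1) / 2 * s u.
have ch : continuous h by move=> u; apply: cvgD; [exact: cet|apply: cvgM; [exact: cvg_cst|exact: cs]].
have bet : bm et by exact: bmeas_continuous.
have bs : bm s by exact: bmeas_continuous.
have bh : bm h by exact: bmeas_continuous.
have pih : \int[pi]_u h u = del psi theta / 2.
  rewrite (bintD pi1 bet (bmeasZ _ bs)) (bintZ pi1 _ bs) /s increment_variance_pi//.
  by rewrite /del /delta -/et; field.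
pose hc u := h u - del psi theta / 2.
have chc : continuous hc by move=> u; apply: cvgB; [exact: ch|exact: cvg_cst].
have hc_pi : \int[pi]_u hc u = 0.
  by rewrite (bintB pi1 bh (bmeas_cst _)) (bint_cst pi1) pih subrr.
have [phi0 [cphi0 phi0_h]] := poisson_exists S_compact K_continuous K_pi chc hc_pi.
have [c1 phi0c] := continuous_nonneg_translate cphi0.
pose phi u := phi0 u + c1.
have cphi : continuous phi by move=> u; apply: cvgD; [exact: cphi0|exact: cvg_cst].
have bphi0 : bm phi0 by exact: bmeas_continuous.
have phi_h u : phi u - kop K phi u = hc u.
  have -> : kop K phi u = kop K phi0 u + c1.
    by rewrite /phi (kopD K bphi0 (bmeas_cst c1))/= (congr1 (@^~ u) (kop_cst K _)).
  by rewrite -phi0_h /phi; ring.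
have phi0' u : 0 <= phi u by exact: phi0c.
have [Cs Cs0 sC] := compact_bounded_fun S_compact cs.
have [Cp Cp0 pC] := compact_bounded_fun S_compact cpsi.
have [Cf Cf0 fC] := compact_bounded_fun S_compact cphi.
have [Ct Ct0 tC] := increment_tail cpsi cphi.
exists (lyapunov psi phi), s, (Cs + Cp + Cf + Ct), (4 * `|Bp| * 2^-1 `^ (2 - p) + 1); split.
- by apply: measurable_lyapunov; apply: continuous_borel.
- move=> z; have i0 : 0 < (`|z.1| + 1)^-1 by rewrite invr_gt0 ltr_wpDl.
  have i1 : (`|z.1| + 1)^-1 <= 1 by rewrite invf_le1 ?lerDr// ltr_wpDl.
  have h1 : 0 <= phi z.2 / (`|z.1| + 1) by rewrite mulr_ge0// ltW.
  have h2 : phi z.2 / (`|z.1| + 1) <= phi z.2 by rewrite ler_piMr.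
  have h3 := psi1 z.2; have h4 := le_trans (ler_norm _) (pC z.2).
  have h5 := le_trans (ler_norm _) (fC z.2).
  by rewrite /lyapunov; move: (phi z.2 / _) h1 h2 => t h1 h2; apply/andP; split; lra.
- by split; rewrite ltr_wpDl// ?addr_ge0// !mulr_ge0// powR_ge0.
- move=> u; have su := le_trans (ler_norm _) (sC u).
  rewrite (increment_variance_ge0 cpsi (@cst_continuous _ _ 0) psi_dd)/=.
  by rewrite (le_trans su)//; lra.
move=> e e0.
have M1 := increment_mean_cvg cpsi cphi psi_dd e0.
have M2 := increment_square_cvg cpsi cphi psi_dd e0.
apply: filterS2 (filterI near_valid M1) M2 => x [[x0 xxB] H1] H2 u /=; split.
- exact: increment_integrable.
- have := H1 u; congr (`|_ - _| <= _).
  by rewrite -[kop K phi u - phi u]opprB phi_h /hc /h /et; ring.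
- exact: H2.
move=> A CA.
have A0 : 0 < A by rewrite (lt_le_trans _ CA)// ltr_wpDl// !addr_ge0.
have CtA : Ct <= A by rewrite (le_trans _ CA)// lerDr !addr_ge0.
apply: (le_trans (tC x u A x0 xxB CtA)).
rewrite powRM ?invr_ge0 ?(ltW A0)// [A `^ _ * _]mulrC mulrA.
apply: ler_wpM2r; first exact: powR_ge0.
rewrite (le_trans _ (_ : 4 * `|Bp| * 2^-1 `^ (2 - p) <= _)) ?lerDl//.
by rewrite ler_wpM2r ?powR_ge0// ler_wpM2l// ler_norm.
Qed.

End kernel_asymptotics.

(** * Classification *)

Section passage_monotone.
Context {R : realType} {S : pointedMetricType R}.
Context {d : measure_display} {Omega : measurableType d}.
Variables (P : probability Omega R) (F : nat -> set (set Omega)).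
Variables (Ks : R.-pker (state R S) ~> (state R S)) (z0 : state R S).
Variable xi : nat -> Omega -> state R S.
Hypothesis process : half_strip_process P F Ks z0 xi.

Lemma passage_antimono (r r' : R) : r <= r' ->
  (\int[P]_w passage xi r' w <= \int[P]_w passage xi r w)%E.
Proof.
move=> rr'; rewrite !(integral_passage process); apply: lee_nneseries => // k _.
apply: le_measure; rewrite ?inE; [exact: (measurable_above process)..|].
by move=> w /aboveP H; apply/aboveP => j jk; rewrite (le_lt_trans rr')// H.
Qed.

End passage_monotone.

Section lyapunov_classification.
Context {R : realType} {S : pointedMetricType R}.
Variable Ks : R.-pker (state R S) ~> (state R S).
Variables (G : state R S -> R) (s : S -> R) (C B dl theta p : R).
Hypotheses (p_gt2 : 2 < p) (mG : measurable_fun setT G).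
Hypothesis G_norm : forall z, `|z.1| + 1 <= G z <= `|z.1| + C.
Hypotheses (C_gt0 : 0 < C) (B_gt0 : 0 < B).
Hypothesis s_bounded : forall u, 0 <= s u <= C.
Hypothesis G_drift : forall e, 0 < e -> \forall x \near +oo, forall u, let D w := G w - G (x, u) in
    [/\ (Ks (x, u)).-integrable setT (EFin \o (fun w => D w ^+ 2)),
      `|G (x, u) * \int[Ks (x, u)]_w D w - (dl / 2 - (2 * theta - 1) / 2 * s u)| <= e,
      `|\int[Ks (x, u)]_w (D w ^+ 2) - s u| <= e &
      forall A, C <= A -> tail (Ks (x, u)) D A <= B * A `^ (2 - p)].

Let D z w := G w - G z.
Let m1 z := \int[Ks z]_w D z w.
Let m2 z := \int[Ks z]_w (D z w ^+ 2).

Let Ks1 z : Ks z setT = 1%E. Proof. exact: prob_kernel. Qed.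

Let G1 z : 1 <= G z.
Proof. by have /andP[h _] := G_norm z; rewrite (le_trans _ h)// lerDr. Qed.

Let GD1 z w : 1 <= G z + D z w. Proof. by rewrite /D addrC subrK. Qed.

Let G_le z c : half_strip z -> z.1 <= c -> G z <= Num.max 1 (c + C).
Proof.
move=> z0 zc; have /andP[_ h] := G_norm z; rewrite le_max; apply/orP; right.
by rewrite (le_trans h)// ger0_norm// lerD2r.
Qed.

Let G_ge z : z.1 <= G z.
Proof. by have /andP[h _] := G_norm z; have := ler_norm z.1; lra. Qed.

Let mD z : measurable_fun setT (D z). Proof. exact: measurable_funB. Qed.

(** Since [tail] at level c G is of order G^(2 - p), it still tends to 0 after multiplication by
    G^g. A positive g serves the negative powers of G; elsewhere g is 0. The term C / c in [r0]
    brings c G above the threshold of the tail bound. *)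
Let drift_near (e c g : R) : 0 < e -> 0 < c -> g < p - 2 ->
  exists2 r0, 0 <= r0 & forall z, half_strip z -> r0 < z.1 ->
    [/\ (Ks z).-integrable setT (EFin \o (fun w => D z w ^+ 2)),
      `|G z * m1 z - (dl / 2 - (2 * theta - 1) / 2 * s z.2)| <= e,
      `|m2 z - s z.2| <= e & G z `^ g * tail (Ks z) (D z) (c * G z) <= e].
Proof.
move=> e0 c0 gp.
have q0 : 2 - p + g < 0 by lra.
have Bc0 : 0 < B * c `^ (2 - p) by rewrite mulr_gt0// powR_gt0.
have e1 : 0 < e / (B * c `^ (2 - p)) by rewrite divr_gt0.
have [M1 [_ H1]] := G_drift e0; have [M2 [_ H2]] := powR_lt0_small q0 e1.
exists (`|M1| + `|M2| + C / c); first by rewrite !addr_ge0// divr_ge0// ltW.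
have Cc : 0 < C / c by rewrite divr_gt0.
move=> [x u] /= x0 rx.
have := ler_norm M1; have := ler_norm M2; have := normr_ge0 M1; have := normr_ge0 M2.
move=> n2 n1 l2 l1.
have [i h1 h2 ht] := H1 x ltac:(lra) u; split => //.
have Gx : x <= G (x, u) by exact: (G_ge (x, u)).
have G0 : 0 < G (x, u) by rewrite (lt_le_trans _ (G1 _)).
have hM := H2 (G (x, u)) ltac:(lra).
have CG : C <= c * G (x, u) by rewrite mulrC -ler_pdivrMr//; lra.
have := ht _ CG; rewrite powRM ?(ltW c0) ?(ltW G0)// => {}ht.
apply: (le_trans (ler_wpM2l (powR_ge0 _ _) ht)).
apply: le_trans (_ : B * c `^ (2 - p) * (G (x, u) `^ (2 - p + g)) <= _); last first.
  by rewrite -ler_pdivlMl// mulrC.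
have -> : G (x, u) `^ (2 - p + g) = G (x, u) `^ (2 - p) * G (x, u) `^ g.
  by rewrite powRD// (gt_eqF G0) implybT.
by rewrite mulrC !mulrA.
Qed.

(** [r0] is produced from the kernel before any process is given, so that one level serves all
    initial states. *)
Lemma lyapunov_recurrent : theta = 0 -> dl < 0 -> exists2 r0, 0 <= r0 &
  forall (d : measure_display) (Omega : measurableType d) (P : probability Omega R)
    (F : nat -> set (set Omega)) (z0 : state R S) (xi : nat -> Omega -> state R S),
  half_strip_process P F Ks z0 xi ->
  {ae P, forall w, limn_esup (fun n => ((xi n w).1)%:E) = +oo%E} ->
  {ae P, forall w, (limn_einf (fun n => ((xi n w).1)%:E) <= r0%:E)%E}.
Proof.
move=> th0 dl0.
(* For theta = 0 the quantity G m1 - m2 / 2 is close to dl / 2; these choices keep the approximation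
   errors, eta m2 and the tail below half of - dl in total. The 1 in [e] gives m2 <= C + 1. *)
pose e := Num.min 1 (- dl / 16); pose eta := Num.min 1 (- dl / (8 * (C + 1))).
have e0 : 0 < e by rewrite lt_min ltr01/= divr_gt0// oppr_gt0.
have C1 : 0 < 8 * (C + 1) by rewrite mulr_gt0// addr_gt0.
have eta0 : 0 < eta by rewrite lt_min ltr01/= divr_gt0// oppr_gt0.
have eta1 : eta <= 1 by rewrite ge_min lexx.
have e1 : e <= 1 by rewrite ge_min lexx.
have e2 : e <= - dl / 16 by rewrite ge_min lexx orbT.
have eta2 : eta * (C + 1) <= - dl / 8.
  rewrite -ler_pdivlMr ?addr_gt0// (le_trans (_ : _ <= - dl / (8 * (C + 1)))) ?ge_min ?lexx ?orbT//.
  by rewrite invfM mulrA.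
have g0 : 0 < p - 2 by rewrite subr_gt0.
have [r0 r00 H] := drift_near e0 eta0 g0; exists r0 => // d Omega P F z0 xi process xi_esup.
apply: (@recurrence_criterion _ _ _ _ _ _ _ _ _ process (fun z => ln (G z))
  _ _ (fun c => ln (Num.max 1 (c + C))) r0) => //.
- by apply: (measurableT_comp _ mG); exact: measurable_ln.
- by move=> z; exact: ln_ge0.
- move=> z zs zr; have [i h1 h2 h3] := H z zs zr.
  have := @ln_step _ _ _ _ (Ks1 z) _ (mD z) i (G z) (G1 z) (GD1 z) eta.
  rewrite eta0 eta1 => /(_ isT).
  under eq_integral do rewrite /D [G z + _]addrC subrK.
  apply; move: h1 h2 h3; rewrite th0 powRr0 mul1r !ler_norml => /andP[h11 h12] /andP[h21 h22] h3.
  rewrite -/(m1 z) -/(m2 z).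
  have m2C : m2 z <= C + 1 by have /andP[_ sC] := s_bounded z.2; lra.
  have : eta * m2 z <= eta * (C + 1) by rewrite ler_wpM2l// ltW.
  by lra.
- by move=> c; rewrite ln_ge0// le_max lexx.
- move=> c z zs zc; rewrite ler_ln ?posrE; first exact: G_le.
    by rewrite (lt_le_trans _ (G1 z)).
  by rewrite lt_max ltr01.
- move=> N; exists (expR N) => z zs zN.
  by rewrite -[N]expRK ler_ln ?posrE ?expR_gt0// ?(le_trans zN)// (lt_le_trans _ (G1 z)).
Qed.

Lemma lyapunov_transient (d : measure_display) (Omega : measurableType d)
    (P : probability Omega R) (F : nat -> set (set Omega)) (z0 : state R S)
    (xi : nat -> Omega -> state R S) :
  theta = 0 -> 0 < dl -> half_strip_process P F Ks z0 xi ->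
  {ae P, forall w, limn_esup (fun n => ((xi n w).1)%:E) = +oo%E} ->
  {ae P, forall w, (xi n w).1 @[n --> \oo] --> +oo}.
Proof.
move=> th0 dl0 process xi_esup.
have C1 : 0 < C + 1 by rewrite addr_gt0.
(* The three bounds serve the range of [powRN_step], the decay of G^g times the tail, and the
   estimate 8 g^2 m2 <= g dl / 16. *)
pose g := Num.min (2^-1) (Num.min ((p - 2) / 2) (dl / (128 * (C + 1)))).
have g0 : 0 < g.
  by rewrite !lt_min invr_gt0 ltr0n/= !divr_gt0 ?subr_gt0// mulr_gt0.
have g1 : g <= 2^-1 by rewrite ge_min lexx.
have gp : g < p - 2.
  have : g <= (p - 2) / 2 by rewrite !ge_min lexx !orbT.
  by move=> h; lra.
have gC : g * (C + 1) <= dl / 128.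
  rewrite -ler_pdivlMr// (le_trans (_ : _ <= dl / (128 * (C + 1)))) ?ge_min ?lexx ?orbT//.
  by rewrite invfM mulrA.
(* [e] is proportional to [g] because the tail at level G / 2 competes with a gain of only g dl / 4;
   eta <= 1 / 2 makes that tail no larger than the one at eta G. *)
pose e := Num.min 1 (g * (dl / 64)); pose eta := Num.min (2^-1) (dl / (8 * (C + 1))).
have e0 : 0 < e by rewrite lt_min ltr01/= mulr_gt0// divr_gt0.
have eta0 : 0 < eta by rewrite lt_min invr_gt0 ltr0n/= divr_gt0// mulr_gt0.
have eta1 : eta <= 2^-1 by rewrite ge_min lexx.
have eta1' : eta <= 1 by lra.
have e1 : e <= 1 by rewrite ge_min lexx.
have e2 : e <= g * (dl / 64) by rewrite ge_min lexx orbT.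
have eta2 : eta * (C + 1) <= dl / 8.
  rewrite -ler_pdivlMr// (le_trans (_ : _ <= dl / (8 * (C + 1)))) ?ge_min ?lexx ?orbT//.
  by rewrite invfM mulrA.
have [r0 r00 H] := drift_near e0 eta0 gp.
apply: (@transience_criterion _ _ _ _ _ _ _ _ _ process (fun z => G z `^ (- g)) _ _ r0) => //.
- by apply: (measurableT_comp (measurable_powR _)); exact: mG.
- by move=> z; exact: powR_ge0.
- move=> z zs zr; have [i h1 h2 h3] := H z zs zr.
  have := @powRN_step _ _ _ _ (Ks1 z) _ (mD z) i (G z) (G1 z) (GD1 z) g eta.
  rewrite eta0 eta1' g0 g1 => /(_ isT isT).
  under eq_integral do rewrite /D [G z + _]addrC subrK.
  apply; move: h1 h2; rewrite th0 !ler_norml => /andP[h11 h12] /andP[h21 h22].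
  rewrite -/(m1 z) -/(m2 z).
  have G0 : 0 < G z by rewrite (lt_le_trans _ (G1 z)).
  have t0 : 0 <= tail (Ks z) (D z) (eta * G z) by exact: tail_ge0.
  have t1 : tail (Ks z) (D z) (G z / 2) <= tail (Ks z) (D z) (eta * G z).
    by apply: (tail_le (mD z) i); rewrite mulrC ler_wpM2l// ltW.
  have G1g : 1 <= G z `^ g.
    by rewrite -(powRr0 (G z)) ler_powR// ltW.
  have t2 : tail (Ks z) (D z) (eta * G z) <= e by apply: le_trans h3; rewrite ler_peMl.
  have t3 : G z `^ g * tail (Ks z) (D z) (G z / 2) <= e.
    by apply: le_trans h3; rewrite ler_wpM2l// powR_ge0.
  have m2C : m2 z <= C + 1 by have /andP[_ sC] := s_bounded z.2; lra.
  have m2e : eta * m2 z <= eta * (C + 1) by rewrite ler_wpM2l// ltW.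
  have m2g : g ^+ 2 * m2 z <= g * (dl / 128).
    by rewrite expr2 -mulrA ler_wpM2l ?(ltW g0)// (le_trans _ gC)// ler_wpM2l// ltW.
  have gd : g * (dl / 64) <= dl / 128 by have := mulr_ge0 (ltW dl0) (_ : 0 <= 2^-1 - g); lra.
  have : g * (dl / 4) <= g * (G z * m1 z - m2 z / 2 - eta * m2 z - tail (Ks z) (D z) (eta * G z)).
    by apply: ler_wpM2l; [exact: (ltW g0)|lra].
  by lra.
- move=> r; exists (Num.max 1 (r + C) `^ (- g)); first by rewrite powR_gt0// lt_max ltr01.
  move=> z zs zr; rewrite !powRN lef_pV2 ?posrE ?powR_gt0 ?lt_max ?ltr01//; last first.
    by rewrite (lt_le_trans _ (G1 z)).
  apply: ge0_ler_powR; rewrite ?nnegrE ?(ltW g0)//; last exact: G_le.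
    by rewrite (le_trans _ (G1 z)).
  by rewrite le_max ler01.
- move=> a a0; have ng0 : - g < 0 by rewrite oppr_lt0.
  have [M [_ HM]] := powR_lt0_small ng0 a0.
  exists (M + 1) => z zs zM; apply: HM.
  by apply: lt_le_trans (G_ge z); apply: lt_le_trans zM; rewrite ltrDl.
Qed.

Lemma lyapunov_positive_recurrent : theta = 1 -> dl < 0 -> exists2 r1, 0 <= r1 &
  forall (d : measure_display) (Omega : measurableType d) (P : probability Omega R)
    (F : nat -> set (set Omega)) (z0 : state R S) (xi : nat -> Omega -> state R S),
  half_strip_process P F Ks z0 xi ->
  forall r, r1 <= r -> (\int[P]_w passage xi r w < +oo)%E.
Proof.
(* For theta = 1, 2 G m1 + m2 differs from [dl] by at most 3 e, which is half of - dl. *)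
move=> th1 dl0; pose e := - dl / 6.
have e0 : 0 < e by rewrite divr_gt0// oppr_gt0.
have g0 : 0 < p - 2 by rewrite subr_gt0.
have [r1 r10 H] := drift_near e0 ltr01 g0; exists r1 => // d Omega P F z0 xi process r rr.
apply: (passage_finite process (V := fun z => G z ^+ 2) (e := - dl / 2)) => //.
- by rewrite divr_gt0// oppr_gt0.
- exact: measurable_funX.
- by move=> z; exact: sqr_ge0.
move=> z zs zr; have [i h1 h2 _] := H z zs (le_lt_trans rr zr).
have := @sqr_step _ _ _ _ (Ks1 z) _ (mD z) i (G z) (- dl / 2).
under eq_integral do rewrite /D [G z + _]addrC subrK.
apply; move: h1 h2; rewrite th1 !ler_norml => /andP[h11 h12] /andP[h21 h22].
by rewrite -/(m1 z) -/(m2 z) -mulrA /e in h11 h12 h21 h22 *; lra.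
Qed.

Lemma lyapunov_null_recurrent : theta = 1 -> 0 < dl -> forall r, 0 <= r -> exists2 r1, r < r1 &
  forall (d : measure_display) (Omega : measurableType d) (P : probability Omega R)
    (F : nat -> set (set Omega)) (z0 : state R S) (xi : nat -> Omega -> state R S),
  half_strip_process P F Ks z0 xi -> r1 < z0.1 -> (\int[P]_w passage xi r w = +oo)%E.
Proof.
move=> th1 dl0 r r_ge0.
have C1 : 0 < C + 1 by rewrite addr_gt0.
(* Then 10 eta^2 m2 and twice the tail are each at most dl / 16, while a quarter of 2 G m1 + m2,
   which is within 3 e of [dl], exceeds dl / 8. *)
pose e := Num.min 1 (dl / 32); pose eta := Num.min 1 (dl / (160 * (C + 1))).
have e0 : 0 < e by rewrite lt_min ltr01/= divr_gt0.
have eta0 : 0 < eta by rewrite lt_min ltr01/= divr_gt0// mulr_gt0.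
have eta1 : eta <= 1 by rewrite ge_min lexx.
have e1 : e <= 1 by rewrite ge_min lexx.
have e2 : e <= dl / 32 by rewrite ge_min lexx orbT.
have eta2 : eta * (C + 1) <= dl / 160.
  rewrite -ler_pdivlMr// (le_trans (_ : _ <= dl / (160 * (C + 1)))) ?ge_min ?lexx ?orbT//.
  by rewrite invfM mulrA.
have g0 : 0 < p - 2 by rewrite subr_gt0.
have [r0 r00 H] := drift_near e0 ltr01 g0.
(* Passage below the higher level [r'] comes no later, so it suffices that its mean is infinite. A
   start above r' + C has G larger than r' + C, which bounds G on the states at or below [r']. *)
pose r' := Num.max r r0; have rr' : r <= r' by rewrite le_max lexx.
exists (r' + C); first by rewrite (le_lt_trans rr')// ltrDl.
move=> d Omega P F z0 xi process zr.
have r'0 : 0 <= r' by rewrite (le_trans r_ge0).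
apply/eqP; rewrite -leye_eq (le_trans _ (passage_antimono process rr'))// leye_eq; apply/eqP.
apply: (passage_infinite process (G := G) (rho := r' + C) (eta := eta) (B := 4 * (C + 1))) => //.
- by move=> z; rewrite (le_trans _ (G1 z)).
- by rewrite mulr_ge0// ltW.
- by rewrite addr_ge0// ltW.
- move=> z zs zr'; have /andP[_ h] := G_norm z.
  by rewrite (le_trans h)// ger0_norm// lerD2r.
- exact: lt_le_trans zr (G_ge z0).
move=> N N1 z zs zr'.
have r0r' : r0 <= r' by rewrite le_max lexx orbT.
have [i h1 h2 h3] := H z zs (le_lt_trans r0r' zr').
have := @capped_step _ _ _ _ (Ks1 z) _ (mD z) i (G z) (G1 z) (GD1 z) N eta (4 * (C + 1)) N1.
rewrite eta0 eta1 => /(_ isT).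
under eq_integral do rewrite /D [G z + _]addrC subrK.
move=> h; have -> : (\1_[set y | (eta * N < G y)%R] z : R) = (eta * N < G z)%R%:R.
  by rewrite indicE; congr (nat_of_bool _)%:R; apply/idP/idP; rewrite inE.
move: h1 h2 h3; rewrite th1 powRr0 !mul1r !ler_norml => /andP[h11 h12] /andP[h21 h22] h3.
have m2C : m2 z <= C + 1 by have /andP[_ sC] := s_bounded z.2; lra.
have m20 : 0 <= m2 z by apply: Rintegral_ge0 => w _; exact: sqr_ge0.
have m2e : eta ^+ 2 * m2 z <= dl / 160.
  apply: le_trans eta2; rewrite expr2 -mulrA; apply: ler_wpM2l; first exact: ltW.
  by apply: le_trans m2C; exact: ler_piMl.
apply: h; rewrite -/(m1 z) -/(m2 z) -?[2 * G z * m1 z]mulrA; lra.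
Qed.

End lyapunov_classification.

Theorem theorem2p5 (R : realType) (S : pointedMetricType R)
  (S_compact : compact [set: S])
  (* the Markov process on the half-strip, for every initial state z *)
  (Ks : R.-pker (state R S) ~> (state R S))
  (Ks_strip : half_strip_kernel Ks)
  (d : measure_display) (Omega : state R S -> measurableType d)
  (P : forall z, probability (Omega z) R)
  (F : forall z, nat -> set (set (Omega z)))
  (xi : forall z, nat -> Omega z -> state R S)
  (xi_process : forall z, half_strip z ->
    half_strip_process (P z) (F z) Ks z (@xi z))
  (* non-confinement *)
  (xi_non_confined : non_confined P xi)
  (* limiting kernel *)
  (K : R.-pker (borel S) ~> (borel S)) (pi : probability (borel S) R)
  (K_pi : unique_invariant_probability K pi)
  (K_continuous : tv_continuous (fun u : S => kcharge K u))
  (* strong asymptotic Markovianity *)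
  (Gam : S -> {charge set (borel S) -> \bar R})
  (Gam_continuous : tv_continuous Gam)
  (Ks_K_Gam : sup_littleo
    (fun (x : R) (u : S) => tv_norm
      (cadd (cadd (kcharge (marginal Ks) (x, u)) (copp (kcharge K u)))
            (copp (cscale x^-1 (Gam u)))))
    (fun x => x^-1))
  (* moments *)
  (p q xB Bp Bq : R) (p_gt2 : 2 < p) (q_gt0 : 0 < q) (xB_ge0 : 0 <= xB)
  (moment_p : forall z, half_strip z -> forall n,
    cond_exp_le_on (P z) (F z n)
      (fun w => (`|(xi z n.+1 w).1 - (xi z n w).1| `^ p)%:E)
      [set w | xB <= (xi z n w).1] Bp)
  (moment_q : forall z, half_strip z -> forall n,
    cond_exp_le_on (P z) (F z n)
      (fun w => (`|(xi z n.+1 w).1| `^ q)%:E)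
      [set w | (xi z n w).1 < xB] Bq)
  (* Lamperti regime; dd, ee, sigma2 are d, e, sigma^2 *)
  (dd ee sigma2 : S -> R)
  (dd_continuous : continuous dd) (ee_continuous : continuous ee)
  (sigma2_continuous : continuous sigma2)
  (mu1_dd_ee : sup_littleo
    (fun (x : R) (u : S) =>
      `|increment_moment Ks 1 x u - (dd u + ee u / x)%:E|%E)
    (fun x => x^-1))
  (mu2_sigma2 : sup_littleo
    (fun (x : R) (u : S) => `|increment_moment Ks 2 x u - (sigma2 u)%:E|%E)
    (fun=> 1))
  (dd_pi : \int[pi]_u dd u = 0)
  (* conditional drifts; L is a regular conditional distribution of the
     next first coordinate given the current state and next S-coordinate *)
  (L : R.-pker (state R S * borel S) ~> R) (L_Ks : disintegrates Ks L)
  (lam : S -> S -> R) (lam_bounded : forall u, bounded_measurable (lam u))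
  (lam_continuous : forall u, sup_dist (lam v) (lam u) @[v --> u] --> 0%E)
  (drift_lam : ereal_sup
      [set `|cond_drift L x uv.1 uv.2 - (lam uv.1 uv.2)%:E|%E |
        uv in [set: S * S]] @[x --> +oo] --> 0%E) :
  [/\ (exists psi, poisson_solution K dd psi /\
        forall phi, poisson_solution K dd phi <->
          exists c, phi = (fun u => psi u + c)),
      (forall psi, poisson_solution K dd psi ->
        let del := delta K pi Gam ee sigma2 lam in
        [/\ (forall c theta, del (fun u => psi u + c) theta = del psi theta),
            (forall theta theta', theta <= theta' ->
              del psi theta <= del psi theta'),
            (* *)
            (0 < del psi 0 -> transient P xi) /\
            (del psi 0 < 0 -> recurrent P xi) &
            (* *)
            2 <= q ->
            (del psi 1 < 0 -> positive_recurrent P xi) /\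
            (del psi 0 < 0 -> 0 < del psi 1 -> null_recurrent P xi)]) &
      ereal_sup [set tv_norm (cadd (kcharge (kiter K n) u)
                                   (copp (charge_of_finite_measure pi))) |
                 u in [set: S]] @[n --> \oo] --> 0%E ->
      (forall u, cvgn (series (fun n => \int[kiter K n u]_v dd v))) /\
      poisson_solution K dd
        (fun u => limn (series (fun n => \int[kiter K n u]_v dd v)))].
Proof.
have moment z : half_strip z -> xB <= z.1 ->
    (\int[Ks z]_w (`|w.1 - z.1| `^ p)%:E <= Bp%:E)%E.
  by move=> z0 xBz; exact: moment_kernel (xi_process z z0) (moment_p z z0 0%N) xBz.
split.
- have [psi [cpsi psi_dd]] := poisson_exists S_compact K_continuous K_pi dd_continuous dd_pi.
  have psiP : poisson_solution K dd psi by apply/(poisson_solutionE S_compact).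
  exists psi; split => // phi; split.
    move=> /(poisson_solutionE S_compact)[cphi phi_dd].
    by apply: (poisson_unique S_compact K_continuous K_pi) => // u; rewrite phi_dd psi_dd.
  move=> [c ->]; split; first by move=> u; apply: cvgD; [exact: cpsi|exact: cvg_cst].
  move=> u; rewrite -(psiP.2 u); apply: eq_Rintegral => v _.
  by rewrite opprD addrACA subrr addr0.
- move=> psi psiP del; have [cpsi _] := psiP.
  have KP theta := lyapunov_function S_compact Ks_strip p_gt2 moment dd_continuous
    ee_continuous sigma2_continuous mu1_dd_ee mu2_sigma2 Gam_continuous K_continuous
    Ks_K_Gam L_Ks lam_bounded lam_continuous drift_lam K_pi dd_pi theta psiP.
  (* Two Lyapunov functions, since phi depends on theta: theta = 0 decides between transience and
     recurrence, theta = 1 between finite and infinite mean passage times. *)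
  have [G0 [s0 [C0 [B0 [mG0 G0_norm [C0_gt0 B0_gt0] s0_bounded G0_drift]]]]] := KP 0.
  have [G1 [s1 [C1 [B1 [mG1 G1_norm [C1_gt0 B1_gt0] s1_bounded G1_drift]]]]] := KP 1.
  split.
  + move=> c theta; exact: (delta_translate S_compact Ks_strip p_gt2 moment dd_continuous
      ee_continuous sigma2_continuous mu1_dd_ee Gam_continuous K_continuous
      Ks_K_Gam L_Ks lam_bounded lam_continuous drift_lam dd_pi).
  + move=> theta theta'; exact: (delta_mono S_compact Ks_strip p_gt2 moment
      ee_continuous sigma2_continuous mu1_dd_ee mu2_sigma2 Gam_continuous K_continuous
      Ks_K_Gam L_Ks lam_bounded lam_continuous drift_lam K_pi psiP).
  + split=> del0.
      move=> z z0; apply: (lyapunov_transient p_gt2 mG0 G0_norm C0_gt0 B0_gt0 s0_bounded G0_drift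
        erefl del0 (xi_process z z0)).
      exact: xi_non_confined.
    have [r0 r0_ge0 H] := lyapunov_recurrent p_gt2 mG0 G0_norm C0_gt0 B0_gt0 s0_bounded G0_drift
      erefl del0.
    exists r0 => // z z0; apply: H (xi_process z z0) _; exact: xi_non_confined.
  move=> _; split=> [del1|_ del1].
    have [r1 r1_ge0 H] := lyapunov_positive_recurrent p_gt2 mG1 G1_norm C1_gt0 B1_gt0 G1_drift
      erefl del1.
    by exists r1 => // r r1r z z0; exact: H (xi_process z z0) r r1r.
  move=> r r_ge0.
  have [r1 rr1 H] := lyapunov_null_recurrent p_gt2 mG1 G1_norm C1_gt0 B1_gt0 s1_bounded G1_drift
    erefl del1 r_ge0.
  by exists r1 => // z z0 zr; exact: H (xi_process z z0) zr.
- by move=> K_pi_tv; exact: (poisson_series S_compact K_continuous K_pi dd_continuous dd_pi K_pi_tv).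
Qed.
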